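(* Let $n\ge 4$. There is a one-to-one correspondence between cluster tilting objects in the Grassmannian cluster category $\mathcal{C}(2,n)$ and Conway--Coxeter friezes of width $n-3$. In particular, each such Conway--Coxeter frieze is obtained by applying the cluster character to the entries of the Auslander--Reiten quiver of $\mathcal{C}(2,n)$ (and forgetting the arrows in the quiver plus adding a top and a bottom row of $0$'s to each frieze).
   Context: **The category.** Let $n\ge 4$. Let $C_n=\langle\zeta\in\mathbb{C}^*:\zeta^n=1\rangle$, with $\zeta$ a primitive $n$-th root of unity, act by $x\mapsto\zeta x$, $y\mapsto\zeta^{-1}y$ on $R=\mathbb{C}[[x,y]]/\langle x^2-y^{n-2}\rangle$. The invariant subring relevant here is $Z=\mathbb{C}[[t]]$ with $t=xy$. The Grassmannian cluster category $\mathcal{C}(2,n)$ is the category of $C_n$-equivariant maximal Cohen--Macaulay $R$-modules, equivalently of maximal Cohen--Macaulay modules over the skew group ring $C_n*R$ (finitely generated modules that are free over $Z$). It is a Krull--Schmidt Frobenius exact category and is stably $2$-Calabi--Yau. **Indecomposables and Auslander--Reiten quiver.** The isomorphism classes of indecomposable objects are in bijection with $2$-subsets $\{a,b\}$ of $\{1,\dots,n\}$; the corresponding module is written $M_{a,b}=M_{b,a}$, with indices read modulo $n$. The indecomposable projective-injectives are $M_{i,i+1}$, $i=1,\dots,n$ (so $M_{n,n+1}=M_{1,n}$). The vertices of the Auslander--Reiten quiver are the indecomposable objects and its arrows are the irreducible maps. It is drawn as an array continuing periodically in both horizontal directions, whose $d$-th row ($1\le d\le n-1$) consists of the $M_{i,i+d}$,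 $i\in\mathbb{Z}$. **Cluster tilting objects.** An object $T$ of $\mathcal{C}(2,n)$ is cluster tilting if $\operatorname{add}(T)=\{X:\operatorname{Ext}^1(X,T')=0 \text{ for all } T'\in\operatorname{add}(T)\}=\{X:\operatorname{Ext}^1(T',X)=0 \text{ for all } T'\in\operatorname{add}(T)\}$, with $\operatorname{Ext}^1$ taken in $\mathcal{C}(2,n)$. Cluster tilting objects are taken with pairwise non-isomorphic indecomposable summands and up to isomorphism; each has the form $T=\bigoplus_{l=1}^{n-3}M_{i_l,j_l}\oplus\bigoplus_{l=1}^{n}M_{l,l+1}$ with the $M_{i_l,j_l}$ not projective-injective. **Cluster character.** For such $T$, the cluster character is a map $\mathbb{X}_T$ from the objects of $\mathcal{C}(2,n)$ to the field $\mathbb{Q}(p_{i_1,j_1},\dots,p_{i_{n-3},j_{n-3}},p_{1,2},\dots,p_{n-1,n},p_{1,n})$ of rational functions in $2n-3$ variables (one for each indecomposable summand of $T$), satisfying: (a) $\mathbb{X}_T(M)=\mathbb{X}_T(N)$ if $M\cong N$; (b) $\mathbb{X}_T(M\oplus N)=\mathbb{X}_T(M)\,\mathbb{X}_T(N)$; (c) if $\dim_{\mathbb{C}}\operatorname{Ext}^1(N,M)=1$ and $0\to N\to L\to M\to 0$ and $0\to M\to L'\to N\to 0$ are nonsplit exact sequences, then $\mathbb{X}_T(M)\,\mathbb{X}_T(N)=\mathbb{X}_T(L)+\mathbb{X}_T(L')$; and $\mathbb{X}_T(M_{i_l,j_l})=p_{i_l,j_l}$, $\mathbb{X}_T(M_{l,l+1})=p_{l,l+1}$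 (with $p_{n,n+1}=p_{1,n}$). It is the Fu--Keller type cluster character, which exists for $\mathcal{C}(2,n)$. **Friezes.** A Conway--Coxeter frieze (CC-frieze, closed integral frieze) of width $w$ is an array of numbers $(m_{i,j})_{i\in\mathbb{Z},\,i\le j\le i+w+3}$ whose rows are indexed by $j-i$, with $m_{i,i}=m_{i,i+w+3}=0$ (top and bottom rows of zeros), $m_{i,i+1}=m_{i,i+w+2}=1$ (second and second to last rows of ones), all entries $m_{i,j}$ with $i+2\le j\le i+w+1$ positive integers, and the frieze rule $m_{i,j}m_{i+1,j+1}-m_{i+1,j}m_{i,j+1}=1$ for all $i<j<i+w+3$. *)

(* Defs.v *)
From HB Require Import structures.
From mathcomp Require Import all_boot all_order all_algebra.
From mathcomp Require Import boolp reals.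
From mathcomp Require Import complex mpoly.

Set Implicit Arguments.
Unset Strict Implicit.
Unset Printing Implicit Defensive.

Import GRing.Theory.
Local Open Scope ring_scope.

(* K[[t]]: a series is its sequence of coefficients, with the Cauchy product. *)
Definition fps (K : Type) : Type := nat -> K.

HB.instance Definition _ (K : Type) := gen_eqMixin (fps K).
HB.instance Definition _ (K : Type) := gen_choiceMixin (fps K).

Section PowerSeries.
Variable K : comNzRingType.
Implicit Types a b c : fps K.

Definition fps_zero : fps K := fun _ => 0.
Definition fps_opp a : fps K := fun k => - a k.
Definition fps_add a b : fps K := fun k => a k + b k.

Fact fps_addA : associative fps_add.
Proof. by move=> a b c; apply/funext => k; rewrite /fps_add addrA. Qed.
Fact fps_addC : commutative fps_add.
Proof. by move=> a b; apply/funext => k; rewrite /fps_add addrC. Qed.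
Fact fps_add0 : left_id fps_zero fps_add.
Proof. by move=> a; apply/funext => k; rewrite /fps_add add0r. Qed.
Fact fps_addN : left_inverse fps_zero fps_opp fps_add.
Proof. by move=> a; apply/funext => k; rewrite /fps_add /fps_opp addNr. Qed.

HB.instance Definition _ :=
  GRing.isZmodule.Build (fps K) fps_addA fps_addC fps_add0 fps_addN.

Definition fps_const (x : K) : fps K := fun k => if k is 0%N then x else 0.
Definition fps_t : fps K := fun k => if k is 1%N then 1 else 0.
Definition fps_mul a b : fps K := fun k => \sum_(i < k.+1) a i * b (k - i)%N.

Fact fps_mulC : commutative fps_mul.
Proof.
move=> a b; apply/funext => k; rewrite /fps_mul (reindex_inj rev_ord_inj) /=.
by apply: eq_bigr => j _; rewrite mulrC (sub_ordK j).
Qed.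

Fact fps_mulA : associative fps_mul.
Proof.
have mulr a b k : fps_mul a b k = \sum_(i < k.+1) a (k - i)%N * b i.
  rewrite /fps_mul (reindex_inj rev_ord_inj) /=.
  by apply: eq_bigr => j _; rewrite (sub_ordK j).
move=> p q r; apply/funext => i; rewrite {1}/fps_mul [RHS]mulr.
pose coef3 j k := p j * (q (i - j - k)%N * r k).
transitivity (\sum_(j < i.+1) \sum_(k < i.+1 | (k <= i - j)%N) coef3 j k).
  apply: eq_bigr => /= j _; rewrite mulr big_distrr /=.
  by rewrite (big_ord_narrow_leq (leq_subr _ _)).
rewrite (exchange_big_dep predT) //=; apply: eq_bigr => k _.
transitivity (\sum_(j < i.+1 | (j <= i - k)%N) coef3 j k).
  apply: eq_bigl => j; rewrite -ltnS -(ltnS j) -!subSn ?leq_ord //.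
  by rewrite -subn_gt0 -(subn_gt0 j) -!subnDA addnC.
rewrite (big_ord_narrow_leq (leq_subr _ _)) /fps_mul big_distrl /=.
by apply: eq_bigr => j _; rewrite /coef3 -!subnDA addnC mulrA.
Qed.

Fact fps_mul1 : left_id (fps_const 1) fps_mul.
Proof.
move=> a; apply/funext => k.
rewrite /fps_mul big_ord_recl /= mul1r subn0 big1 ?addr0 // => i _.
by rewrite mul0r.
Qed.

Fact fps_mulDl : left_distributive fps_mul fps_add.
Proof.
move=> a b c; apply/funext => k; rewrite /fps_mul /fps_add -big_split /=.
by apply: eq_bigr => i _; rewrite mulrDl.
Qed.

Fact fps_1neq0 : fps_const 1 != 0 :> fps K.
Proof. by apply/eqP => /(congr1 (@^~ 0%N)) /eqP; rewrite /= oner_eq0. Qed.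

HB.instance Definition _ := GRing.Zmodule_isComNzRing.Build (fps K)
  fps_mulA fps_mulC fps_mul1 fps_mulDl fps_1neq0.

End PowerSeries.

Section Category.
Variables (R : realType) (n : nat) (zeta : R[i]).

Local Notation Z := (fps R[i]).
Local Notation t := (fps_t R[i]).
Local Notation "z %:Z0" := (fps_const z) (at level 2, format "z %:Z0").

(* Modulo t = xy, S = C[[x, y]]/(x^2 - y^(n-2)) is spanned over C = R[i] by
   1, x, y, ..., y^(n-2), so S is the Z-algebra on x, y with xy = yx = t and
   x^2 = y^(n-2), where Z = C[[t]].  Hence a module over the skew group ring
   C_n * S that is free of finite rank over Z (with a chosen basis) is given by
   the matrices of x, y and of the generator g = zeta of C_n, acting on column
   vectors; in the skew group ring g x = zeta x g and g y = zeta^-1 y g. *)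
Record obj := Obj {
  rk : nat;
  actx : 'M[Z]_rk;
  acty : 'M[Z]_rk;
  actg : 'M[Z]_rk;
  obj_xy : actx *m acty = t%:M;
  obj_yx : acty *m actx = t%:M;
  obj_rel : actx ^+ 2 = acty ^+ (n - 2);
  obj_gn : actg ^+ n = 1%:M;
  obj_gx : actg *m actx = zeta%:Z0 *: (actx *m actg);
  obj_gy : actg *m acty = zeta^-1%:Z0 *: (acty *m actg) }.

Definition is_hom (A B : obj) (F : 'M[Z]_(rk B, rk A)) : Prop :=
  [/\ F *m actx A = actx B *m F,
      F *m acty A = acty B *m F &
      F *m actg A = actg B *m F].

Definition iso (A B : obj) : Prop :=
  exists (F : 'M[Z]_(rk B, rk A)) (G : 'M[Z]_(rk A, rk B)),
    [/\ is_hom F, is_hom G, G *m F = 1%:M & F *m G = 1%:M].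

Definition zero_obj : obj.
Proof. by refine (@Obj 0 0 0 0 _ _ _ _ _ _); apply/matrixP => -[]. Defined.

Fact block_diag_mul (p q : nat) (A A' : 'M[Z]_p) (B B' : 'M[Z]_q) :
  block_mx A 0 0 B *m block_mx A' 0 0 B' = block_mx (A *m A') 0 0 (B *m B').
Proof. by rewrite mulmx_block !mulmx0 !mul0mx !addr0 !add0r. Qed.

Fact block_diag_scale (p q : nat) (z : Z) (A : 'M[Z]_p) (B : 'M[Z]_q) :
  z *: block_mx A 0 0 B = block_mx (z *: A) 0 0 (z *: B).
Proof. by rewrite scale_block_mx !scaler0. Qed.

Fact block_diag_exp (p q k : nat) (A : 'M[Z]_p) (B : 'M[Z]_q) :
  (block_mx A 0 0 B) ^+ k = block_mx (A ^+ k) 0 0 (B ^+ k).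
Proof.
elim: k => [|k IHk]; first by rewrite !expr0 -scalar_mx_block.
by rewrite !exprS IHk -!mulmxE block_diag_mul.
Qed.

Definition dsum (A B : obj) : obj.
Proof.
refine (@Obj (rk A + rk B) (block_mx (actx A) 0 0 (actx B))
  (block_mx (acty A) 0 0 (acty B)) (block_mx (actg A) 0 0 (actg B))
  _ _ _ _ _ _).
- by rewrite block_diag_mul !obj_xy -scalar_mx_block.
- by rewrite block_diag_mul !obj_yx -scalar_mx_block.
- by rewrite !block_diag_exp !obj_rel.
- by rewrite block_diag_exp !obj_gn -scalar_mx_block.
- by rewrite !block_diag_mul block_diag_scale !obj_gx.
- by rewrite !block_diag_mul block_diag_scale !obj_gy.
Defined.

Definition dsums (k : nat) (F : 'I_k -> obj) : obj :=
  foldr dsum zero_obj [seq F i | i <- enum 'I_k].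

Definition summand (A T : obj) : Prop := exists B, iso (dsum A B) T.

Definition in_add (T A : obj) : Prop := exists m, summand A (dsums (fun _ : 'I_m => T)).

Definition indecomposable (A : obj) : Prop :=
  ~ iso A zero_obj /\
  forall B C, iso A (dsum B C) -> iso B zero_obj \/ iso C zero_obj.

(* Yoneda extensions 0 -> N -> L -> M -> 0. *)
Record extension (M N : obj) := Extension {
  ext_mid : obj;
  ext_in : 'M[Z]_(rk ext_mid, rk N);
  ext_out : 'M[Z]_(rk M, rk ext_mid);
  ext_in_hom : is_hom ext_in;
  ext_out_hom : is_hom ext_out;
  ext_inj : forall v : 'cV[Z]_(rk N), ext_in *m v = 0 -> v = 0;
  ext_comp : ext_out *m ext_in = 0;
  ext_exact : forall v : 'cV[Z]_(rk ext_mid),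
    ext_out *m v = 0 -> exists u : 'cV[Z]_(rk N), v = ext_in *m u;
  ext_surj : forall w : 'cV[Z]_(rk M),
    exists v : 'cV[Z]_(rk ext_mid), ext_out *m v = w }.

Definition ext_split (M N : obj) (E : extension M N) : Prop :=
  exists S : 'M[Z]_(rk (ext_mid E), rk M), is_hom S /\ ext_out E *m S = 1%:M.

(* [E'] = c [E] in Ext^1(M, N): E' is the pushout of E along c id_N. *)
Definition ext_scaled (M N : obj) (c : R[i]) (E E' : extension M N) : Prop :=
  exists F : 'M[Z]_(rk (ext_mid E'), rk (ext_mid E)),
    [/\ is_hom F, F *m ext_in E = c%:Z0 *: ext_in E' &
        ext_out E' *m F = ext_out E].

Definition Ext1_zero (M N : obj) : Prop :=
  forall E : extension M N, ext_split E.

(* Ext^1(M, N) is spanned over C by one nonzero class. *)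
Definition Ext1_dim1 (M N : obj) : Prop :=
  exists E : extension M N,
    ~ ext_split E /\ forall E' : extension M N, exists c, ext_scaled c E E'.

Definition cluster_tilting (T : obj) : Prop :=
  forall A : obj,
    (in_add T A <-> forall T', in_add T T' -> Ext1_zero A T') /\
    (in_add T A <-> forall T', in_add T T' -> Ext1_zero T' A).

Definition basic (T : obj) : Prop :=
  exists k (F : 'I_k -> obj),
    [/\ forall i, indecomposable (F i),
        forall i j, iso (F i) (F j) -> i = j &
        iso T (dsums F)].

Definition basic_cluster_tilting (T : obj) : Prop :=
  cluster_tilting T /\ basic T.

End Category.

Arguments zero_obj {R n zeta}.

(* The 2-subsets of {1, ..., n}, read modulo n: n is 0 : 'I_n. *)
Definition twoset (n : nat) := {I : {set 'I_n} | #|I| == 2%N}.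

Fact fps_constM (K : comNzRingType) (x y : K) :
  fps_const x * fps_const y = fps_const (x * y).
Proof.
apply/funext => -[|k]; rewrite /GRing.mul /= /fps_mul.
  by rewrite big_ord1.
by rewrite big1 // => -[[|i] hi] _ /=; rewrite ?mulr0 ?mul0r.
Qed.

Section Indecomposables.
Variables (R : realType) (n : nat) (zeta : R[i]).
Hypothesis zeta_prim : n.-primitive_root zeta.

Local Notation Z := (fps R[i]).
Local Notation t := (fps_t R[i]).

Section Matrices.
Variable I : {set 'I_n}.

(* In the weight basis (g e_j = zeta^j e_j) of M_I, x maps e_{j-1} to e_j if
   j is in I and to t e_j otherwise; y maps e_j to t e_{j-1} if j is in I and
   to e_{j-1} otherwise. *)
Definition Mx : 'M[Z]_n :=
  \matrix_(i, j) if i == ordS j then t ^+ (i \notin I) else 0.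
Definition My : 'M[Z]_n :=
  \matrix_(i, j) if j == ordS i then t ^+ (j \in I) else 0.
Definition Mg : 'M[Z]_n := diag_mx (\row_j fps_const (zeta ^+ j)).

Fact Mxl (A : 'M[Z]_n) i j : (Mx *m A) (ordS i) j = t ^+ (ordS i \notin I) * A i j.
Proof.
rewrite mxE (bigD1 i) //= mxE eqxx big1 ?addr0 // => k kNi.
by rewrite mxE (inj_eq (@ordS_inj n)) eq_sym (negPf kNi) mul0r.
Qed.

Fact Myl (A : 'M[Z]_n) i j : (My *m A) i j = t ^+ (ordS i \in I) * A (ordS i) j.
Proof.
rewrite mxE (bigD1 (ordS i)) //= mxE eqxx big1 ?addr0 // => k kNi.
by rewrite mxE (negPf kNi) mul0r.
Qed.

Fact Mxy : Mx *m My = t%:M.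
Proof.
apply/matrixP => i j; rewrite -{1}(ord_predK i) Mxl !mxE ord_predK eq_sym.
case: eqP => [->|_]; last by rewrite mulr0.
by rewrite -exprD; case: (_ \in _).
Qed.

Fact Myx : My *m Mx = t%:M.
Proof.
apply/matrixP => i j; rewrite Myl !mxE (inj_eq (@ordS_inj n)).
case: eqP => _; last by rewrite mulr0.
by rewrite -exprD; case: (_ \in _).
Qed.

Fact My_exp k i j : (My ^+ k) i j =
  if j == iter k (@ordS n) i
  then t ^+ (\sum_(l < k) (iter l.+1 (@ordS n) i \in I)) else 0.
Proof.
elim: k i => [|k IHk] i.
  by rewrite expr0 mxE big_ord0 expr0 eq_sym; case: eqP.
rewrite exprS -mulmxE Myl IHk -iterSr; case: eqP => _; last by rewrite mulr0.
rewrite -exprD big_ord_recl /=; congr (t ^+ (_ + _)).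
by apply: eq_bigr => l _; rewrite -iterSr.
Qed.

Fact val_iter_ordS k (i : 'I_n) : val (iter k (@ordS n) i) = ((i + k) %% n)%N.
Proof.
elim: k => [|k IHk]; first by rewrite addn0 modn_small.
by rewrite iterS /= IHk -addn1 modnDml addn1 addnS.
Qed.

Fact Mrel : #|I| == 2%N -> Mx ^+ 2 = My ^+ (n - 2).
Proof.
move=> /eqP I2; have n2 : (2 <= n)%N.
  by have := max_card (mem I); rewrite I2 card_ord.
have itern i : iter n (@ordS n) i = i.
  by apply: val_inj; rewrite val_iter_ordS modnDr modn_small.
apply/matrixP => i j; pose k := iter (n - 2) (@ordS n) i.
have ik : i = ordS (ordS k).
  by rewrite - [RHS]/(iter 2 _ k) /k -iterD subnKC.
rewrite My_exp expr2 -mulmxE {1}ik Mxl mxE -ik -/k (inj_eq (@ordS_inj n)) eq_sym.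
case: eqP => _; last by rewrite mulr0.
rewrite -exprD; congr (t ^+ _); apply/eqP.
have S2 : (\sum_(l < n) (iter l.+1 (@ordS n) i \in I) = 2)%N.
  rewrite -I2 -sum1_card [RHS]big_mkcond /=.
  have inj : injective (fun l : 'I_n => iter l.+1 (@ordS n) i).
    move=> a b /ordS_inj /(congr1 val); rewrite !val_iter_ordS => /eqP.
    by rewrite eqn_modDl !modn_small // => /eqP/val_inj.
  rewrite [RHS](reindex_inj inj) /=.
  by apply: eq_bigr => l _; case: (_ \in _).
move: S2; rewrite -(big_mkord xpredT (fun l => (iter l.+1 _ i \in I) : nat)).
rewrite -{1}(subnK n2) addn2 !big_nat_recr //= big_mkord -/k -ik => S2.
rewrite -(eqn_add2r ((ordS k \in I) + (i \in I))) [X in _ == X]addnA S2.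
by case: (i \in I); case: (ordS k \in I).
Qed.

Fact Mg_exp : Mg ^+ n = 1%:M.
Proof.
have e k : Mg ^+ k = diag_mx (\row_j fps_const (zeta ^+ (j * k))).
  elim: k => [|k IHk].
    rewrite expr0; apply/matrixP => i j; rewrite !mxE muln0 expr0.
    by case: eqP.
  rewrite exprS IHk -mulmxE mulmx_diag; congr diag_mx.
  by apply/rowP => j; rewrite !mxE fps_constM -exprD mulnS.
rewrite e; apply/matrixP => i j; rewrite !mxE mulnC exprM.
by rewrite (prim_expr_order zeta_prim) expr1n.
Qed.

Fact zeta_ordS (j : 'I_n) : zeta ^+ ordS j = zeta * zeta ^+ j.
Proof. by rewrite /= (prim_expr_mod zeta_prim) exprS. Qed.

Fact zeta_neq0 : (0 < n)%N -> zeta != 0.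
Proof.
move=> n0; apply/eqP => z0; have := prim_expr_order zeta_prim.
by rewrite z0 expr0n gtn_eqF //= => /esym/eqP; rewrite oner_eq0.
Qed.

Fact Mgx : Mg *m Mx = fps_const zeta *: (Mx *m Mg).
Proof.
apply/matrixP => i j; rewrite mul_diag_mx mul_mx_diag !mxE.
case: eqP => [->|_]; last by rewrite mul0r !mulr0.
by rewrite zeta_ordS -fps_constM -mulrA [X in _ * X]mulrC.
Qed.

Fact Mgy : Mg *m My = fps_const zeta^-1 *: (My *m Mg).
Proof.
apply/matrixP => i j; rewrite mul_diag_mx mul_mx_diag !mxE.
case: eqP => [->|_]; last by rewrite mul0r !mulr0.
rewrite zeta_ordS [X in _ = _ * X]mulrC mulrA fps_constM mulKf //.
by rewrite zeta_neq0 // (leq_ltn_trans _ (ltn_ord i)).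
Qed.

End Matrices.

Definition Mod (I : twoset n) : obj n zeta :=
  Obj (Mxy (val I)) (Myx (val I)) (Mrel (valP I)) Mg_exp
    (Mgx (val I)) (Mgy (val I)).

Definition summands (T : obj n zeta) : {set twoset n} :=
  [set I | `[< summand (Mod I) T >]].

(* Q(p_I : M_I a summand of T) *)
Definition clfield (T : obj n zeta) : fieldType :=
  {fraction {mpoly rat[#|summands T|]}}.

Definition clvar (T : obj n zeta) (I : twoset n) (hI : I \in summands T) :
    clfield T :=
  tofrac ('X_(enum_rank_in hI I) : {mpoly rat[#|summands T|]}).

Definition cluster_character (T : obj n zeta) (X : obj n zeta -> clfield T) :
    Prop :=
  [/\ forall M N, iso M N -> X M = X N,
      forall M N, X (dsum M N) = X M * X N,
      forall M N, Ext1_dim1 N M ->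
        forall (E : extension M N) (E' : extension N M),
          ~ ext_split E -> ~ ext_split E' ->
          X M * X N = X (ext_mid E) + X (ext_mid E') &
      forall (I : twoset n) (hI : I \in summands T), X (Mod I) = clvar hI].

End Indecomposables.

(* The rational function f is defined at (1, ..., 1) with value v. *)
Definition value_at_ones (k : nat) (f : {fraction {mpoly rat[k]}}) (v : rat) :
    Prop :=
  exists P Q : {mpoly rat[k]},
    [/\ Q.@[fun=> 1] != 0, f = tofrac P / tofrac Q &
        v = P.@[fun=> 1] / Q.@[fun=> 1]].

(* An array (m_{i,j}), i <= j <= i + w + 3, is a function on all pairs of
   integers, considered only on that domain. *)
Definition CC_frieze (w : nat) (m : int -> int -> int) : Prop :=
  [/\ forall i, m i i = 0 /\ m i (i + w%:Z + 3) = 0,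
      forall i, m i (i + 1) = 1 /\ m i (i + w%:Z + 2) = 1,
      forall i j, i + 2 <= j <= i + w%:Z + 1 -> 0 < m i j &
      forall i j, i < j < i + w%:Z + 3 ->
        m i j * m (i + 1) (j + 1) - m (i + 1) j * m i (j + 1) = 1].

Definition same_frieze (w : nat) (m m' : int -> int -> int) : Prop :=
  forall i j, i <= j <= i + w%:Z + 3 -> m i j = m' i j.

(* I = {i, j} modulo n; M_I is then the entry M_{i,j} of the array drawing the
   Auslander-Reiten quiver, in row j - i. *)
Definition is_pair (n : nat) (i j : int) (I : twoset n) : Prop :=
  exists a b : 'I_n,
    [/\ (a%:Z = i %[mod n%:Z])%Z, (b%:Z = j %[mod n%:Z])%Z & val I = [set a; b]].

(* m is the array of the values of X on the entries of the Auslander-Reiten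
   quiver, with all the initial variables set to 1, completed by a top and a
   bottom row of zeros. *)
Definition obtained_from (R : realType) (n : nat) (zeta : R[i])
    (hz : n.-primitive_root zeta) (T : obj n zeta)
    (X : obj n zeta -> clfield hz T) (m : int -> int -> int) : Prop :=
  (forall i, m i i = 0 /\ m i (i + n%:Z) = 0) /\
  (forall i j (I : twoset n), i < j < i + n%:Z -> is_pair i j I ->
     value_at_ones (X (Mod hz I)) (m i j)%:~R).

(* Main.v *)
(* An object is a chain of Z-lattices V_0 >= y V_1 >= ... >= y^n V_n = t^2 V_0, where
   V_j is the zeta^j-eigenspace of g.  Looking at the two steps at which a suitable
   vector of V_0 leaves the chain modulo t and modulo t^2 gives a direct summand M_I,
   so every object is a sum of the rank one modules M_I.  Between these,
   Ext^1(M_I, M_J) vanishes when the chords I and J of the n-gon do not cross, because a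
   lift of one basis vector can be moved along the whole chain; if they cross, it is one
   dimensional and its nonsplit extension has the two opposite sides of the
   quadrilateral as middle term.  Hence basic cluster tilting objects are triangulations
   of the n-gon, and a cluster character satisfies the Ptolemy relations.  A frieze is
   m_(i,j) = det(v_i, v_j) for vectors v_i in Z^2, so it satisfies the same relations,
   and it is determined by the triangulation formed by its entries 1 (Conway and
   Coxeter), the vectors being found by Farey mediants. *)
Require Import Defs.
From HB Require Import structures.
From mathcomp Require Import all_boot all_order all_algebra.
From mathcomp Require Import zify ring boolp reals complex mpoly.

Set Implicit Arguments.
Unset Strict Implicit.
Unset Printing Implicit Defensive.

Import GRing.Theory.
Local Open Scope ring_scope.

(** * Power series and matrices over them *)

(** Splitting of extensions is handled through [lifts A N]: every morphism from [A] to any [B] lifts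
    along every extension of [B] by [N]. No pullback has to be built, and since [B] is free, a lift
    to a quotient can be lifted once more, which settles sums in the second argument.

    Averaging over the cyclic group commutes with all homomorphisms, so [g] obstructs nothing: it
    cuts objects into weight spaces, and as [xy = t] is regular, only [y] has to be followed from
    one weight to the next.

    The frieze attached to [T] is fixed by its entries 1, without reference to a character. A
    character takes values in a fraction field, where evaluation at ones is only partial. Its values
    are therefore propagated from the chords of [T] by Ptolemy relations, dividing each time by a
    diagonal whose value is a positive entry of the frieze. The same induction compares two friezes
    with the same entries 1; there the diagonal in question is 1 in both. *)

Section PowerSeries.
Variable K : fieldType.
Implicit Types a b c : fps K.

Definition fps_coef0 a : K := a 0%N.

Fact fps_coef0_additive : zmod_morphism fps_coef0.
Proof. by []. Qed.
Fact fps_coef0_multiplicative : monoid_morphism fps_coef0.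
Proof. by split=> // a b; rewrite /fps_coef0 [LHS]big_ord1. Qed.
HB.instance Definition _ :=
  GRing.isZmodMorphism.Build (fps K) K fps_coef0 fps_coef0_additive.
HB.instance Definition _ :=
  GRing.isMonoidMorphism.Build (fps K) K fps_coef0 fps_coef0_multiplicative.

Lemma fps_constD (x y : K) : fps_const (x + y) = fps_const x + fps_const y.
Proof. by apply/funext => -[|k] //; rewrite [RHS]addr0. Qed.
Lemma fps_constN (x : K) : fps_const (- x) = - fps_const x.
Proof. by apply/funext => -[|k] //; rewrite [RHS]oppr0. Qed.
Lemma fps_const0 : fps_const 0 = 0 :> fps K.
Proof. by apply/funext => -[|k]. Qed.
Lemma fps_coef0_const (x : K) : fps_coef0 (fps_const x) = x.
Proof. by []. Qed.
Lemma fps_coef0_t : fps_coef0 (fps_t K) = 0. Proof. by []. Qed.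

Lemma fps_tmulE a k : (fps_t K * a) k = if k is k'.+1 then a k' else 0.
Proof.
case: k => [|k]; first by rewrite [LHS]big_ord1 mul0r.
rewrite [LHS]big_ord_recl mul0r add0r big_ord_recl /= /bump /= mul1r subSS subn0.
by rewrite big1 ?addr0 // => i _; rewrite mul0r.
Qed.

Lemma fps_t_inj : injective ( *%R (fps_t K)).
Proof.
move=> a b ab; apply/funext => k.
by have := congr1 (@^~ k.+1) ab; rewrite !fps_tmulE.
Qed.

Lemma fps_texp_inj k : injective ( *%R (fps_t K ^+ k)).
Proof.
elim: k => [|k IHk] a b; first by rewrite !expr0 !mul1r.
by rewrite exprS -!mulrA => /fps_t_inj /IHk.
Qed.

Lemma fps_tdiv a : fps_coef0 a = 0 -> exists b, a = fps_t K * b.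
Proof.
move=> a0; exists (fun k => a k.+1); apply/funext => -[|k]; rewrite fps_tmulE //.
Qed.

Lemma fps_texp_coef a k i : (i < k)%N -> (fps_t K ^+ k * a) i = 0.
Proof.
elim: k i => // k IHk [|i] ik; rewrite exprS -mulrA fps_tmulE //.
exact: IHk.
Qed.

Lemma fps_geometric c : exists b, (1 - fps_t K * c) * b = 1.
Proof.
pose u := fps_t K * c.
have u0 k i : (i < k)%N -> (u ^+ k) i = 0.
  by move=> ik; rewrite /u exprMn fps_texp_coef.
have sumE (F : nat -> fps K) m i : (\sum_(k < m) F k) i = \sum_(k < m) F k i.
  by elim: m => [|m IHm]; rewrite ?big_ord0 // !big_ord_recr /= -IHm.
pose B N := \sum_(k < N) u ^+ k.
have BE N i : (i < N)%N -> B N i = B i.+1 i.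
  move=> iN; rewrite /B !sumE -(subnKC iN) big_split_ord /= [X in _ + X]big1 ?addr0 //.
  by move=> k _; rewrite u0 // ltnS leq_addr.
(* The geometric series read off its partial sums: [u ^+ k] starts in degree [k], so coefficient [j]
   is already final in [B j.+1]. *)
exists (fun j => B j.+1 j); apply/funext => j.
transitivity (((1 - u) * B j.+1) j).
  apply: eq_bigr => i _; congr (_ * _); apply/esym/BE.
  by rewrite ltnS leq_subr.
have /(congr1 (fun c : fps K => (- c) j)) := subrX1 u j.+1.
rewrite -mulNr !opprB => <-.
have -> : (1 - u ^+ j.+1) j = (1 : fps K) j - (u ^+ j.+1) j by [].
by rewrite u0 // subr0.
Qed.

Lemma fps_inv a : fps_coef0 a != 0 -> exists b, a * b = 1.
Proof.
move=> a0; pose x := fps_coef0 a.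
have [|c ac] := @fps_tdiv (1 - fps_const x^-1 * a).
  by rewrite rmorphB rmorphM /= rmorph1 fps_coef0_const mulVf ?subrr.
have [b cb] := fps_geometric c.
exists (fps_const x^-1 * b); rewrite mulrA (mulrC a) -cb; congr (_ * _).
by rewrite -ac subKr.
Qed.

Lemma fps_const_inj (x : K) a b : x != 0 -> fps_const x * a = fps_const x * b -> a = b.
Proof.
move=> x0 /(congr1 ( *%R (fps_const x^-1))).
by rewrite !mulrA fps_constM mulVf // !mul1r.
Qed.

End PowerSeries.

Section Matrices.
Variable K : fieldType.
Local Notation Z := (fps K).
Local Notation t := (fps_t K).
Local Notation red := (map_mx (@fps_coef0 K)).

Lemma tmx_inj k m p : injective (fun A : 'M[Z]_(m, p) => t ^+ k *: A).
Proof.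
move=> A B AB; apply/matrixP => i j; apply: (@fps_texp_inj _ k).
by have /matrixP/(_ i j) := AB; rewrite !mxE.
Qed.

Lemma tmx_inj1 m p : injective (fun A : 'M[Z]_(m, p) => t *: A).
Proof. by have := @tmx_inj 1 m p; rewrite expr1. Qed.

Lemma red_tmx m p (A : 'M[Z]_(m, p)) : red (t *: A) = 0.
Proof. by apply/matrixP => i j; rewrite !mxE rmorphM /= fps_coef0_t mul0r. Qed.

Lemma redM m p q (A : 'M[Z]_(m, p)) (B : 'M[Z]_(p, q)) :
  red (A *m B) = red A *m red B.
Proof. exact: map_mxM. Qed.

Lemma redB m p (A B : 'M[Z]_(m, p)) : red (A - B) = red A - red B.
Proof. exact: map_mxB. Qed.

Lemma red_lift m p (a : 'M[K]_(m, p)) : red (map_mx (@fps_const K) a) = a.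
Proof. by apply/matrixP => i j; rewrite !mxE. Qed.

Lemma tmx_div m p (A : 'M[Z]_(m, p)) : red A = 0 -> exists B, A = t *: B.
Proof.
move=> A0; have h i j : exists b, A i j = t * b.
  by apply: fps_tdiv; have /matrixP/(_ i j) := A0; rewrite !mxE.
exists (\matrix_(i, j) projT1 (cid (h i j))); apply/matrixP => i j; rewrite !mxE.
exact: projT2 (cid (h i j)).
Qed.

(** The induction is on the index [k] of a nonzero coefficient, which bounds the power of [t] that
    can be extracted. *)
Lemma tmx_val m p (A : 'M[Z]_(m, p)) :
  A != 0 -> exists k B, A = t ^+ k *: B /\ red B != 0.
Proof.
move=> A0; have [i [j [k Ak]]] : exists i j k, A i j k != 0.
  apply: contrapT => h; move/negP: A0; apply; apply/eqP/matrixP => i j.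
  apply/funext => k; apply: contrapT => /eqP hk; apply: h.
  by exists i, j, k; rewrite mxE in hk.
elim: k A {A0} Ak => [|k IHk] A Ak.
  exists 0%N, A; rewrite expr0 scale1r; split=> //; apply/eqP => /matrixP/(_ i j).
  by rewrite !mxE => /eqP; apply/negP.
have [|] := eqVneq (red A) 0; last by exists 0%N, A; rewrite expr0 scale1r.
move=> /tmx_div[B AB]; have [|l [D [BD D0]]] := IHk B.
  by rewrite AB mxE fps_tmulE in Ak.
by exists l.+1, D; rewrite exprS -scalerA -BD.
Qed.

Lemma mx_inv m (A : 'M[Z]_m) : \det (red A) != 0 ->
  exists B, A *m B = 1%:M /\ B *m A = 1%:M.
Proof.
rewrite det_map_mx => /fps_inv[d Ad]; exists (d *: \adj A).
by rewrite -scalemxAr -scalemxAl mul_mx_adj mul_adj_mx scale_scalar_mx mulrC Ad.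
Qed.

(** Invariance of the rank, seen modulo [t] by ranks over the field. *)
Lemma mx_eq_size m p (A : 'M[Z]_(m, p)) (B : 'M[Z]_(p, m)) :
  A *m B = 1%:M -> B *m A = 1%:M -> m = p.
Proof.
move=> AB BA; apply/eqP; rewrite eqn_leq.
have h q r (C : 'M[Z]_(q, r)) (D : 'M[Z]_(r, q)) : C *m D = 1%:M -> (q <= r)%N.
  move=> /(congr1 red); rewrite map_mxM map_mx1 => CD.
  by rewrite -(mxrank1 K q) -CD (leq_trans (mxrankM_maxl _ _)) ?rank_leq_col.
by rewrite (h _ _ _ _ AB) (h _ _ _ _ BA).
Qed.

End Matrices.

(** * Homomorphisms and direct sums *)

Section Objects.
Variables (R : realType) (n : nat) (zeta : R[i]).

Local Notation Z := (fps R[i]).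
Local Notation t := (fps_t R[i]).
Local Notation obj := (obj n zeta).
Implicit Types A B C D : obj.

Lemma hom_id A : is_hom (1%:M : 'M[Z]_(rk A, rk A)).
Proof. by split; rewrite mul1mx mulmx1. Qed.

Lemma hom_comp A B C (F : 'M[Z]_(rk B, rk A)) (G : 'M[Z]_(rk C, rk B)) :
  is_hom F -> is_hom G -> is_hom (G *m F).
Proof.
by case=> Fx Fy Fg [Gx Gy Gg]; split;
  rewrite -mulmxA ?(Fx, Fy, Fg) mulmxA ?(Gx, Gy, Gg) mulmxA.
Qed.

Lemma hom0 A B : is_hom (0 : 'M[Z]_(rk B, rk A)).
Proof. by split; rewrite mul0mx mulmx0. Qed.

Lemma hom_add A B (F G : 'M[Z]_(rk B, rk A)) :
  is_hom F -> is_hom G -> is_hom (F + G).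
Proof.
by case=> Fx Fy Fg [Gx Gy Gg]; split;
  rewrite mulmxDl mulmxDr ?(Fx, Fy, Fg) ?(Gx, Gy, Gg).
Qed.

Lemma hom_scale A B (c : Z) (F : 'M[Z]_(rk B, rk A)) :
  is_hom F -> is_hom (c *: F).
Proof.
by case=> Fx Fy Fg; split; rewrite -scalemxAl -scalemxAr ?(Fx, Fy, Fg).
Qed.

Lemma hom_opp A B (F : 'M[Z]_(rk B, rk A)) : is_hom F -> is_hom (- F).
Proof. by move=> hF; rewrite -scaleN1r; apply: hom_scale. Qed.

(* Since xy = yx = t and t is regular, compatibility with y forces
   compatibility with x. *)
Lemma hom_of_yg A B (F : 'M[Z]_(rk B, rk A)) :
  F *m acty A = acty B *m F -> F *m actg A = actg B *m F -> is_hom F.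
Proof.
move=> Fy Fg; split; [apply: tmx_inj1|exact: Fy|exact: Fg].
transitivity (actx B *m (acty B *m F) *m actx A).
  by rewrite mulmxA obj_xy mul_scalar_mx -scalemxAl.
by rewrite -Fy -!mulmxA obj_yx !mul_mx_scalar -scalemxAr.
Qed.

Lemma iso_refl A : iso A A.
Proof. by exists 1%:M, 1%:M; split; rewrite ?mulmx1 //; apply: hom_id. Qed.

Lemma iso_sym A B : iso A B -> iso B A.
Proof. by case=> F [G [hF hG GF FG]]; exists G, F. Qed.

Lemma iso_trans A B C : iso A B -> iso B C -> iso A C.
Proof.
case=> F [G [hF hG GF FG]] [F' [G' [hF' hG' GF' FG']]].
exists (F' *m F), (G *m G'); split; try exact: hom_comp.
  by rewrite mulmxA -(mulmxA G) GF' mulmx1.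
by rewrite mulmxA -(mulmxA F') FG mulmx1.
Qed.

Lemma iso_rk A B : iso A B -> rk A = rk B.
Proof. by case=> F [G [_ _ GF FG]]; apply: mx_eq_size GF FG. Qed.

Lemma flat_mx_eq m p (M N : 'M[Z]_(m, p)) : m = 0%N -> M = N.
Proof. by move=> m0; move: M N; rewrite m0 => M N; apply/matrixP => -[]. Qed.

Lemma iso_zeroP A : iso A zero_obj <-> rk A = 0%N.
Proof.
split; first by move/iso_rk.
move=> A0; exists 0, 0.
by split; [exact: hom0 | exact: hom0 | exact: flat_mx_eq | exact: flat_mx_eq].
Qed.

Definition dsum_in1 A B : 'M[Z]_(rk (dsum A B), rk A) :=
  col_mx 1%:M (0 : 'M_(rk B, rk A)).
Definition dsum_in2 A B : 'M[Z]_(rk (dsum A B), rk B) :=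
  col_mx (0 : 'M_(rk A, rk B)) 1%:M.
Definition dsum_out1 A B : 'M[Z]_(rk A, rk (dsum A B)) :=
  row_mx 1%:M (0 : 'M_(rk A, rk B)).
Definition dsum_out2 A B : 'M[Z]_(rk B, rk (dsum A B)) :=
  row_mx (0 : 'M_(rk B, rk A)) 1%:M.

Lemma dsum_in1_hom A B : is_hom (dsum_in1 A B).
Proof.
by split; rewrite /= mul_block_col mul_col_mx !mul0mx !mulmx0 !mulmx1 mul1mx !addr0.
Qed.

Lemma dsum_in2_hom A B : is_hom (dsum_in2 A B).
Proof.
by split; rewrite /= mul_block_col mul_col_mx !mul0mx !mulmx0 !mulmx1 mul1mx !add0r.
Qed.

Lemma dsum_out1_hom A B : is_hom (dsum_out1 A B).
Proof.
by split; rewrite /= mul_row_block mul_mx_row !mul0mx !mulmx0 !mulmx1 mul1mx !addr0.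
Qed.

Lemma dsum_out2_hom A B : is_hom (dsum_out2 A B).
Proof.
by split; rewrite /= mul_row_block mul_mx_row !mul0mx !mulmx0 !mulmx1 mul1mx !add0r.
Qed.

Lemma dsum_out1_in1 A B : dsum_out1 A B *m dsum_in1 A B = 1%:M.
Proof. by rewrite mul_row_col mul1mx mulmx0 addr0. Qed.
Lemma dsum_out2_in2 A B : dsum_out2 A B *m dsum_in2 A B = 1%:M.
Proof. by rewrite mul_row_col mul1mx mulmx0 add0r. Qed.
Lemma dsum_out1_in2 A B : dsum_out1 A B *m dsum_in2 A B = 0.
Proof. by rewrite mul_row_col mul1mx mul0mx addr0. Qed.
Lemma dsum_out2_in1 A B : dsum_out2 A B *m dsum_in1 A B = 0.
Proof. by rewrite mul_row_col mulmx0 mul0mx addr0. Qed.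
Lemma dsum_in_out A B :
  dsum_in1 A B *m dsum_out1 A B + dsum_in2 A B *m dsum_out2 A B = 1%:M.
Proof.
rewrite !mul_col_row !mul1mx !mulmx0 ?mul0mx add_block_mx !addr0 !add0r.
by rewrite -scalar_mx_block.
Qed.

Lemma comp_dsum A B m p (F : 'M[Z]_(rk (dsum A B), m)) (G : 'M[Z]_(p, rk (dsum A B))) :
  G *m F = (G *m dsum_in1 A B) *m (dsum_out1 A B *m F) +
           (G *m dsum_in2 A B) *m (dsum_out2 A B *m F).
Proof.
rewrite !mulmxA -mulmxDl -!(mulmxA G) -mulmxDr dsum_in_out mulmx1; exact: erefl.
Qed.

Definition dpair A B m (X : 'M[Z]_(rk A, m)) (Y : 'M[Z]_(rk B, m)) :
    'M[Z]_(rk (dsum A B), m) :=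
  dsum_in1 A B *m X + dsum_in2 A B *m Y.

Definition dcopair A B m (X : 'M[Z]_(m, rk A)) (Y : 'M[Z]_(m, rk B)) :
    'M[Z]_(m, rk (dsum A B)) :=
  X *m dsum_out1 A B + Y *m dsum_out2 A B.

Lemma dpair_hom A B C (X : 'M[Z]_(rk A, rk C)) (Y : 'M[Z]_(rk B, rk C)) :
  is_hom X -> is_hom Y -> @is_hom _ _ _ C (dsum A B) (dpair X Y).
Proof.
move=> hX hY; apply: hom_add; first exact: hom_comp hX (dsum_in1_hom A B).
exact: hom_comp hY (dsum_in2_hom A B).
Qed.

Lemma dcopair_hom A B C (X : 'M[Z]_(rk C, rk A)) (Y : 'M[Z]_(rk C, rk B)) :
  is_hom X -> is_hom Y -> @is_hom _ _ _ (dsum A B) C (dcopair X Y).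
Proof.
move=> hX hY; apply: hom_add; first exact: hom_comp (dsum_out1_hom A B) hX.
exact: hom_comp (dsum_out2_hom A B) hY.
Qed.

Lemma dcopair_dpair A B m p (X : 'M[Z]_(m, rk A)) (Y : 'M[Z]_(m, rk B))
    (X' : 'M[Z]_(rk A, p)) (Y' : 'M[Z]_(rk B, p)) :
  dcopair X Y *m dpair X' Y' = X *m X' + Y *m Y'.
Proof.
rewrite mulmxDl !mulmxDr -!mulmxA (mulmxA (dsum_out1 A B)) (mulmxA (dsum_out2 A B)).
rewrite (mulmxA (dsum_out1 A B)) (mulmxA (dsum_out2 A B)).
rewrite dsum_out1_in1 dsum_out1_in2 dsum_out2_in1 dsum_out2_in2.
by rewrite !mul1mx !mul0mx !mulmx0 addr0 add0r.
Qed.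

Lemma out1_dpair A B m (X : 'M[Z]_(rk A, m)) (Y : 'M[Z]_(rk B, m)) :
  dsum_out1 A B *m dpair X Y = X.
Proof.
rewrite mulmxDr !mulmxA dsum_out1_in1 dsum_out1_in2 mul1mx mul0mx addr0.
exact: erefl.
Qed.

Lemma out2_dpair A B m (X : 'M[Z]_(rk A, m)) (Y : 'M[Z]_(rk B, m)) :
  dsum_out2 A B *m dpair X Y = Y.
Proof.
rewrite mulmxDr !mulmxA dsum_out2_in1 dsum_out2_in2 mul1mx mul0mx add0r.
exact: erefl.
Qed.

Lemma dpair_mul A B m p (X : 'M[Z]_(rk A, m)) (Y : 'M[Z]_(rk B, m)) (W : 'M[Z]_(m, p)) :
  dpair X Y *m W = dpair (X *m W) (Y *m W).
Proof. by rewrite mulmxDl -!mulmxA. Qed.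

Lemma mul_dcopair A B m p (X : 'M[Z]_(m, rk A)) (Y : 'M[Z]_(m, rk B)) (W : 'M[Z]_(p, m)) :
  W *m dcopair X Y = dcopair (W *m X) (W *m Y).
Proof. by rewrite mulmxDr !mulmxA. Qed.

Lemma dpair_eta A B m (v : 'M[Z]_(rk (dsum A B), m)) :
  v = dpair (dsum_out1 A B *m v) (dsum_out2 A B *m v).
Proof. by rewrite /dpair !mulmxA -mulmxDl dsum_in_out mul1mx. Qed.

Lemma dcopair_mul A B m p (X : 'M[Z]_(m, rk A)) (Y : 'M[Z]_(m, rk B))
    (v : 'M[Z]_(rk (dsum A B), p)) :
  dcopair X Y *m v = X *m (dsum_out1 A B *m v) + Y *m (dsum_out2 A B *m v).
Proof. by rewrite mulmxDl -!mulmxA. Qed.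

Lemma dpair0 A B m : dpair (0 : 'M[Z]_(rk A, m)) (0 : 'M[Z]_(rk B, m)) = 0.
Proof. by rewrite /dpair !mulmx0 addr0. Qed.

Lemma biprod_iso X A B
    (i1 : 'M[Z]_(rk X, rk A)) (i2 : 'M[Z]_(rk X, rk B))
    (p1 : 'M[Z]_(rk A, rk X)) (p2 : 'M[Z]_(rk B, rk X)) :
  is_hom i1 -> is_hom i2 -> is_hom p1 -> is_hom p2 ->
  p1 *m i1 = 1%:M -> p2 *m i2 = 1%:M -> p1 *m i2 = 0 -> p2 *m i1 = 0 ->
  i1 *m p1 + i2 *m p2 = 1%:M -> iso X (dsum A B).
Proof.
move=> hi1 hi2 hp1 hp2 e11 e22 e12 e21 e.
exists (dsum_in1 A B *m p1 + dsum_in2 A B *m p2),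
       (i1 *m dsum_out1 A B + i2 *m dsum_out2 A B); split.
- apply: hom_add; apply: hom_comp => //; [exact: dsum_in1_hom|exact: dsum_in2_hom].
- apply: hom_add; apply: hom_comp => //; [exact: dsum_out1_hom|exact: dsum_out2_hom].
- rewrite mulmxDl !mulmxDr !mulmxA -!(mulmxA _ (dsum_out1 _ _)) -!(mulmxA _ (dsum_out2 _ _)).
  rewrite dsum_out1_in1 dsum_out2_in2 dsum_out1_in2 dsum_out2_in1.
  by rewrite !mulmx1 !mulmx0 !mul0mx addr0 add0r.
- rewrite mulmxDl !mulmxDr !mulmxA -!(mulmxA _ p1) -!(mulmxA _ p2).
  rewrite e11 e12 e21 e22 !mulmx1 !mulmx0 !mul0mx addr0 add0r.
  exact: dsum_in_out.
Qed.

Lemma dsum_cong A A' B B' : iso A A' -> iso B B' -> iso (dsum A B) (dsum A' B').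
Proof.
case=> F [G [hF hG GF FG]] [F' [G' [hF' hG' GF' FG']]].
apply: (@biprod_iso _ _ _ (dsum_in1 A B *m G) (dsum_in2 A B *m G')
          (F *m dsum_out1 A B) (F' *m dsum_out2 A B)).
- exact: hom_comp hG (dsum_in1_hom _ _).
- exact: hom_comp hG' (dsum_in2_hom _ _).
- exact: hom_comp (dsum_out1_hom _ _) hF.
- exact: hom_comp (dsum_out2_hom _ _) hF'.
- by rewrite mulmxA -(mulmxA F) dsum_out1_in1 mulmx1.
- by rewrite mulmxA -(mulmxA F') dsum_out2_in2 mulmx1.
- by rewrite mulmxA -(mulmxA F) dsum_out1_in2 mulmx0 mul0mx.
- by rewrite mulmxA -(mulmxA F') dsum_out2_in1 mulmx0 mul0mx.
- by rewrite !mulmxA -(mulmxA _ G) -(mulmxA _ G') GF GF' !mulmx1 dsum_in_out.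
Qed.

Lemma dsumC A B : iso (dsum A B) (dsum B A).
Proof.
apply: (biprod_iso (dsum_in2_hom A B) (dsum_in1_hom A B)
         (dsum_out2_hom A B) (dsum_out1_hom A B)).
- exact: dsum_out2_in2.
- exact: dsum_out1_in1.
- exact: dsum_out2_in1.
- exact: dsum_out1_in2.
- by rewrite addrC dsum_in_out.
Qed.

Lemma dsumA A B C : iso (dsum A (dsum B C)) (dsum (dsum A B) C).
Proof.
pose i1 := dsum_in1 A (dsum B C); pose i2 := dsum_in2 A (dsum B C).
pose p1 := dsum_out1 A (dsum B C); pose p2 := dsum_out2 A (dsum B C).
pose j1 := dsum_in1 B C; pose j2 := dsum_in2 B C.
pose q1 := dsum_out1 B C; pose q2 := dsum_out2 B C.
pose k1 := dsum_in1 A B; pose k2 := dsum_in2 A B.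
pose r1 := dsum_out1 A B; pose r2 := dsum_out2 A B.
have p1i1 : p1 *m i1 = 1%:M := dsum_out1_in1 _ _.
have p2i2 : p2 *m i2 = 1%:M := dsum_out2_in2 _ _.
have p1i2 : p1 *m i2 = 0 := dsum_out1_in2 _ _.
have p2i1 : p2 *m i1 = 0 := dsum_out2_in1 _ _.
have q1j1 : q1 *m j1 = 1%:M := dsum_out1_in1 _ _.
have q2j2 : q2 *m j2 = 1%:M := dsum_out2_in2 _ _.
have q1j2 : q1 *m j2 = 0 := dsum_out1_in2 _ _.
have q2j1 : q2 *m j1 = 0 := dsum_out2_in1 _ _.
have r1k1 : r1 *m k1 = 1%:M := dsum_out1_in1 _ _.
have r2k2 : r2 *m k2 = 1%:M := dsum_out2_in2 _ _.
have r1k2 : r1 *m k2 = 0 := dsum_out1_in2 _ _.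
have r2k1 : r2 *m k1 = 0 := dsum_out2_in1 _ _.
apply: (@biprod_iso _ _ _ (i1 *m r1 + i2 *m (j1 *m r2)) (i2 *m j2)
          (k1 *m p1 + k2 *m (q1 *m p2)) (q2 *m p2)).
- apply: hom_add; apply: hom_comp; try exact: dsum_in1_hom; try exact: dsum_out1_hom;
    try exact: dsum_in2_hom.
  by apply: hom_comp; [exact: dsum_out2_hom|exact: dsum_in1_hom].
- by apply: hom_comp; exact: dsum_in2_hom.
- apply: hom_add; apply: hom_comp; try exact: dsum_in1_hom; try exact: dsum_out1_hom;
    try exact: dsum_in2_hom.
  by apply: hom_comp; [exact: dsum_out2_hom|exact: dsum_out1_hom].
- by apply: hom_comp; exact: dsum_out2_hom.
- rewrite mulmxDl !mulmxDr !mulmxA -!(mulmxA _ p1) -!(mulmxA _ p2).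
  rewrite p1i1 p1i2 p2i1 p2i2 !mulmx0 !mul0mx !mulmx1 addr0 add0r.
  by rewrite -(mulmxA _ q1) q1j1 mulmx1 dsum_in_out.
- by rewrite mulmxA -(mulmxA q2) p2i2 mulmx1.
- by rewrite mulmxDl -!mulmxA (mulmxA p1) (mulmxA p2) p1i2 p2i2 mul0mx mulmx0
    mul1mx q1j2 mulmx0 addr0.
- by rewrite -mulmxA mulmxDr (mulmxA p2 i1) (mulmxA p2 i2) p2i1 p2i2 mul0mx add0r
    mul1mx mulmxA q2j1 mul0mx.
- rewrite mulmxDl !mulmxDr !mulmxA -!(mulmxA _ r1) -!(mulmxA _ r2).
  rewrite r1k1 r1k2 r2k1 r2k2 !mulmx0 !mul0mx !mulmx1 addr0 add0r.
  have e : i2 *m j1 *m q1 *m p2 + i2 *m j2 *m q2 *m p2 = i2 *m p2.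
    by rewrite -mulmxDl -!(mulmxA i2) -mulmxDr dsum_in_out mulmx1.
  by rewrite -addrA e dsum_in_out.
Qed.

Lemma dsumCA A B C : iso (dsum A (dsum B C)) (dsum B (dsum A C)).
Proof.
apply: iso_trans (dsumA A B C) _; apply: iso_trans (iso_sym (dsumA B A C)).
exact: dsum_cong (dsumC A B) (iso_refl C).
Qed.

Lemma dsumACA A B C D :
  iso (dsum (dsum A B) (dsum C D)) (dsum (dsum A C) (dsum B D)).
Proof.
apply: iso_trans (iso_sym (dsumA A B (dsum C D))) _.
apply: iso_trans (dsumA A C (dsum B D)).
exact: dsum_cong (iso_refl A) (dsumCA B C D).
Qed.

Lemma dsum_zeror A B : iso B zero_obj -> iso (dsum A B) A.
Proof.
move/iso_zeroP => B0.
exists (dsum_out1 A B), (dsum_in1 A B); split;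
  [exact: dsum_out1_hom|exact: dsum_in1_hom| |exact: dsum_out1_in1].
rewrite -(dsum_in_out A B) -[LHS]addr0; congr (_ + _).
by rewrite (flat_mx_eq (dsum_out2 A B) 0 B0) mulmx0.
Qed.

Lemma dsum_zerol A B : iso A zero_obj -> iso (dsum A B) B.
Proof. by move=> A0; apply: iso_trans (dsumC _ _) (dsum_zeror _ A0). Qed.

Lemma summand_retract A X : summand A X ->
  exists (i : 'M[Z]_(rk X, rk A)) (p : 'M[Z]_(rk A, rk X)),
    [/\ is_hom i, is_hom p & p *m i = 1%:M].
Proof.
case=> B [F [G [hF hG GF FG]]].
exists (F *m dsum_in1 A B), (dsum_out1 A B *m G); split.
- exact: hom_comp (dsum_in1_hom _ _) hF.
- exact: hom_comp hG (dsum_out1_hom _ _).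
- by rewrite mulmxA -(mulmxA _ G) GF mulmx1 dsum_out1_in1.
Qed.

Lemma summand_iso A A' X X' : iso A A' -> iso X X' -> summand A X -> summand A' X'.
Proof.
move=> iA iX [B iB]; exists B.
by apply: iso_trans iX; apply: iso_trans iB; apply: dsum_cong (iso_sym iA) (iso_refl _).
Qed.

Lemma summand_dsum A A' X X' : summand A X -> summand A' X' ->
  summand (dsum A A') (dsum X X').
Proof.
case=> B iB [B' iB']; exists (dsum B B').
exact: iso_trans (dsumACA _ _ _ _) (dsum_cong iB iB').
Qed.

End Objects.

(** * Weight spaces of the cyclic group *)

Lemma expmxD (K : comNzRingType) m p (y : 'M[K]_m) (u : 'M[K]_(m, p)) a b :
  y ^+ (a + b) *m u = y ^+ a *m (y ^+ b *m u).
Proof. by rewrite mulmxA exprD. Qed.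

Lemma mul_expmxD (K : comNzRingType) m p (y : 'M[K]_m) (u : 'M[K]_(p, m)) a b :
  u *m y ^+ (a + b) = u *m y ^+ a *m y ^+ b.
Proof. by rewrite -mulmxA exprD. Qed.

Section Weights.
Variables (R : realType) (n : nat) (zeta : R[i]).
Hypotheses (n2 : (2 <= n)%N) (hz : n.-primitive_root zeta).

Local Notation Z := (fps R[i]).
Local Notation t := (fps_t R[i]).
Local Notation obj := (obj n zeta).
Implicit Types A B C D : obj.

Let n_gt0 : (0 < n)%N := prim_order_gt0 hz.

Lemma zeta_nz : zeta != 0.
Proof. exact: zeta_neq0 hz n_gt0. Qed.

(** By the relation, [y ^+ n = y ^+ 2 x ^+ 2], and [yx = t] applies twice. This closes up the chain
    of weight spaces. *)
Lemma acty_n A : acty A ^+ n = (t ^+ 2)%:M.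
Proof.
transitivity (acty A ^+ 2 *m acty A ^+ (n - 2)).
  by rewrite mulmxE -exprD subnKC.
rewrite -obj_rel !expr2 -!mulmxE.
rewrite mulmxA -(mulmxA (acty A)) obj_yx mul_mx_scalar -scalemxAl obj_yx.
by rewrite scale_scalar_mx.
Qed.

Lemma acty_inj A k p (u v : 'M[Z]_(rk A, p)) :
  acty A ^+ k *m u = acty A ^+ k *m v -> u = v.
Proof.
have y1 : forall a b : 'M[Z]_(rk A, p), acty A *m a = acty A *m b -> a = b.
  move=> a b ab; apply: tmx_inj1; rewrite -!mul_scalar_mx -(obj_xy A).
  by rewrite -!mulmxA ab.
elim: k => [|k IHk]; first by rewrite expr0 !mul1mx.
rewrite exprS -mulmxE -!mulmxA => /y1; exact: IHk.
Qed.

Definition weight A (j : nat) p (v : 'M[Z]_(rk A, p)) : bool :=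
  actg A *m v == fps_const (zeta ^+ j) *: v.

Lemma weightD A j p (u v : 'M[Z]_(rk A, p)) :
  weight j u -> weight j v -> weight j (u + v).
Proof. by rewrite /weight mulmxDr scalerDr => /eqP -> /eqP ->. Qed.

Lemma weightZ A j p c (v : 'M[Z]_(rk A, p)) : weight j v -> weight j (c *: v).
Proof. by rewrite /weight -scalemxAr => /eqP ->; rewrite !scalerA mulrC. Qed.

Lemma weightN A j p (v : 'M[Z]_(rk A, p)) : weight j v -> weight j (- v).
Proof. by rewrite -scaleN1r; apply: weightZ. Qed.

Lemma weightB A j p (u v : 'M[Z]_(rk A, p)) :
  weight j u -> weight j v -> weight j (u - v).
Proof. by move=> hu hv; apply: weightD hu (weightN hv). Qed.

Lemma weightM A j p q (v : 'M[Z]_(rk A, p)) (w : 'M[Z]_(p, q)) :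
  weight j v -> weight j (v *m w).
Proof. by rewrite /weight mulmxA => /eqP ->; rewrite scalemxAl. Qed.

Lemma weight_hom A B (F : 'M[Z]_(rk B, rk A)) j p (v : 'M[Z]_(rk A, p)) :
  is_hom F -> weight j v -> weight j (F *m v).
Proof.
by case=> _ _ Fg; rewrite /weight mulmxA -Fg -mulmxA => /eqP ->; rewrite scalemxAr.
Qed.

Lemma weight_y A j p (v : 'M[Z]_(rk A, p)) : weight j.+1 v -> weight j (acty A *m v).
Proof.
rewrite /weight mulmxA obj_gy -scalemxAl -mulmxA => /eqP ->.
by rewrite -scalemxAr scalerA fps_constM exprS mulKf // zeta_nz.
Qed.

Lemma weight_yk A j k p (v : 'M[Z]_(rk A, p)) :
  weight (j + k) v -> weight j (acty A ^+ k *m v).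
Proof.
elim: k j => [|k IHk] j; first by rewrite addn0 expr0 mul1mx.
move=> hv; rewrite exprS -mulmxE -mulmxA; apply/weight_y/IHk.
by rewrite addSnnS.
Qed.

Lemma weight_x A j p (v : 'M[Z]_(rk A, p)) : weight j v -> weight j.+1 (actx A *m v).
Proof.
rewrite /weight mulmxA obj_gx -scalemxAl -mulmxA => /eqP ->.
by rewrite -scalemxAr scalerA fps_constM exprS.
Qed.

Lemma weight_modn A j p (v : 'M[Z]_(rk A, p)) : weight (j %% n) v = weight j v.
Proof. by rewrite /weight (prim_expr_mod hz). Qed.

Lemma weight_addn A j p (v : 'M[Z]_(rk A, p)) : weight (j + n) v = weight j v.
Proof. by rewrite -weight_modn modnDr weight_modn. Qed.

Lemma weight_t A j k p (v : 'M[Z]_(rk A, p)) : weight j (t ^+ k *: v) -> weight j v.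
Proof.
by rewrite /weight -scalemxAr scalerA mulrC -scalerA => /eqP /tmx_inj ->.
Qed.

(** The projector to the [zeta ^+ j]-eigenspace of [g]: the powers of [g] are averaged against a
    character of the cyclic group. *)
Definition wproj A j : 'M[Z]_(rk A) :=
  fps_const n%:R^-1 *:
    \sum_(0 <= k < n) (fps_const (zeta ^- (j * k)) *: actg A ^+ k).

Lemma natn_neq0 : n%:R != 0 :> R[i].
Proof. by rewrite Num.Theory.pnatr_eq0 -lt0n n_gt0. Qed.

Lemma wproj_weight A j : weight j (wproj A j).
Proof.
apply/eqP; rewrite -scalemxAr !scalerA mulrC -scalerA; congr (_ *: _).
rewrite mulmx_sumr; pose E k := fps_const (zeta ^- (j * k)) *: actg A ^+ k.
have e k : actg A *m (fps_const (zeta ^- (j * k)) *: actg A ^+ k)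
    = fps_const (zeta ^+ j) *: E k.+1.
  rewrite -scalemxAr mulmxE -exprS /E scalerA fps_constM mulnS exprD invfM mulrA.
  by rewrite divff ?mul1r // expf_neq0 // zeta_nz.
rewrite (eq_bigr _ (fun k _ => e k)) -scaler_sumr; congr (_ *: _).
have En : E n = E 0%N.
  by rewrite /E obj_gn muln0 mulnC exprM (prim_expr_order hz) expr1n expr0.
have : E 0%N + \sum_(0 <= k < n) E k.+1 = \sum_(0 <= k < n) E k + E n.
  by rewrite -big_nat_recr // -big_nat_recl.
by rewrite En addrC => /addIr.
Qed.

Lemma wproj_id A j p (v : 'M[Z]_(rk A, p)) : weight j v -> wproj A j *m v = v.
Proof.
move=> /eqP hv; rewrite -scalemxAl mulmx_suml.
have e k : actg A ^+ k *m v = fps_const (zeta ^+ (j * k)) *: v.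
  elim: k => [|k IHk]; first by rewrite muln0 !expr0 mul1mx scale1r.
  rewrite exprS -mulmxE -mulmxA IHk -scalemxAr hv scalerA fps_constM -exprD.
  by move=> {IHk hv}; rewrite mulnSr.
rewrite (eq_bigr (fun=> v)); last first.
  move=> k _. rewrite -scalemxAl. rewrite e scalerA fps_constM mulVf ?scale1r //.
  by rewrite expf_neq0 // zeta_nz.
rewrite sumr_const_nat subn0.
have -> : v *+ n = (n%:R : Z) *: v by rewrite scaler_nat.
rewrite scalerA.
have -> : (n%:R : Z) = fps_const n%:R.
  by elim: (n) => [|m IHm]; rewrite ?fps_const0 // !mulrS IHm fps_constD.
rewrite fps_constM (mulVf natn_neq0) scale1r; exact: erefl.
Qed.

Lemma wproj_hom A B (F : 'M[Z]_(rk B, rk A)) j :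
  is_hom F -> F *m wproj A j = wproj B j *m F.
Proof.
case=> _ _ Fg; rewrite -scalemxAl -scalemxAr mulmx_suml mulmx_sumr.
congr (_ *: _); apply: eq_bigr => k _; rewrite -scalemxAl -scalemxAr; congr (_ *: _).
elim: k => [|k IHk]; first by rewrite !expr0 mulmx1 mul1mx.
rewrite !exprS -!mulmxE mulmxA Fg -!mulmxA IHk; exact: erefl.
Qed.

(** Orthogonality of characters: for [0 < k < n] the [n] powers of [zeta ^- k] sum to zero, which
    leaves only the term [k = 0]. *)
Lemma wproj_sum A : \sum_(0 <= j < n) wproj A j = 1%:M.
Proof.
rewrite -scaler_sumr exchange_big_nat /=.
have e k : \sum_(0 <= j < n) fps_const (zeta ^- (j * k)) *: actg A ^+ k
   = fps_const (\sum_(0 <= j < n) (zeta ^- k) ^+ j) *: actg A ^+ k.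
  rewrite -scaler_suml; congr (_ *: _).
  elim: (n) => [|m IHm]; first by rewrite !big_nil fps_const0.
  rewrite !big_nat_recr //= fps_constD -IHm; congr (_ + fps_const _).
  by rewrite exprVn mulnC exprM.
have sum0 k : (0 < k < n)%N -> \sum_(0 <= j < n) (zeta ^- k) ^+ j = 0.
  case/andP=> k0 kn; have /eqP := subrX1 (zeta ^- k) n.
  rewrite big_mkord exprVn -exprM mulnC exprM (prim_expr_order hz) expr1n invr1 subrr.
  rewrite eq_sym mulf_eq0 subr_eq0 => /orP[|/eqP //].
  rewrite invr_eq1 -(prim_order_dvd hz) => /(dvdn_leq k0).
  by rewrite leqNgt kn.
rewrite (big_ltn n_gt0) e; set S := (X in _ + X).
have -> : S = 0.
  rewrite /S big_nat_cond big1 // => k /andP[hk _].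
  by rewrite e sum0 // fps_const0 scale0r.
rewrite addr0 expr0 invr1 (eq_bigr (fun=> 1)); last by move=> j _; rewrite expr1n.
by rewrite sumr_const_nat subn0 scalerA fps_constM mulVf ?natn_neq0 // scale1r.
Qed.


End Weights.

(** * The modules of rank one *)

Section RankOne.
Variables (R : realType) (n : nat) (zeta : R[i]).
Hypotheses (n2 : (2 <= n)%N) (hz : n.-primitive_root zeta).

Local Notation Z := (fps R[i]).
Local Notation t := (fps_t R[i]).
Local Notation obj := (obj n zeta).
Local Notation M := (Mod hz).
Implicit Types (A B C D : obj) (I J : twoset n).

Let n_gt0 : (0 < n)%N := prim_order_gt0 hz.

(** Positions are natural numbers read modulo [n], so that a full turn from any [m] is simply
    [m, ..., m + n]. *)
Definition od (k : nat) : 'I_n := Ordinal (ltn_pmod k n_gt0).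

Lemma od_val (i : 'I_n) : od i = i.
Proof. by apply: val_inj; rewrite /= modn_small. Qed.

Lemma od_eq j k : j = k %[mod n] -> od j = od k.
Proof. by move=> jk; apply: val_inj. Qed.

Lemma ordS_od k : ordS (od k) = od k.+1.
Proof. by apply: val_inj; rewrite /= -addn1 modnDml addn1. Qed.

Definition in_pos I (k : nat) : bool := od k \in val I.

Lemma in_pos_mod I j k : j = k %[mod n] -> in_pos I j = in_pos I k.
Proof. by move=> jk; rewrite /in_pos (od_eq jk). Qed.

Lemma in_pos_sum I m : (\sum_(k < n) in_pos I (m + k.+1) = 2)%N.
Proof.
rewrite -(eqP (valP I)) -sum1_card [RHS]big_mkcond /=.
have inj : injective (fun k : 'I_n => od (m + k.+1)).
  move=> a b /(congr1 val) /= /eqP; rewrite !addnS -!addSn eqn_modDl.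
  by rewrite !modn_small // => /eqP/val_inj.
by rewrite [RHS](reindex_inj inj) /=; apply: eq_bigr => k _; rewrite /in_pos; case: ifP.
Qed.

Definition ev (k : nat) : 'cV[Z]_n := delta_mx (od k) 0.

Lemma ev_mod j k : j = k %[mod n] -> ev j = ev k.
Proof. by move=> jk; rewrite /ev (od_eq jk). Qed.

Lemma mul_ev m (F : 'M[Z]_(m, n)) k : F *m ev k = col (od k) F.
Proof. by rewrite /ev -colE. Qed.

Lemma eq_on_ev m (F G : 'M[Z]_(m, n)) :
  (forall k, (k < n)%N -> F *m ev k = G *m ev k) -> F = G.
Proof.
move=> FG; apply/matrixP => i j; have := FG j (ltn_ord j).
by rewrite !mul_ev od_val => /matrixP/(_ i 0); rewrite !mxE.
Qed.

Lemma ev_y I k : acty (M I) *m ev k.+1 = t ^+ in_pos I k.+1 *: ev k.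
Proof.
rewrite mul_ev; apply/matrixP => i j; rewrite !mxE -ordS_od (inj_eq (@ordS_inj n)).
rewrite eq_sym (ord1 j) andbT /in_pos -ordS_od.
by case: eqP => _; rewrite ?mulr1 ?mulr0.
Qed.

Lemma ev_x I k : actx (M I) *m ev k = t ^+ (~~ in_pos I k.+1) *: ev k.+1.
Proof.
rewrite mul_ev; apply/matrixP => i j; rewrite !mxE (ord1 j) andbT /in_pos -ordS_od.
by case: eqP => [->|_]; rewrite ?mulr1 ?mulr0.
Qed.

Lemma ev_g I k : actg (M I) *m ev k = fps_const (zeta ^+ k) *: ev k.
Proof.
rewrite mul_ev; apply/matrixP => i j; rewrite !mxE (ord1 j) andbT.
case: eqP => [->|_]; last by rewrite mulr0n mulr0.
by rewrite mulr1n mulr1 /= (prim_expr_mod hz).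
Qed.

Lemma ev_weight I k : @weight _ _ _ (M I) k _ (ev k).
Proof. by rewrite /weight ev_g. Qed.

(** The weight spaces of [M I] have rank one: an entry at another position [i] is killed by the
    nonzero constant [zeta ^+ i - zeta ^+ k]. *)
Lemma weight_ev I k (u : 'cV[Z]_n) :
  @weight _ _ _ (M I) k _ u -> u = u (od k) 0 *: ev k.
Proof.
move=> /eqP ku; apply/matrixP => i j; rewrite (ord1 j) !mxE eqxx andbT.
have [->|ik] := eqVneq i (od k); first by rewrite mulr1.
rewrite mulr0; have /matrixP/(_ i 0) := ku; rewrite mul_diag_mx !mxE => /eqP.
rewrite -subr_eq0 -mulrBl -fps_constN -fps_constD => /eqP h.
apply: (@fps_const_inj _ (zeta ^+ i - zeta ^+ k)); last by rewrite h mulr0.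
by rewrite subr_eq0 (eq_prim_root_expr hz) modn_small //.
Qed.

Definition cols m (f : nat -> 'cV[Z]_m) : 'M[Z]_(m, n) :=
  \matrix_(a, j) f j a 0.

Lemma cols_ev m (f : nat -> 'cV[Z]_m) k : (k < n)%N -> cols f *m ev k = f k.
Proof.
move=> kn; rewrite mul_ev; apply/matrixP => i j.
by rewrite !mxE (ord1 j) /= modn_small.
Qed.

(** A homomorphism out of [M I] is a closed walk of weight vectors in [A]; by [hom_of_yg] only the
    steps of [y] have to be checked. *)
Lemma cols_hom I A (f : nat -> 'cV[Z]_(rk A)) :
  (forall k, (k < n)%N -> weight k (f k)) ->
  (forall k, (k < n)%N -> acty A *m f k.+1 = t ^+ in_pos I k.+1 *: f k) ->
  f n = f 0%N -> @is_hom _ _ _ (M I) A (cols f).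
Proof.
move=> fw fy fn; apply: hom_of_yg; apply: eq_on_ev => -[|k] kn; rewrite -!mulmxA.
(* Position 0 is the successor of [n.-1]: here the walk is closed by [fn]. *)
- have -> : ev 0 = ev n.-1.+1 by apply: ev_mod; rewrite prednK // modnn mod0n.
  have n1 : (n.-1 < n)%N by rewrite prednK.
  have -> : cols f *m ev n.-1.+1 = f n.-1.+1.
    rewrite prednK // fn -(cols_ev f n_gt0); congr (_ *m _).
    by apply: ev_mod; rewrite modnn mod0n.
  by rewrite ev_y -scalemxAr cols_ev // fy.
- by rewrite ev_y -scalemxAr !cols_ev // ?fy // ltnW.
- by rewrite ev_g -scalemxAr !cols_ev // (eqP (fw _ _)).
- by rewrite ev_g -scalemxAr !cols_ev // (eqP (fw _ _)).
Qed.

Lemma path_y A (s : nat -> 'cV[Z]_(rk A)) (e : nat -> nat) m :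
  (forall k, (k < m)%N -> acty A *m s k.+1 = t ^+ e k *: s k) ->
  acty A ^+ m *m s m = t ^+ (\sum_(k < m) e k) *: s 0%N.
Proof.
elim: m => [|m IHm] h; first by rewrite big_ord0 !expr0 mul1mx scale1r.
rewrite exprSr -mulmxE -mulmxA h // -scalemxAr IHm; last by move=> k km; apply: h; apply: ltnW.
by rewrite big_ord_recr /= scalerA -exprD addnC.
Qed.

(* The path may start at any position [m]: [y ^+ n = t ^+ 2] closes it up. *)
Lemma path_hom I A m (s : nat -> 'cV[Z]_(rk A)) :
  (forall k, (k <= n)%N -> weight (m + k) (s k)) ->
  (forall k, (k < n)%N -> acty A *m s k.+1 = t ^+ in_pos I (m + k.+1) *: s k) ->
  exists F : 'M[Z]_(rk A, rk (M I)),
    is_hom F /\ forall k, (k <= n)%N -> F *m ev (m + k) = s k.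
Proof.
move=> sw sy.
have sn : s n = s 0%N.
  have := path_y (e := fun k => in_pos I (m + k.+1)) sy.
  by rewrite in_pos_sum (acty_n n2) mul_scalar_mx => /tmx_inj.
(* The number of steps from position [m] to position [j], modulo [n]. *)
pose ix j := ((j + (n - m %% n)) %% n)%N.
have mr : (m %% n < n)%N by rewrite ltn_pmod.
have ixm j : (m + ix j = j %[mod n])%N.
  by rewrite /ix modnDmr -modnDml addnCA subnKC ?modnDr // ltnW.
have ixS j : s (ix j.+1) = s (ix j).+1.
  have jn : (ix j < n)%N by rewrite ltn_pmod.
  have e : ix j.+1 = ((ix j).+1 %% n)%N.
    by rewrite /ix -[in RHS]addn1 modnDml addn1 addSn.
  rewrite e; have [->|jn'] := eqVneq (ix j).+1 n; first by rewrite modnn sn.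
  by rewrite modn_small // ltn_neqAle jn' jn.
pose f j := s (ix j).
have fw k : weight k (f k).
  rewrite -(weight_modn hz) -ixm (weight_modn hz); apply: sw.
  by rewrite ltnW // ltn_pmod.
exists (cols f); split.
  apply: cols_hom => [k _|k kn|]; first exact: fw.
    rewrite /f ixS (sy _ (ltn_pmod _ n_gt0)); congr (t ^+ nat_of_bool _ *: _).
    by apply: in_pos_mod; rewrite addnS -addn1 -modnDml ixm modnDml addn1.
  by rewrite /f /ix addnC modnDr.
move=> k kn; rewrite -(@ev_mod ((m + k) %% n)); last by rewrite modn_mod.
rewrite cols_ev ?ltn_pmod // /f.
have -> : ix ((m + k) %% n)%N = (k %% n)%N.
  apply/eqP; rewrite -[X in X == _](modn_small (d := n)) ?ltn_pmod //.
  by rewrite -(eqn_modDl m) ixm modn_mod.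
have [->|kn'] := eqVneq k n; first by rewrite modnn sn.
by rewrite modn_small // ltn_neqAle kn' kn.
Qed.

End RankOne.

(** * Splitting off direct summands *)

(** A discrete intermediate value principle; it finds the step at which a vector leaves a chain of
    lattices. *)
Lemma last_true (P : nat -> Prop) a b : (a <= b)%N -> P a -> ~ P b ->
  exists k, [/\ (a <= k < b)%N, P k & ~ P k.+1].
Proof.
move=> /subnKC <-; elim: (b - a)%N => [|d IHd] Pa; first by rewrite addn0.
rewrite addnS => Pb; have [Pd|Pd] := pselect (P (a + d)%N).
  by exists (a + d)%N; split => //; rewrite leq_addr ltnS leqnn.
have [k [/andP[ak kd] Pk PSk]] := IHd Pa Pd; exists k; split=> //.
by rewrite ak ltnS ltnW.
Qed.

(** * Quotients of an object by a stable direct summand over Z *)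

Section Quotient.
Variables (R : realType) (n : nat) (zeta : R[i]).
Local Notation Z := (fps R[i]).
Variables (A : obj n zeta) (d : nat) (L : 'M[Z]_(d, rk A)) (E : 'M[Z]_(rk A, d)).
Hypotheses (LE : L *m E = 1%:M)
  (Lx : L *m actx A *m E *m L = L *m actx A)
  (Ly : L *m acty A *m E *m L = L *m acty A)
  (Lg : L *m actg A *m E *m L = L *m actg A).

Fact quot_mul (a b : 'M[Z]_(rk A)) : L *m a *m E *m L = L *m a ->
  L *m a *m E *m (L *m b *m E) = L *m (a *m b) *m E.
Proof. by move=> La; rewrite !mulmxA La. Qed.

Fact quot_exp (a : 'M[Z]_(rk A)) k : L *m a *m E *m L = L *m a ->
  (L *m a *m E) ^+ k = L *m a ^+ k *m E.
Proof.
move=> La; elim: k => [|k IHk]; first by rewrite !expr0 mulmx1 LE.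
rewrite !exprS IHk -!mulmxE; exact: quot_mul.
Qed.

Fact quot_scale (c : Z) (a : 'M[Z]_(rk A)) :
  L *m (c *: a) *m E = c *: (L *m a *m E).
Proof. by rewrite -scalemxAr -scalemxAl. Qed.

Fact quot_scalar (c : Z) : L *m c%:M *m E = c%:M.
Proof. by rewrite mul_mx_scalar -scalemxAl LE scalemx1. Qed.

(** The structure induced on the quotient of [A] by the kernel of [L], written in a basis by means
    of the linear section [E]. As [E *m L] is a projector with the same kernel as [L], the equations
    [Lx], [Ly], [Lg] say that this kernel is stable. *)
Definition quot_obj : obj n zeta.
Proof.
refine (@Obj R n zeta d (L *m actx A *m E) (L *m acty A *m E) (L *m actg A *m E)
          _ _ _ _ _ _).
- rewrite (@quot_mul (actx A) (acty A) Lx) obj_xy; exact: quot_scalar.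
- rewrite (@quot_mul (acty A) (actx A) Ly) obj_yx; exact: quot_scalar.
- apply: etrans (@quot_exp (actx A) 2 Lx) _.
  apply: etrans (esym (@quot_exp (acty A) (n - 2) Ly)).
  exact: (congr1 (fun a => L *m a *m E) (obj_rel A)).
- apply: etrans (@quot_exp (actg A) n Lg) (etrans _ (quot_scalar 1)).
  exact: (congr1 (fun a => L *m a *m E) (obj_gn A)).
- apply: etrans (@quot_mul (actg A) (actx A) Lg) _.
  rewrite obj_gx quot_scale; congr (_ *: _).
  exact: esym (@quot_mul (actx A) (actg A) Lx).
- apply: etrans (@quot_mul (actg A) (acty A) Lg) _.
  rewrite obj_gy quot_scale; congr (_ *: _).
  exact: esym (@quot_mul (acty A) (actg A) Ly).
Defined.

Lemma quot_hom : @is_hom _ _ _ A quot_obj L.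
Proof. by split; rewrite /=; apply/esym; [exact: Lx|exact: Ly|exact: Lg]. Qed.

End Quotient.

Section Splitting.
Variables (R : realType) (n : nat) (zeta : R[i]).
Local Notation Z := (fps R[i]).
Local Notation red := (map_mx (@fps_coef0 R[i])).
Local Notation lift := (map_mx (@fps_const R[i])).

Lemma mx_rinv_linv m p (a : 'M[Z]_(m, p)) (b : 'M[Z]_(p, m)) :
  m = p -> a *m b = 1%:M -> b *m a = 1%:M.
Proof. by move=> mp; move: a b; rewrite mp => a b; apply: mulmx1C. Qed.

(* Complements of free direct summands are free: a basis of the kernel of [G]
   modulo [t] lifts to a basis. *)
Lemma mx_complement c m (F : 'M[Z]_(m, c)) (G : 'M[Z]_(c, m)) : G *m F = 1%:M ->
  exists d (E : 'M[Z]_(m, d)) (L : 'M[Z]_(d, m)),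
    [/\ L *m E = 1%:M, G *m E = 0, L *m F = 0 & F *m G + E *m L = 1%:M].
Proof.
move=> GF; pose g := red G; pose h := col_base (cokermx g).
have gh : g *m h = 0.
  apply: (row_free_inj (row_base_free (cokermx g))).
  by rewrite -mulmxA mulmx_base mulmx_coker mul0mx.
have gf : g *m red F = 1%:M by rewrite -map_mxM GF map_mx1.
have rg : \rank g = c.
  apply/eqP; rewrite eqn_leq rank_leq_row -{1}(mxrank1 R[i] c) -gf.
  exact: mxrankM_maxl.
have cm : (c <= m)%N by rewrite -rg rank_leq_col.
have [k kh] : exists k, k *m h = 1%:M by apply/row_fullP/col_base_full.
(* [P] projects to the kernel of [G] along the image of [F], and so moves the lifted basis [h] into
   the true kernel without changing it modulo [t]. *)
pose P := 1%:M - F *m G; pose E := P *m lift h.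
have PF : P *m F = 0 by rewrite mulmxBl mul1mx -mulmxA GF mulmx1 subrr.
have GP : G *m P = 0 by rewrite mulmxBr mulmx1 mulmxA GF mul1mx subrr.
have PP : P *m P = P by rewrite {2}/P mulmxBr mulmx1 mulmxA PF mul0mx subr0.
have redE : red E = h.
  rewrite map_mxM red_lift map_mxB map_mx1 map_mxM mulmxBl mul1mx -mulmxA.
  by rewrite -/g gh mulmx0 subr0.
(* Modulo [t] this product is [k *m h = 1], hence it is invertible over [Z]. *)
have [|W [_ WKE]] := @mx_inv _ _ (lift k *m E).
  by rewrite map_mxM red_lift redE kh det1 oner_neq0.
pose L := W *m (lift k *m P).
have LE : L *m E = 1%:M by rewrite /L -mulmxA -mulmxA (mulmxA P) PP WKE.
have LF : L *m F = 0 by rewrite /L -!mulmxA PF !mulmx0.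
have GE : G *m E = 0 by rewrite mulmxA GP mul0mx.
exists (\rank (cokermx g)), E, L; split; [exact: LE|exact: GE|exact: LF|].
have e : col_mx G L *m row_mx F E = 1%:M.
  by rewrite mul_col_row GF GE LF LE -scalar_mx_block.
rewrite -mul_row_col; apply: mx_rinv_linv e.
by rewrite mxrank_coker rg subnKC.
Qed.

(** The complement is at once the quotient by the image of [F] and the kernel of [G]. The first is
    stable because [F] is a homomorphism, which gives the structure and makes [L] a homomorphism;
    the second is stable because [G] is one, which makes [E] a homomorphism. *)
Lemma split_off (A C : obj n zeta) (F : 'M[Z]_(rk A, rk C)) (G : 'M[Z]_(rk C, rk A)) :
  is_hom F -> is_hom G -> G *m F = 1%:M -> exists B, iso A (dsum C B).
Proof.
move=> hF hG GF; have [d [E [L [LE GE LF FGEL]]]] := mx_complement GF.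
have La (a : 'M[Z]_(rk A)) (c : 'M[Z]_(rk C)) : a *m F = F *m c ->
    L *m a *m E *m L = L *m a.
  move=> aF; have LaF : L *m a *m F = 0 by rewrite -mulmxA aF mulmxA LF mul0mx.
  rewrite -[RHS]mulmx1 -FGEL mulmxDr !mulmxA LaF mul0mx add0r; exact: erefl.
have Ea (a : 'M[Z]_(rk A)) (c : 'M[Z]_(rk C)) : G *m a = c *m G ->
    E *m (L *m a *m E) = a *m E.
  move=> aG; have GaE : G *m a *m E = 0 by rewrite aG -mulmxA GE mulmx0.
  rewrite -[RHS]mul1mx -FGEL mulmxDl -!mulmxA (mulmxA G) GaE mulmx0 add0r.
  exact: erefl.
have [Fx Fy Fg] := hF; have [Gx Gy Gg] := hG.
pose B := quot_obj LE (La _ _ (esym Fx)) (La _ _ (esym Fy)) (La _ _ (esym Fg)).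
exists B; apply: (@biprod_iso _ _ _ _ _ B F E G L) => //.
- by split; [exact: Ea Gx | exact: Ea Gy | exact: Ea Gg].
- exact: quot_hom.
Qed.

End Splitting.

(** * Coordinate functionals and reduction modulo t *)

Section Functionals.
Variables (R : realType) (n : nat) (zeta : R[i]).
Hypothesis hz : n.-primitive_root zeta.

Local Notation Z := (fps R[i]).
Local Notation t := (fps_t R[i]).
Local Notation obj := (obj n zeta).
Local Notation red := (map_mx (@fps_coef0 R[i])).
Local Notation M := (Mod hz).
Local Notation od := (od hz).
Local Notation ev := (ev hz).
Local Notation at_pos := (in_pos hz).
Implicit Types (A B C D : obj) (I J : twoset n).

Lemma actg_yk A k :
  actg A *m acty A ^+ k = fps_const (zeta ^- k) *: (acty A ^+ k *m actg A).
Proof.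
elim: k => [|k IHk]; first by rewrite !expr0 invr1 mul1mx mulmx1 scale1r.
rewrite exprSr -mulmxE mulmxA IHk -scalemxAl -[in LHS]mulmxA obj_gy -scalemxAr.
by rewrite {IHk} scalerA fps_constM exprSr invfM mulmxA.
Qed.

Lemma constmx_inj (c : R[i]) m p (u v : 'M[Z]_(m, p)) :
  c != 0 -> fps_const c *: u = fps_const c *: v -> u = v.
Proof.
move=> c0 uv; apply/matrixP => i j; apply: (fps_const_inj c0).
by have /matrixP/(_ i j) := uv; rewrite !mxE.
Qed.

Lemma weight_yk_inv A j k p (v : 'M[Z]_(rk A, p)) :
  weight j (acty A ^+ k *m v) -> weight (j + k) v.
Proof.
rewrite /weight mulmxA actg_yk -scalemxAl -mulmxA => /eqP h; apply/eqP.
apply: (@acty_inj _ _ _ A k); rewrite -[in RHS]scalemxAr.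
apply: (@constmx_inj (zeta ^- k)); first by rewrite invr_eq0 expf_neq0 ?(zeta_nz hz).
rewrite {}h scalerA fps_constM; congr (fps_const _ *: _).
by rewrite addnC exprD mulKf // expf_neq0 ?(zeta_nz hz).
Qed.

Lemma wproj_yk A j k : wproj A j *m acty A ^+ k = acty A ^+ k *m wproj A (j + k).
Proof.
rewrite -scalemxAl -scalemxAr mulmx_suml mulmx_sumr; congr (_ *: _).
apply: eq_bigr => m _; rewrite -scalemxAl -scalemxAr.
have -> : actg A ^+ m *m acty A ^+ k =
    fps_const (zeta ^- (m * k)) *: (acty A ^+ k *m actg A ^+ m).
  elim: m => [|m IHm]; first by rewrite !expr0 invr1 mul1mx mulmx1 scale1r.
  rewrite exprS -!mulmxE -[in LHS]mulmxA IHm -scalemxAr !mulmxA actg_yk -scalemxAl.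
  by rewrite {IHm} scalerA fps_constM mulSnr exprD invfM.
by rewrite scalerA fps_constM mulnDl exprD invfM (mulnC m).
Qed.

Lemma wproj_g A j : wproj A j *m actg A = fps_const (zeta ^+ j) *: wproj A j.
Proof.
rewrite -(eqP (wproj_weight hz A j)) -scalemxAl -scalemxAr mulmx_suml mulmx_sumr.
congr (_ *: _); apply: eq_bigr => k _; rewrite -scalemxAl -scalemxAr !mulmxE.
by rewrite -exprS -exprSr.
Qed.

Definition rows m (xi : nat -> 'rV[Z]_m) : 'M[Z]_(n, m) :=
  \matrix_(i, b) xi i 0 b.

Lemma row_rows m (xi : nat -> 'rV[Z]_m) i : row i (rows xi) = xi i.
Proof. by apply/rowP => j; rewrite !mxE. Qed.

Lemma My_mul I m (B : 'M[Z]_(n, m)) i j :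
  (My R (val I) *m B) i j = t ^+ (ordS i \in val I) * B (ordS i) j.
Proof.
rewrite mxE (bigD1 (ordS i)) //= mxE eqxx big1 ?addr0 // => k kNi.
by rewrite mxE (negPf kNi) mul0r.
Qed.

(** Dual to [cols_hom]: a homomorphism into [M I] is a closed walk of functionals. *)
Lemma rows_hom I A (xi : nat -> 'rV[Z]_(rk A)) :
  (forall k, (k < n)%N -> xi k *m actg A = fps_const (zeta ^+ k) *: xi k) ->
  (forall k, (k < n)%N -> xi k *m acty A = t ^+ at_pos I k.+1 *: xi k.+1) ->
  xi n = xi 0%N -> @is_hom _ _ _ A (M I) (rows xi).
Proof.
move=> xw xy xn; apply: hom_of_yg; apply/row_matrixP => i; rewrite row_mul row_rows.
- rewrite (xy _ (ltn_ord i)); apply/rowP => j; rewrite [LHS]mxE [RHS]mxE /= My_mul [in RHS]mxE.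
  have -> : at_pos I i.+1 = (ordS i \in val I) by rewrite /in_pos -ordS_od od_val.
  congr (_ * _); have [e|e] := eqVneq i.+1 n; first by rewrite /= e modnn xn.
  by rewrite /= modn_small // ltn_neqAle e ltn_ord.
- rewrite (xw _ (ltn_ord i)); apply/rowP => j; rewrite [LHS]mxE [RHS]mxE /= mul_diag_mx !mxE.
  exact: erefl.
Qed.

Lemma red_col m p (a : 'M[Z]_(m, p)) : red a != 0 -> exists j, red (col j a) != 0.
Proof.
move=> a0; apply: contrapT => h; move/negP: a0; apply; apply/eqP/matrixP => i j.
have /matrixP/(_ i 0) : red (col j a) = 0.
  by apply: contrapT => /eqP hj; apply: h; exists j.
by rewrite !mxE.
Qed.

(** Some weight space is nonzero, and the injective [y ^+ j] carries it into weight 0. Dividing by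
    the largest power of [t] leaves vectors of weight 0 that are nonzero modulo [t] and fixed by the
    projector. *)
Lemma wproj0_red A : (0 < rk A)%N -> red (wproj A 0) != 0.
Proof.
move=> A0; have [j wj] : exists j, wproj A j != 0.
  apply: contrapT => h; suff : 1%:M = 0 :> 'M[Z]_(rk A).
    move=> /matrixP/(_ (Ordinal A0) (Ordinal A0)); rewrite !mxE eqxx => /eqP.
    by rewrite oner_eq0.
  rewrite -(wproj_sum hz A) big1 // => j _; apply: contrapT => /eqP wj.
  by apply: h; exists j.
have : acty A ^+ j *m wproj A j != 0.
  apply: contraNN wj => /eqP yw; apply/eqP; apply: (@acty_inj _ _ _ A j).
  by rewrite mulmx0.
move=> /tmx_val[k [B [yB B0]]].
have wB : weight 0 B.
  apply: (@weight_t _ _ _ A 0 k); rewrite -yB; apply: (weight_yk hz (j := 0)).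
  exact: wproj_weight.
apply: contraNN B0; rewrite -(wproj_id hz wB) map_mxM => /eqP ->.
by rewrite mul0mx.
Qed.

(** The columns of [cokermx Y^T] cut out the column space of [Y], so one of them does not vanish on
    [v]; it is scaled to the value 1. *)
Lemma separating_row m p (v : 'cV[R[i]]_m) (Y : 'M[R[i]]_(m, p)) :
  (forall u, v <> Y *m u) ->
  exists xi : 'rV[R[i]]_m, xi *m v = 1%:M /\ xi *m Y = 0.
Proof.
move=> vY; pose c := v^T *m cokermx Y^T.
have [j cj] : exists j, c 0 j != 0.
  apply: contrapT => h; have : (v^T <= Y^T)%MS.
    rewrite submxE; apply/eqP/rowP => j; rewrite [RHS]mxE; apply: contrapT => /eqP hj.
    by apply: h; exists j.
  case/submxP => D /(congr1 trmx); rewrite trmx_mul !trmxK; exact: vY.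
exists ((c 0 j)^-1 *: (col j (cokermx Y^T))^T); split; apply: trmx_inj.
  rewrite trmx_mul linearZ /= trmxK -scalemxAr colE mulmxA -/c -colE.
  rewrite tr_scalar_mx -(mulVf cj) -scale_scalar_mx; congr (_ *: _).
  by apply/matrixP => a b; rewrite (ord1 a) (ord1 b) mxE [RHS]mxE eqxx mulr1n.
rewrite trmx_mul linearZ /= trmxK -scalemxAr colE mulmxA mulmx_coker mul0mx trmx0.
by apply/matrixP => a b; rewrite !mxE mulr0.
Qed.

End Functionals.

(** * A rank one summand in every nonzero object *)

Lemma step_count p q j : (p < q)%N ->
  ((p <= j.+1) + (q <= j.+1) =
   (p <= j) + (q <= j) + ((j.+1 == p) || (j.+1 == q)))%N.
Proof. by case: (ltngtP j.+1 p); case: (ltngtP j.+1 q); lia. Qed.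

Section RankOneSummand.
Variables (R : realType) (n : nat) (zeta : R[i]).
Hypotheses (n2 : (2 <= n)%N) (hz : n.-primitive_root zeta).

Local Notation Z := (fps R[i]).
Local Notation t := (fps_t R[i]).
Local Notation obj := (obj n zeta).
Local Notation red := (map_mx (@fps_coef0 R[i])).
Local Notation lift := (map_mx (@fps_const R[i])).
Local Notation M := (Mod hz).
Local Notation od := (od hz).
Local Notation ev := (ev hz).
Local Notation at_pos := (in_pos hz).
Implicit Types (A B C D : obj) (I J : twoset n).

(** The representatives are [1, ..., n] because a step of the chain is numbered by its end, and the
    last step ends at [n]. *)
Lemma od_eqE i j : (0 < i <= n)%N -> (0 < j <= n)%N -> (od i == od j) = (i == j).
Proof.
move=> /andP[i0 iN] /andP[j0 jN]; apply/eqP/eqP => [/(congr1 val) /= |-> //].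
have h k : (0 < k <= n)%N -> (k %% n)%N = if k == n then 0%N else k.
  move=> /andP[k0 kn]; case: eqP => [->|/eqP kn']; first by rewrite modnn.
  by rewrite modn_small // ltn_neqAle kn' kn.
by rewrite !h ?i0 ?j0 //; case: eqP; case: eqP; lia.
Qed.

Lemma tw_card i j : od i != od j -> #|[set od i; od j]| == 2%N.
Proof. by move=> h; rewrite cards2 h. Qed.

Definition tw i j (h : od i != od j) : twoset n :=
  exist (fun I : {set 'I_n} => #|I| == 2%N) [set od i; od j] (tw_card h).

Lemma at_tw i j (h : od i != od j) k :
  at_pos (tw h) k = (od k == od i) || (od k == od j).
Proof. by rewrite /in_pos /= in_set2. Qed.

(* The lattices [N_j = y^j V_j] of [V_0] decrease from [V_0] to [t^2 V_0]. If
   [p] is the first index with [N_p] inside [t A] and [v] in [N_(p-1)] is not in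
   [t A], then [v] spans a direct summand: with [q] such that [t v] lies in
   [N_(q-1)] but not in [N_q], some functional takes the value 1 at [v], values
   in [t Z] on [N_p] and values in [t^2 Z] on [N_q]. *)
Lemma rank_one_summand A : (0 < rk A)%N ->
  exists I (F : 'M[Z]_(rk A, rk (M I))) (G : 'M[Z]_(rk (M I), rk A)),
    [/\ is_hom F, is_hom G & G *m F = 1%:M].
Proof.
move=> A0; pose y := acty A.
have [w [ww wid wyk wg w0]] : exists w : nat -> 'M[Z]_(rk A),
    [/\ forall j, weight j (w j),
        forall j m (v : 'M[Z]_(rk A, m)), weight j v -> w j *m v = v,
        forall j k, w j *m y ^+ k = y ^+ k *m w (j + k)%N,
        forall j, w j *m actg A = fps_const (zeta ^+ j) *: w j & red (w 0%N) != 0].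
  exists (wproj A); split; [exact: wproj_weight|exact: (wproj_id hz)|
    exact: wproj_yk|exact: (wproj_g hz)|exact: (wproj0_red hz)].
have yn : y ^+ n = (t ^+ 2)%:M := acty_n n2 A.
have [|yn0|k [/andP[_ kn] P1k P1Sk]] :=
  @last_true (fun k => red (y ^+ k *m w k) != 0) 0 n (leq0n n).
- by rewrite expr0 mul1mx; exact: w0.
- by move: yn0; rewrite yn mul_scalar_mx expr2 -scalerA red_tmx eqxx.
have [j0 v0] := red_col P1k.
pose p := k.+1; pose wk := w k *m col j0 1%:M.
have wkw : weight k wk by apply: weightM.
have [v [vw {}v0 yv yxv]] : exists v : 'cV[Z]_(rk A),
    [/\ weight 0 v, red v != 0,
        forall m, (m <= k)%N -> y ^+ m *m (y ^+ (k - m) *m wk) = v &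
        y ^+ p *m (actx A *m wk) = t *: v].
  exists (y ^+ k *m wk); split; first exact: (@weight_yk _ _ _ hz A 0 k _ wk wkw).
  - by move: v0; rewrite colE -mulmxA /wk colE mul1mx.
  - move=> m mk; rewrite -expmxD (subnKC mk); exact: erefl.
  - rewrite exprSr -mulmxE -mulmxA (mulmxA (acty A)) obj_yx mul_scalar_mx -scalemxAr.
    exact: erefl.
have [Y1 Y1E] : exists Y1, y ^+ p *m w p = t *: Y1.
  by apply: tmx_div; apply/eqP; apply: contra_notT P1Sk.
(* At [p] the vector [x wk] qualifies, since [y ^+ p x = t y ^+ k]. At [n] one would get [v = t w'],
   although [v] is nonzero modulo [t]. *)
have [||l [/andP[pl ln] [w' [ww' yw']] P2q]] :=
  @last_true (fun l => exists w', weight l w' /\ y ^+ l *m w' = t *: v) p n kn.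
- by exists (actx A *m wk); split; [exact: weight_x wkw|exact: yxv].
- case=> w' [_]; rewrite yn mul_scalar_mx expr2 -scalerA => /tmx_inj1 vE.
  by move: v0; rewrite -vE red_tmx eqxx.
pose q := l.+1.
have pq : (p < q)%N by [].
have [Y2 [Y2E Y2w]] : exists Y2, y ^+ q *m w q = t *: Y2 /\ weight 0 Y2.
  pose Y2 := Y1 *m y ^+ (q - p) *m w q.
  have e : y ^+ q *m w q = t *: Y2.
    rewrite /Y2 !scalemxAl -Y1E -!mulmxA.
    have e : weight p (y ^+ (q - p) *m w q).
      apply: (@weight_yk _ _ _ hz A p (q - p) _ (w q)); rewrite (subnKC (ltnW pq)).
      exact: ww.
    rewrite (wid _ _ _ e) -expmxD (subnKC (ltnW pq)); exact: erefl.
  exists Y2; split; first exact: e.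
  apply: (@weight_t _ _ _ A 0 1); rewrite expr1 -e.
  exact: (@weight_yk _ _ _ hz A 0 q _ (w q) (ww q)).
(* Otherwise [v = Y2 u + t z], and as [t ^+ 2 = y ^+ n] the vector [t v] would lie in [y ^+ q V_q],
   against the choice of [q]. *)
have vY u : red v <> red Y2 *m u.
  move=> vu; have [|z vz] := @tmx_div _ _ _ (v - Y2 *m lift u).
    rewrite redB redM red_lift vu subrr; exact: erefl.
  apply: P2q; pose w'' := w q *m lift u + y ^+ (n - q) *m z.
  have e : y ^+ q *m w'' = t *: v.
    rewrite mulmxDr mulmxA Y2E -expmxD (subnKC ln) yn mul_scalar_mx.
    rewrite expr2 -scalerA -vz -scalemxAl -scalerDr addrC subrK; exact: erefl.
  exists w''; split; [|exact: e].
  apply: (@weight_yk_inv _ _ _ hz A 0 q _ w''); rewrite -/y e; exact: weightZ.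
have [xb [xbv xbY]] := separating_row vY.
have [s sv] : exists s, s *: (lift xb *m v) = 1%:M.
  have [|s es] := @fps_inv _ ((lift xb *m v) 0 0).
    have /matrixP/(_ 0 0) : red (lift xb *m v) = 1%:M by rewrite redM red_lift.
    by rewrite !mxE => ->; rewrite oner_neq0.
  exists s; apply/matrixP => a b; rewrite (ord1 a) (ord1 b) [LHS]mxE mulrC es.
  by rewrite mxE.
(* Composing with [w 0] makes [xi0] see weight 0 only, hence [xi0 *m y ^+ j] sees weight [j]
   only. *)
pose xi0 := s *: (lift xb *m w 0%N).
have xi0v : xi0 *m v = 1%:M.
  rewrite -scalemxAl -mulmxA (wid _ _ _ vw); exact: sv.
have xi0y j : xi0 *m y ^+ j = xi0 *m y ^+ j *m w j.
  rewrite -[in RHS]mulmxA -(wyk 0%N j) mulmxA; congr (_ *m _).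
  rewrite -scalemxAl -mulmxA (wid _ _ _ (ww 0%N)); exact: erefl.
have xi0g j : xi0 *m y ^+ j *m actg A = fps_const (zeta ^+ j) *: (xi0 *m y ^+ j).
  rewrite {1}xi0y -mulmxA wg -scalemxAr -xi0y; exact: erefl.
have xi0p : xi0 *m y ^+ p = t *: (xi0 *m Y1).
  rewrite xi0y -mulmxA Y1E -scalemxAr; exact: erefl.
have [rho xi0q] : exists rho, xi0 *m y ^+ q = t ^+ 2 *: rho.
  have [|rho e] := @tmx_div _ _ _ (xi0 *m Y2).
    rewrite -scalemxAl -mulmxA (wid _ _ _ Y2w); apply/matrixP => a b.
    have /matrixP/(_ a b) : red (lift xb *m Y2) = 0 by rewrite redM red_lift.
    by rewrite !mxE rmorphM => /= ->; rewrite mulr0.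
  exists rho; rewrite xi0y -mulmxA Y2E -scalemxAr e scalerA expr2.
  exact: erefl.
(* The exponent of [t] collected up to position [j]: the walks [f] and [xi] satisfy
   [y ^+ j f_j = t ^+ c j v] and [t ^+ c j xi_j = xi0 y ^+ j], which makes
   [xi_j f_j = xi0 v = 1]. *)
pose c j := ((p <= j) + (q <= j))%N.
have /choice[f fP] : forall j, exists fj : 'cV[Z]_(rk A), (j <= n)%N ->
    weight j fj /\ y ^+ j *m fj = t ^+ c j *: v.
  move=> j.
  have [jp|pj] := ltnP j p.
    have jk : (j <= k)%N := jp.
    exists (y ^+ (k - j) *m wk) => _; split.
      apply: (@weight_yk _ _ _ hz A j (k - j) _ wk); rewrite (subnKC jk); exact: wkw.
    rewrite (yv _ jk) /c leqNgt jp leqNgt (ltn_trans jp pq) expr0 scale1r.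
    exact: erefl.
  have [jq|qj] := ltnP j q.
    have jl : (j <= l)%N := jq.
    exists (y ^+ (l - j) *m w') => _; split.
      apply: (@weight_yk _ _ _ hz A j (l - j) _ w'); rewrite (subnKC jl); exact: ww'.
    rewrite -expmxD (subnKC jl) yw' /c pj leqNgt jq expr1; exact: erefl.
  exists (y ^+ (n - j) *m v) => jn; split.
    apply: (@weight_yk _ _ _ hz A j (n - j) _ v); rewrite (subnKC jn).
    move: vw; rewrite -(weight_addn hz); exact: id.
  rewrite -expmxD (subnKC jn) yn mul_scalar_mx /c pj qj; exact: erefl.
have /choice[xi xiP] : forall j, exists xj : 'rV[Z]_(rk A),
    t ^+ c j *: xj = xi0 *m y ^+ j.
  move=> j; have [jp|pj] := ltnP j p.
    exists (xi0 *m y ^+ j).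
    rewrite /c leqNgt jp leqNgt (ltn_trans jp pq) expr0 scale1r; exact: erefl.
  have [jq|qj] := ltnP j q.
    exists (xi0 *m Y1 *m y ^+ (j - p)); rewrite /c pj leqNgt jq expr1 scalemxAl -xi0p.
    rewrite -mul_expmxD (subnKC pj); exact: erefl.
  exists (rho *m y ^+ (j - q)); rewrite /c pj qj scalemxAl -xi0q.
  rewrite -mul_expmxD (subnKC qj); exact: erefl.
have pn : (0 < p <= n)%N by [].
have qn : (0 < q <= n)%N by [].
have pNq : od p != od q by rewrite (od_eqE pn qn) neq_ltn pq.
pose I := tw pNq.
have cS j : (j < n)%N -> c j.+1 = (c j + at_pos I j.+1)%N.
  move=> jn; have jn' : (0 < j.+1 <= n)%N := jn.
  by rewrite at_tw (od_eqE jn' pn) (od_eqE jn' qn) /c (step_count j pq).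
have c0 : c 0%N = 0%N by [].
have cn : c n = 2%N by rewrite /c; case/andP: pn => _ ->; case/andP: qn => _ ->.
have fn : f n = f 0%N.
  apply: (@acty_inj _ _ _ A n); have [_ ->] := fP n (leqnn n).
  have [_] := fP 0%N (leq0n n); rewrite c0 !expr0 mul1mx scale1r => ->.
  rewrite cn -/y yn mul_scalar_mx; exact: erefl.
have xin : xi n = xi 0%N.
  apply: (@tmx_inj _ 2); rewrite /= -{1}cn xiP yn mul_mx_scalar; congr (_ *: _).
  by have := xiP 0%N; rewrite c0 !expr0 mulmx1 scale1r => ->.
have fy j : (j < n)%N -> y *m f j.+1 = t ^+ at_pos I j.+1 *: f j.
  move=> jn; apply: (@acty_inj _ _ _ A j).
  have [_ e1] := fP j.+1 jn; have [_ e2] := fP j (ltnW jn).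
  rewrite -[acty A]/y mulmxA mulmxE -exprSr e1 -[in RHS]scalemxAr e2 (cS _ jn) scalerA.
  rewrite -exprD addnC; exact: erefl.
have xiy j : (j < n)%N -> xi j *m y = t ^+ at_pos I j.+1 *: xi j.+1.
  move=> jn; apply: (@tmx_inj _ (c j)); rewrite /= scalemxAl xiP scalerA -exprD -(cS _ jn).
  rewrite xiP exprSr -mulmxE mulmxA; exact: erefl.
have xig j : xi j *m actg A = fps_const (zeta ^+ j) *: xi j.
  apply: (@tmx_inj _ (c j)); rewrite /= scalemxAl xiP xi0g -xiP !scalerA mulrC.
  exact: erefl.
have xif j : (j < n)%N -> xi j *m f j = 1%:M.
  move=> jn; apply: (@tmx_inj _ (c j)); rewrite /= scalemxAl xiP -mulmxA.
  by have [_ ->] := fP j (ltnW jn); rewrite -scalemxAr; congr (_ *: _); exact: xi0v.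
have hF : @is_hom _ _ _ (M I) A (cols n f).
  by apply: cols_hom fy fn => j jn; case: (fP j (ltnW jn)).
have hG : @is_hom _ _ _ A (M I) (rows n xi) by apply: rows_hom xiy xin => j _.
exists I, (cols n f), (rows n xi); split; [exact: hF|exact: hG|].
apply: (eq_on_ev (hz := hz)) => j jn; rewrite mul1mx -mulmxA (cols_ev hz f jn).
have : @weight _ _ _ (M I) j _ (rows n xi *m f j).
  by apply: weight_hom hG _; case: (fP j (ltnW jn)).
move=> /weight_ev ->; rewrite -[RHS]scale1r; congr (_ *: _).
have oj : nat_of_ord (od j) = j by rewrite /= modn_small.
have /matrixP/(_ 0 0) : row (od j) (rows n xi *m f j) = 1%:M.
  rewrite row_mul row_rows oj; exact: xif.
by rewrite mxE [RHS]mxE.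
Qed.

End RankOneSummand.

(** * The Krull-Schmidt decomposition *)

Section KrullSchmidt.
Variables (R : realType) (n : nat) (zeta : R[i]).
Hypotheses (n2 : (2 <= n)%N) (hz : n.-primitive_root zeta).

Local Notation Z := (fps R[i]).
Local Notation t := (fps_t R[i]).
Local Notation obj := (obj n zeta).
Local Notation c0 := (@fps_coef0 R[i]).
Local Notation M := (Mod hz).
Local Notation od := (od hz).
Local Notation ev := (ev hz).
Local Notation at_pos := (in_pos hz).
Implicit Types (A B C D : obj) (I J : twoset n) (s : seq (twoset n)).

Let n_gt0 : (0 < n)%N := prim_order_gt0 hz.

Definition mod_sum s : obj := foldr (@dsum R n zeta) zero_obj (map M s).

Lemma dsm_cons I s : mod_sum (I :: s) = dsum (M I) (mod_sum s). Proof. by []. Qed.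

Lemma dsm_cat s1 s2 : iso (mod_sum (s1 ++ s2)) (dsum (mod_sum s1) (mod_sum s2)).
Proof.
elim: s1 => [|I s1 IH]; first exact: iso_sym (dsum_zerol _ (iso_refl zero_obj)).
rewrite cat_cons !dsm_cons.
exact: iso_trans (dsum_cong (iso_refl _) IH) (dsumA _ _ _).
Qed.

Lemma dsm_perm s1 s2 : perm_eq s1 s2 -> iso (mod_sum s1) (mod_sum s2).
Proof.
elim: s1 s2 => [|I s1 IH] s2.
  by rewrite perm_sym => /perm_nilP ->; exact: iso_refl.
move=> s12; have Is2 : I \in s2 by rewrite -(perm_mem s12) mem_head.
case/splitPr: Is2 s12 => p1 p2; rewrite perm_sym perm_catC cat_cons perm_cons.
rewrite perm_sym => h; rewrite dsm_cons.
apply: iso_trans (dsum_cong (iso_refl _) (IH _ h)) _.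
apply: iso_trans (dsum_cong (iso_refl _) (dsm_cat _ _)) _.
apply: iso_trans (iso_sym (dsm_cat _ _)).
rewrite dsm_cons; apply: iso_trans (dsumA _ _ _) _.
exact: dsumC.
Qed.

Lemma rk_dsm s : rk (mod_sum s) = (n * size s)%N.
Proof. by elim: s => [|I s IH]; rewrite ?muln0 // mulnS -IH. Qed.

Theorem classification A : exists s, iso A (mod_sum s).
Proof.
have [m] := ubnP (rk A); elim: m A => // m IHm A; rewrite ltnS => Am.
have [A0|A0] := posnP (rk A); first by exists [::]; apply/iso_zeroP.
have [I [F [G [hF hG GF]]]] := rank_one_summand n2 hz A0.
have [B iB] := split_off hF hG GF.
have [|s iBs] := IHm B.
  apply: leq_trans Am; have -> : rk A = (n + rk B)%N := iso_rk iB.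
  by rewrite -addn1 addnC leq_add2r.
exists (I :: s); apply: iso_trans iB _; exact: dsum_cong (iso_refl _) iBs.
Qed.

Lemma hom_ev I J (F : 'M[Z]_n) j : @is_hom _ _ _ (M I) (M J) F ->
  F *m ev j = F (od j) (od j) *: ev j.
Proof.
move=> hF; have : @weight _ _ _ (M J) j _ (F *m ev j).
  by apply: weight_hom hF _; apply: ev_weight.
by move=> /weight_ev e; rewrite {1}e mul_ev mxE.
Qed.

Lemma ev_inj (a b : Z) j : a *: ev j = b *: ev j -> a = b.
Proof. by move=> /matrixP/(_ (od j) 0); rewrite !mxE !eqxx !mulr1. Qed.

Lemma hom_step I J (F : 'M[Z]_n) j : @is_hom _ _ _ (M I) (M J) F ->
  t ^+ at_pos I j.+1 * F (od j) (od j) =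
  t ^+ at_pos J j.+1 * F (od j.+1) (od j.+1).
Proof.
move=> hF; have [_ Fy _] := hF; apply: (@ev_inj _ _ j).
rewrite -scalerA -(hom_ev _ hF) scalemxAr -ev_y mulmxA Fy -mulmxA.
by rewrite (hom_ev _ hF) -scalemxAr ev_y scalerA mulrC.
Qed.

Lemma twoset_eq I J : (forall j, at_pos I j.+1 = at_pos J j.+1) -> I = J.
Proof.
move=> IJ; apply/val_inj/setP => i; have := IJ (i + n.-1)%N.
rewrite /in_pos -addnS prednK //.
have -> : od (i + n) = i by apply: val_inj; rewrite /= modnDr modn_small.
by [].
Qed.

Lemma hom_end I (F : 'M[Z]_n) j : @is_hom _ _ _ (M I) (M I) F ->
  F (od j) (od j) = F (od 0) (od 0).
Proof.
move=> hF; elim: j => // j IHj; apply: (@fps_texp_inj _ (at_pos I j.+1)).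
by rewrite -(hom_step j hF) IHj.
Qed.

Lemma hom_end_scalar I (F : 'M[Z]_n) : @is_hom _ _ _ (M I) (M I) F ->
  F = (F (od 0) (od 0))%:M.
Proof.
move=> hF; apply: (eq_on_ev (hz := hz)) => j _.
by rewrite (hom_ev j hF) (hom_end j hF) mul_scalar_mx.
Qed.

(** The composite is a scalar with nonzero constant term, so every diagonal entry of [F] has one
    too. Then [hom_step] forces the powers of [t] in [M I] and [M J] to agree at each position. *)
Lemma hom_unit_eq I J (F G : 'M[Z]_n) :
  @is_hom _ _ _ (M I) (M J) F -> @is_hom _ _ _ (M J) (M I) G ->
  c0 ((G *m F) (od 0) (od 0)) != 0 -> I = J.
Proof.
move=> hF hG GF0.
have GFj j : (G *m F) (od j) (od j) = G (od j) (od j) * F (od j) (od j).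
  apply: (@ev_inj _ _ j); rewrite -(hom_ev (I := I) (J := I)); last exact: hom_comp hF hG.
  by rewrite -mulmxA (hom_ev j hF) -scalemxAr (hom_ev j hG) scalerA mulrC.
have Fj j : c0 (F (od j) (od j)) != 0.
  move: GF0; rewrite -(hom_end j (hom_comp hF hG)) GFj rmorphM mulf_eq0.
  by case/norP.
apply: twoset_eq => j; have /(congr1 c0) := hom_step j hF; rewrite !rmorphM !rmorphXn /=.
rewrite fps_coef0_t; have /negPf n1 := Fj j; have /negPf n2' := Fj j.+1.
case: (at_pos I j.+1); case: (at_pos J j.+1) => //=; rewrite expr0 expr1 mul0r mul1r.
  by move=> /esym/eqP; rewrite n2'.
by move=> /eqP; rewrite n1.
Qed.

Lemma coef0_addN m (X Y : 'M[Z]_m) i j :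
  c0 ((X + Y) i j) != 0 -> c0 (X i j) != 0 \/ c0 (Y i j) != 0.
Proof.
rewrite mxE rmorphD /=; have [->|X0] := eqVneq (c0 (X i j)) 0; last by left.
by rewrite add0r; right.
Qed.

(** The Krull-Schmidt argument for a local endomorphism ring: if a sum of two endomorphisms of [M I]
    has a nonzero constant term, so has one of them, and it passes through a single summand. *)
Lemma hom_through_dsm I s (F : 'M[Z]_(rk (mod_sum s), rk (M I)))
    (G : 'M[Z]_(rk (M I), rk (mod_sum s))) :
  is_hom F -> is_hom G -> c0 ((G *m F) (od 0) (od 0)) != 0 -> I \in s.
Proof.
elim: s F G => [|J s IH] F G hF hG.
  have -> : G *m F = 0.
    by apply/matrixP => i j; rewrite !mxE big1 // => -[].
  by rewrite mxE rmorph0 eqxx.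
move: F G hF hG; rewrite dsm_cons; move: (mod_sum s) IH => X IH F G hF hG.
rewrite (comp_dsum F G) in_cons => /coef0_addN[h|h]; apply/orP; [left|right].
  apply/eqP; apply: (hom_unit_eq _ _ h).
    exact: hom_comp hF (dsum_out1_hom _ _).
  exact: hom_comp (dsum_in1_hom _ _) hG.
apply: (IH _ _ _ _ h).
  exact: hom_comp hF (dsum_out2_hom _ _).
exact: hom_comp (dsum_in2_hom _ _) hG.
Qed.

Lemma summand_dsm I s X : iso X (mod_sum s) -> summand (M I) X -> I \in s.
Proof.
move=> iX sI; have [F [G [hF hG GF]]] := summand_retract (summand_iso (iso_refl _) iX sI).
by apply: hom_through_dsm hF hG _; rewrite GF mxE eqxx rmorph1 oner_neq0.
Qed.

Lemma dsm_summand I s : I \in s -> summand (M I) (mod_sum s).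
Proof.
case/splitPr => p1 p2; exists (mod_sum (p1 ++ p2)); rewrite -dsm_cons.
by apply: dsm_perm; rewrite perm_sym perm_catC cat_cons perm_cons perm_catC.
Qed.

(** All ranks are multiples of [n], while [M I] has rank [n]. *)
Lemma Mod_indecomposable I : indecomposable (M I).
Proof.
split=> [/iso_zeroP n0|B C iBC]; first by by move: n_gt0; rewrite -{1}[n]/(rk (M I)) n0.
have [[|J s] iB] := classification B; first by left.
have [[|J' s'] iC] := classification C; first by right.
have := iso_rk iBC; rewrite /= (iso_rk iB) (iso_rk iC) !rk_dsm /=; nia.
Qed.

Lemma indecomposable_Mod A : indecomposable A -> exists I, iso A (M I).
Proof.
case=> A0 hA; have [[|I s] iA] := classification A; first by case: A0.
exists I; have [I0|s0] := hA _ _ iA; first by case: (Mod_indecomposable I) => /(_ I0).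
exact: iso_trans iA (dsum_zeror _ s0).
Qed.

Lemma Mod_inj I J : iso (M I) (M J) -> I = J.
Proof.
move=> IJ; have : I \in [:: J].
  apply: (@summand_dsm _ _ (M I)).
    by apply: iso_trans IJ _; apply: iso_sym (dsum_zeror _ (iso_refl _)).
  by exists zero_obj; apply: dsum_zeror (iso_refl _).
by rewrite inE => /eqP.
Qed.

End KrullSchmidt.

(** * Vanishing of extensions *)

(** The elements are chosen outwards from the index [k0], by [back] below it and by [fwd] above
    it. *)
Lemma two_sided_chain T (P : nat -> T -> Prop) (Q : nat -> T -> T -> Prop) k0 n a0 :
  (k0 <= n)%N -> P k0 a0 ->
  (forall k b, (k < k0)%N -> P k.+1 b -> exists a, P k a /\ Q k a b) ->
  (forall k a, (k0 <= k < n)%N -> P k a -> exists b, P k.+1 b /\ Q k a b) ->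
  exists s : nat -> T, (forall k, (k <= n)%N -> P k (s k)) /\
    (forall k, (k < n)%N -> Q k (s k) (s k.+1)).
Proof.
move=> k0n Pa0 back fwd.
(* Choice needs total functions; [a0] is the default value where the premises fail. *)
have /choice[f fP] : forall kb : nat * T, exists a, (kb.1 < k0)%N -> P kb.1.+1 kb.2 ->
    P kb.1 a /\ Q kb.1 a kb.2.
  move=> [k b] /=; have [[kk0 Pb]|h] := pselect ((k < k0)%N /\ P k.+1 b).
    by have [a aP] := back _ _ kk0 Pb; exists a.
  by exists a0 => kk0 Pb; case: h.
have /choice[g gP] : forall ka : nat * T, exists b, (k0 <= ka.1 < n)%N -> P ka.1 ka.2 ->
    P ka.1.+1 b /\ Q ka.1 ka.2 b.
  move=> [k a] /=; have [[kk0 Pa]|h] := pselect ((k0 <= k < n)%N /\ P k a).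
    by have [b bP] := fwd _ _ kk0 Pa; exists b.
  by exists a0 => kk0 Pb; case: h.
pose fix sb d := if d is d'.+1 then f ((k0 - d)%N, sb d') else a0.
pose fix sf d := if d is d'.+1 then g ((k0 + d')%N, sf d') else a0.
have sbP d : (d <= k0)%N -> P (k0 - d)%N (sb d).
  elim: d => [|d IHd] dk; first by rewrite subn0.
  have [] // := fP ((k0 - d.+1)%N, sb d); first by rewrite /= ltn_subrL (leq_ltn_trans _ dk).
  by rewrite /= subnSK //; apply: IHd; apply: ltnW.
have sfP d : (k0 + d <= n)%N -> P (k0 + d)%N (sf d).
  elim: d => [|d IHd] dk; first by rewrite addn0.
  rewrite addnS in dk *; have [] // := gP ((k0 + d)%N, sf d).
    by rewrite /= leq_addr.
  by apply: IHd; apply: ltnW.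
exists (fun k => if (k < k0)%N then sb (k0 - k)%N else sf (k - k0)%N); split=> k kn.
  case: ltnP => kk0; last by rewrite -{1}(subnKC kk0); apply: sfP; rewrite subnKC.
  by rewrite -{1}(subKn (ltnW kk0)); apply: sbP; rewrite leq_subr.
case: (ltnP k k0) => kk0; last first.
  rewrite ltnNge (leq_trans kk0 (leqnSn _)) /= subSn //=.
  have [] // := gP ((k0 + (k - k0))%N, sf (k - k0)%N).
  - by rewrite /= subnKC // kk0.
  - by apply: sfP; rewrite subnKC // ltnW.
  - by rewrite /= subnKC.
have e : sb (k0 - k)%N = f (k, sb (k0 - k.+1)%N).
  by rewrite -(subnSK kk0) /= subnSK // subKn // ltnW.
have Pk : P k.+1 (sb (k0 - k.+1)%N).
  by rewrite -{1}(subKn kk0); apply: sbP; rewrite leq_subr.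
have [_ ] := fP (k, sb (k0 - k.+1)%N) kk0 Pk; rewrite e /=.
case: ltnP => // kk0'; have -> : k0 = k.+1 by apply/eqP; rewrite eqn_leq kk0' kk0.
by rewrite subnn.
Qed.

Section Lifts.
Variables (R : realType) (n : nat) (zeta : R[i]).
Hypothesis hz : n.-primitive_root zeta.

Local Notation Z := (fps R[i]).
Local Notation obj := (obj n zeta).
Implicit Types A B N : obj.

Lemma factor_cols r p m (G : 'M[Z]_(r, p)) (X : 'M[Z]_(r, m)) :
  (forall j, exists u : 'cV_p, col j X = G *m u) -> exists Y, X = G *m Y.
Proof.
move=> /choice[f fP]; exists (\matrix_(i, j) f j i 0); apply/matrixP => i j.
have /matrixP/(_ i 0) := fP j; rewrite mxE => ->; rewrite !mxE.
by apply: eq_bigr => k _; rewrite mxE.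
Qed.

Section OneExtension.
Variables (B N : obj) (E : extension B N).

Lemma ext_in_inj m (X Y : 'M[Z]_(rk N, m)) : ext_in E *m X = ext_in E *m Y -> X = Y.
Proof.
move=> XY; apply/eqP; rewrite -subr_eq0; apply/eqP; apply/matrixP => i j.
have /matrixP/(_ i 0) : col j (X - Y) = 0.
  by apply: (ext_inj (e := E)); rewrite colE mulmxA mulmxBr XY subrr mul0mx.
by rewrite !mxE.
Qed.

Lemma ext_factor m (X : 'M[Z]_(rk (ext_mid E), m)) :
  ext_out E *m X = 0 -> exists Y, X = ext_in E *m Y.
Proof.
move=> X0; apply: factor_cols => j; apply: ext_exact.
by rewrite colE mulmxA X0 mul0mx.
Qed.

Lemma ext_lift m (W : 'M[Z]_(rk B, m)) : exists V, W = ext_out E *m V.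
Proof. by apply: factor_cols => j; have [v <-] := ext_surj E (col j W); exists v. Qed.

(** Any lift can be replaced by its image under [wproj], which commutes with homomorphisms and fixes
    [w]. *)
Lemma ext_weight_lift j (w : 'cV[Z]_(rk B)) : weight j w ->
  exists v, weight j v /\ ext_out E *m v = w.
Proof.
move=> jw; have [v vw] := ext_surj E w; exists (wproj _ j *m v); split.
  by apply: weightM; apply: wproj_weight.
rewrite mulmxA (wproj_hom j (ext_out_hom E)) -mulmxA vw; exact: wproj_id.
Qed.

Lemma ext_factor_hom A (X : 'M[Z]_(rk (ext_mid E), rk A)) :
  is_hom X -> ext_out E *m X = 0 -> exists Y : 'M[Z]_(rk N, rk A),
    is_hom Y /\ X = ext_in E *m Y.
Proof.
case=> Xx Xy Xg X0; have [Y XY] := ext_factor X0; exists Y; split; last exact: XY.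
have [ix iy ig] := ext_in_hom E.
by split; apply: ext_in_inj; rewrite !mulmxA -XY ?(ix, iy, ig) -mulmxA -XY.
Qed.

End OneExtension.

(** In other words, the pullback of every extension by [N] along every [phi] splits; for [phi] the
    identity this is [Ext1_zero A N]. *)
Definition lifts A N : Prop :=
  forall B (E : extension B N) (phi : 'M[Z]_(rk B, rk A)), is_hom phi ->
  exists psi : 'M[Z]_(rk (ext_mid E), rk A), is_hom psi /\ ext_out E *m psi = phi.

Lemma lifts_Ext1 A N : lifts A N -> Ext1_zero A N.
Proof. by move=> h E; apply: h (hom_id A). Qed.

Lemma lifts_isol A A' N : iso A A' -> lifts A N -> lifts A' N.
Proof.
case=> F [G [hF hG GF FG]] h B E phi hphi.
have [psi [hpsi e]] := h _ E _ (hom_comp hF hphi).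
exists (psi *m G); split; first exact: hom_comp hG hpsi.
rewrite mulmxA e -mulmxA FG mulmx1; exact: erefl.
Qed.

Lemma lifts_dsuml A A' N : lifts A N -> lifts A' N -> lifts (dsum A A') N.
Proof.
move=> h h' B E phi hphi.
have [psi [hpsi e]] := h _ E _ (hom_comp (dsum_in1_hom A A') hphi).
have [psi' [hpsi' e']] := h' _ E _ (hom_comp (dsum_in2_hom A A') hphi).
exists (psi *m dsum_out1 A A' + psi' *m dsum_out2 A A'); split.
  apply: hom_add; [exact: hom_comp (dsum_out1_hom _ _) hpsi|].
  exact: hom_comp (dsum_out2_hom _ _) hpsi'.
rewrite mulmxDr !mulmxA e e' -!mulmxA -mulmxDr dsum_in_out mulmx1; exact: erefl.
Qed.

Lemma lifts_zerol N : lifts zero_obj N.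
Proof.
move=> B E phi _; exists 0; split; first exact: hom0.
by apply/matrixP => i [].
Qed.

Definition ext_precomp B N N' (E : extension B N) (F : 'M[Z]_(rk N, rk N'))
    (G : 'M[Z]_(rk N', rk N)) (hF : is_hom F) (GF : G *m F = 1%:M) (FG : F *m G = 1%:M) :
  extension B N'.
Proof.
refine (@Extension _ _ _ B N' (ext_mid E) (ext_in E *m F) (ext_out E) _ _ _ _ _ _).
- exact: hom_comp hF (ext_in_hom E).
- exact: ext_out_hom.
- move=> v; rewrite -mulmxA => /ext_inj Fv; rewrite -[v]mul1mx -GF -mulmxA Fv.
  exact: mulmx0.
- rewrite mulmxA ext_comp; exact: mul0mx.
- move=> v /ext_exact[u ->]; exists (G *m u); rewrite mulmxA -(mulmxA _ F) FG mulmx1.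
  exact: erefl.
- exact: ext_surj.
Defined.

Lemma lifts_isor A N N' : iso N N' -> lifts A N -> lifts A N'.
Proof.
case=> F [G [hF hG GF FG]] h B E phi hphi.
exact: (h _ (ext_precomp E hF GF FG) _ hphi).
Qed.

(** Here [ext_out E] is injective as well, and cancelling it shows that a linear section composed
    with [phi] respects the actions. *)
Lemma lifts_zeror A : lifts A zero_obj.
Proof.
move=> B E phi hphi; have [sg sgE] := ext_lift E 1%:M.
have oinj m (X Y : 'M[Z]_(rk (ext_mid E), m)) :
    ext_out E *m X = ext_out E *m Y -> X = Y.
  move=> XY; have [U XYU] : exists U, X - Y = ext_in E *m U.
    by apply: ext_factor; rewrite mulmxBr XY subrr.
  apply/eqP; rewrite -subr_eq0 XYU (flat_mx_eq U 0) ?mulmx0 //.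
have [ox oy og] := ext_out_hom E; have [px py pg] := hphi.
have aux (a : 'M_(rk A)) (b : 'M_(rk (ext_mid E))) (c : 'M_(rk B)) :
    ext_out E *m b = c *m ext_out E -> phi *m a = c *m phi ->
    sg *m phi *m a = b *m (sg *m phi).
  move=> ob pa; apply: oinj; rewrite !mulmxA ob -(mulmxA c) -sgE mulmx1 mul1mx.
  exact: pa.
exists (sg *m phi); split; last by rewrite mulmxA -sgE mul1mx.
by split; [exact: aux ox px|exact: aux oy py|exact: aux og pg].
Qed.

End Lifts.

(** * Lifting morphisms from rank one modules and their sums *)

Section Lifting.
Variables (R : realType) (n : nat) (zeta : R[i]).
Hypotheses (n2 : (2 <= n)%N) (hz : n.-primitive_root zeta).

Local Notation Z := (fps R[i]).
Local Notation t := (fps_t R[i]).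
Local Notation obj := (obj n zeta).
Local Notation M := (Mod hz).
Local Notation od := (od hz).
Local Notation ev := (ev hz).
Local Notation at_pos := (in_pos hz).
Local Notation dsm := (mod_sum hz).
Implicit Types (A B C D N : obj) (I J K : twoset n).

Let n_gt0 : (0 < n)%N := prim_order_gt0 hz.

(* An extension L by N1 + N2 is an extension by N2 of L / N2, which is itself an
   extension by N1. *)
Lemma lifts_dsumr A N1 N2 : lifts A N1 -> lifts A N2 -> lifts A (dsum N1 N2).
Proof.
move=> h1 h2 B E phi hphi.
pose L := ext_mid E; pose f := ext_in E; pose g := ext_out E.
pose i1 := dsum_in1 N1 N2; pose i2 := dsum_in2 N1 N2.
pose o1 := dsum_out1 N1 N2; pose o2 := dsum_out2 N1 N2.
have [sg gsg] := ext_lift E 1%:M.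
have [rho frho] : exists rho, 1%:M - sg *m g = f *m rho.
  by apply: ext_factor; rewrite mulmxBr mulmx1 mulmxA -gsg mul1mx subrr.
have gf : g *m f = 0 := ext_comp E.
have rhof : rho *m f = 1%:M.
  apply: (ext_in_inj (E := E)); rewrite -/f mulmxA -frho mulmxBl mul1mx -mulmxA gf.
  by rewrite mulmx0 subr0 mulmx1.
have rhosg : rho *m sg = 0.
  apply: (ext_in_inj (E := E)); rewrite -/f mulmxA -frho mulmxBl mul1mx -mulmxA -gsg.
  by rewrite mulmx1 subrr mulmx0.
(* Over [Z] the middle term is the sum of [N1], [N2] and [B], by means of [rho] and [sg]. [Q]
   forgets [N2], and [Q'] is a linear section of it. *)
pose Q : 'M[Z]_(rk N1 + rk B, rk L) := col_mx (o1 *m rho) g.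
pose Q' : 'M[Z]_(rk L, rk N1 + rk B) := row_mx (f *m i1) sg.
pose p1 : 'M[Z]_(rk N1, rk N1 + rk B) := row_mx 1%:M 0.
pose p2 : 'M[Z]_(rk B, rk N1 + rk B) := row_mx 0 1%:M.
have o1i1 : o1 *m i1 = 1%:M := dsum_out1_in1 N1 N2.
have o1i2 : o1 *m i2 = 0 := dsum_out1_in2 N1 N2.
have o2i2 : o2 *m i2 = 1%:M := dsum_out2_in2 N1 N2.
have rhofi1 : o1 *m rho *m (f *m i1) = 1%:M.
  by rewrite -mulmxA (mulmxA rho) rhof mul1mx.
have QQ' : Q *m Q' = 1%:M.
  rewrite mul_col_row rhofi1 -[o1 *m rho *m sg]mulmxA rhosg mulmx0.
  by rewrite (mulmxA g) gf mul0mx -gsg -scalar_mx_block.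
have Qfi2 : Q *m (f *m i2) = 0.
  rewrite mul_col_mx -(mulmxA o1) (mulmxA rho) rhof mul1mx o1i2 (mulmxA g) gf mul0mx.
  exact: col_mx0.
have Q'Q : 1%:M - Q' *m Q = f *m i2 *m (o2 *m rho).
  have e : f *m rho = f *m i1 *m (o1 *m rho) + f *m i2 *m (o2 *m rho).
    rewrite !mulmxA -mulmxDl -!(mulmxA f) -mulmxDr dsum_in_out mulmx1; exact: erefl.
  rewrite mul_row_col opprD addrA addrAC frho e addrC addKr; exact: erefl.
have Q'E : Q' = f *m i1 *m p1 + sg *m p2.
  rewrite !mul_mx_row !mulmx1 !mulmx0 add_row_mx addr0 add0r; exact: erefl.
have p1Q : p1 *m Q = o1 *m rho by rewrite mul_row_col mul1mx mul0mx addr0.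
have p2Q : p2 *m Q = g by rewrite mul_row_col mul1mx mul0mx add0r.
have [fx fy fg] := ext_in_hom E.
have [gx gy gg] := ext_out_hom E.
have [ix iy ig] := dsum_in2_hom N1 N2.
(* The kernel of [Q] is the image of [N2], which the actions preserve. *)
have Qa (a : 'M[Z]_(rk L)) (b : 'M[Z]_(rk (dsum N1 N2))) (c : 'M[Z]_(rk N2)) :
    f *m b = a *m f -> i2 *m c = b *m i2 -> Q *m a *m Q' *m Q = Q *m a.
  move=> fb ic; apply/esym/eqP; rewrite -subr_eq0 -(mulmxA (Q *m a)).
  rewrite -[X in X - _]mulmx1 -mulmxBr Q'Q; apply/eqP.
  rewrite [LHS]mulmxA -[Q *m a *m _]mulmxA (mulmxA a) -fb -[f *m b *m i2]mulmxA -ic.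
  rewrite (mulmxA f) (mulmxA Q) Qfi2 !mul0mx; exact: erefl.
pose L1 := quot_obj QQ' (Qa _ _ _ fx ix) (Qa _ _ _ fy iy) (Qa _ _ _ fg ig).
have hQ : @is_hom _ _ _ L L1 Q := quot_hom QQ' _ _ _.
have p2a (a : 'M[Z]_(rk L)) (c : 'M[Z]_(rk B)) :
    g *m a = c *m g -> p2 *m (Q *m a *m Q') = c *m p2.
  move=> ga; rewrite !mulmxA p2Q ga -p2Q -!mulmxA QQ' mulmx1; exact: erefl.
have hp2 : @is_hom _ _ _ L1 B p2 by split; [exact: p2a gx|exact: p2a gy|exact: p2a gg].
have fi1 : @is_hom _ _ _ N1 L1 (Q *m (f *m i1)).
  exact: hom_comp (hom_comp (dsum_in1_hom N1 N2) (ext_in_hom E)) hQ.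
have inj1 (v : 'cV[Z]_(rk N1)) : Q *m (f *m i1) *m v = 0 -> v = 0.
  move=> /(congr1 (mulmx p1)); rewrite !mulmxA p1Q -[_ *m f *m i1]mulmxA.
  rewrite rhofi1 mul1mx mulmx0; exact: id.
have comp1 : p2 *m (Q *m (f *m i1)) = 0 by rewrite mulmxA p2Q mulmxA gf mul0mx.
have exact1 (v : 'cV[Z]_(rk N1 + rk B)) : p2 *m v = 0 ->
    exists u : 'cV[Z]_(rk N1), v = Q *m (f *m i1) *m u.
  move=> v0; have e : Q' *m v = f *m i1 *m (p1 *m v).
    rewrite Q'E mulmxDl -[sg *m p2 *m v]mulmxA v0 mulmx0 addr0.
    exact: esym (mulmxA (f *m i1) p1 v).
  exists (p1 *m v); rewrite -[LHS]mul1mx -QQ' -[LHS]mulmxA e [LHS]mulmxA.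
  exact: erefl.
have surj1 (w : 'cV[Z]_(rk B)) : exists v : 'cV[Z]_(rk N1 + rk B), p2 *m v = w.
  exists (Q *m (sg *m w)); rewrite !mulmxA p2Q -gsg mul1mx; exact: erefl.
pose E1 : extension B N1 :=
  @Extension R n zeta B N1 L1 (Q *m (f *m i1)) p2 fi1 hp2 inj1 comp1 exact1 surj1.
have inj2 (v : 'cV[Z]_(rk N2)) : f *m i2 *m v = 0 -> v = 0.
  rewrite -mulmxA => /ext_inj/(congr1 (mulmx o2)).
  rewrite mulmxA o2i2 mul1mx mulmx0; exact: id.
have exact2 (v : 'cV[Z]_(rk L)) : Q *m v = 0 ->
    exists u : 'cV[Z]_(rk N2), v = f *m i2 *m u.
  move=> Qv; exists (o2 *m rho *m v); rewrite mulmxA -Q'Q mulmxBl mul1mx.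
  rewrite -mulmxA Qv mulmx0 subr0; exact: erefl.
have surj2 (w : 'cV[Z]_(rk N1 + rk B)) : exists v : 'cV[Z]_(rk L), Q *m v = w.
  exists (Q' *m w); rewrite mulmxA QQ' mul1mx; exact: erefl.
have fi2 : @is_hom _ _ _ N2 L (f *m i2).
  exact: hom_comp (dsum_in2_hom N1 N2) (ext_in_hom E).
pose E2 : extension L1 N2 :=
  @Extension R n zeta L1 N2 L (f *m i2) Q fi2 hQ inj2 Qfi2 exact2 surj2.
have [psi1 [hpsi1 e1]] := h1 _ E1 phi hphi.
have [psi [hpsi e]] := h2 _ E2 psi1 hpsi1.
exists psi; split; first exact: hpsi.
by rewrite -/g -p2Q -mulmxA [Q *m psi]e.
Qed.

Lemma lifts_dsm (s s' : seq (twoset n)) :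
  (forall I J, I \in s -> J \in s' -> lifts (M I) (M J)) ->
  lifts (dsm s) (dsm s').
Proof.
move=> h; elim: s h => [|I s IH] h; first exact: lifts_zerol.
apply: lifts_dsuml; last first.
  by apply: IH => K J Ks Js; apply: h => //; rewrite in_cons Ks orbT.
have {IH} : forall J, J \in s' -> lifts (M I) (M J).
  by move=> J Js; apply: h => //; apply: mem_head.
elim: s' {h} => [|J s' IH] h; first exact: lifts_zeror.
apply: lifts_dsumr; first by apply: h; apply: mem_head.
by apply: IH => K Ks; apply: h; rewrite in_cons Ks orbT.
Qed.

Lemma hom_xv A B (F : 'M[Z]_(rk B, rk A)) p (v : 'M[Z]_(rk A, p)) : is_hom F ->
  F *m (actx A *m v) = actx B *m (F *m v).
Proof. by case=> Fx _ _; rewrite !mulmxA Fx. Qed.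

Lemma hom_yv A B (F : 'M[Z]_(rk B, rk A)) p (v : 'M[Z]_(rk A, p)) : is_hom F ->
  F *m (acty A *m v) = acty B *m (F *m v).
Proof. by case=> _ Fy _; rewrite !mulmxA Fy. Qed.

Section LiftMod.
Variables (K J : twoset n) (B : obj) (E : extension B (M J)).
Variable phi : 'M[Z]_(rk B, n).
Hypothesis hphi : @is_hom _ _ _ (M K) B phi.

Lemma phi_weight j : weight j (phi *m ev j).
Proof. by apply: (weight_hom (A := M K)) hphi _; apply: ev_weight. Qed.

(** The kernel is a copy of [M J], whose weight spaces have rank one. *)
Lemma ker_weight j (v : 'cV[Z]_(rk (ext_mid E))) : weight j v -> ext_out E *m v = 0 ->
  exists b, v = b *: (ext_in E *m ev j).
Proof.
move=> jv /ext_exact[u vu].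
have : weight j (wproj (M J) j *m u) by apply: weightM; apply: wproj_weight.
move=> /weight_ev; set b := (X in X *: _) => e; exists b.
rewrite scalemxAr -e mulmxA (wproj_hom j (ext_in_hom E)) -mulmxA -vu.
by rewrite (wproj_id hz jv).
Qed.

Let hout := ext_out_hom E.
Let hin := ext_in_hom E.

Lemma phi_x j : at_pos K j.+1 -> phi *m ev j.+1 = actx B *m (phi *m ev j).
Proof.
by move=> K1; rewrite -(hom_xv (A := M K) _ hphi) ev_x K1 expr0 scale1r.
Qed.

Lemma phi_y j : ~~ at_pos K j.+1 -> phi *m ev j = acty B *m (phi *m ev j.+1).
Proof.
by move=> K0; rewrite -(hom_yv (A := M K) _ hphi) ev_y (negPf K0) expr0 scale1r.
Qed.

Lemma in_x j : at_pos J j.+1 ->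
  ext_in E *m ev j.+1 = actx (ext_mid E) *m (ext_in E *m ev j).
Proof. by move=> J1; rewrite -(hom_xv _ hin) ev_x J1 expr0 scale1r. Qed.

Lemma in_y j : ~~ at_pos J j.+1 ->
  ext_in E *m ev j = acty (ext_mid E) *m (ext_in E *m ev j.+1).
Proof. by move=> J0; rewrite -(hom_yv _ hin) ev_y (negPf J0) expr0 scale1r. Qed.

Lemma in_weight j b : weight j (b *: (ext_in E *m ev j)).
Proof. by apply/weightZ/(weight_hom (A := M J)) => //; apply: ev_weight. Qed.

Lemma out_correct s b j : ext_out E *m (s + b *: (ext_in E *m ev j)) = ext_out E *m s.
Proof. by rewrite mulmxDr -scalemxAr mulmxA ext_comp mul0mx scaler0 addr0. Qed.

(** If [j.+1] is not in [K], then [y s] is the next vector. If it is, [s] has to be divided by [x]: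
    for any lift [s0] one step below, [s - x s0] is a multiple of [ext_in E *m ev j.+1], and this
    vector is itself in the image of [x] because [j.+1] is also in [J]. *)
Lemma lift_down j (s : 'cV[Z]_(rk (ext_mid E))) : (at_pos K j.+1 -> at_pos J j.+1) ->
  weight j.+1 s /\ ext_out E *m s = phi *m ev j.+1 ->
  exists s', (weight j s' /\ ext_out E *m s' = phi *m ev j) /\
    acty (ext_mid E) *m s = t ^+ at_pos K j.+1 *: s'.
Proof.
move=> KJ [ws os]; have [K1|K0] := boolP (at_pos K j.+1); last first.
  exists (acty (ext_mid E) *m s); rewrite expr0 scale1r; split; last exact: erefl.
  split; first exact: (weight_y hz ws).
  rewrite (hom_yv _ hout) os; exact: esym (phi_y K0).
have [s0 [ws0 os0]] := ext_weight_lift hz E (phi_weight j).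
have [b sb] : exists b, s - actx _ *m s0 = b *: (ext_in E *m ev j.+1).
  apply: ker_weight; first by apply: weightB ws (weight_x ws0).
  rewrite mulmxBr os (hom_xv _ hout) os0 (phi_x K1); exact: subrr.
pose s' := s0 + b *: (ext_in E *m ev j).
have sE : s = actx _ *m s'.
  rewrite mulmxDr -scalemxAr -(in_x (KJ K1)) -sb addrC subrK; exact: erefl.
exists s'; split.
  split; first exact: weightD ws0 (in_weight _ _).
  rewrite out_correct; exact: os0.
rewrite sE mulmxA obj_yx mul_scalar_mx; exact: erefl.
Qed.

(** The mirror image of [lift_down]: [x] moves up for free when [j.+1] is in [K]; otherwise [s] is
    divided by [y], and the correction term is divisible because [j.+1] is outside [J]. *)
Lemma lift_up j (s : 'cV[Z]_(rk (ext_mid E))) : (at_pos J j.+1 -> at_pos K j.+1) ->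
  weight j s /\ ext_out E *m s = phi *m ev j ->
  exists s', (weight j.+1 s' /\ ext_out E *m s' = phi *m ev j.+1) /\
    acty (ext_mid E) *m s' = t ^+ at_pos K j.+1 *: s.
Proof.
move=> JK [ws os]; have [K1|K0] := boolP (at_pos K j.+1).
  exists (actx (ext_mid E) *m s); split; last first.
    rewrite mulmxA obj_yx mul_scalar_mx; exact: erefl.
  split; first exact: weight_x ws.
  rewrite (hom_xv _ hout) os; exact: esym (phi_x K1).
have J0 : ~~ at_pos J j.+1 by apply: contraNN K0.
have [s0 [ws0 os0]] := ext_weight_lift hz E (phi_weight j.+1).
have [b sb] : exists b, s - acty _ *m s0 = b *: (ext_in E *m ev j).
  apply: ker_weight; first by apply: weightB ws (weight_y hz ws0).
  rewrite mulmxBr os (hom_yv _ hout) os0 -(phi_y K0); exact: subrr.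
pose s' := s0 + b *: (ext_in E *m ev j.+1).
have sE : s = acty _ *m s'.
  rewrite mulmxDr -scalemxAr -(in_y J0) -sb addrC subrK; exact: erefl.
exists s'; rewrite expr0 scale1r; split; last exact: esym sE.
split; first exact: weightD ws0 (in_weight _ _).
rewrite out_correct; exact: os0.
Qed.

End LiftMod.

(* Starting from a lift at [m + k0], go down to [m] and up to [m + n]. *)
Lemma lifts_Mod K J m k0 : (k0 <= n)%N ->
  (forall k, (k < k0)%N -> at_pos K (m + k.+1) -> at_pos J (m + k.+1)) ->
  (forall k, (k0 <= k < n)%N -> at_pos J (m + k.+1) -> at_pos K (m + k.+1)) ->
  lifts (M K) (M J).
Proof.
move=> k0n KJ JK B E phi hphi.
have [s0 s0P] := ext_weight_lift hz E (phi_weight hphi (m + k0)).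
have [|||s [sP sQ]] := @two_sided_chain _
  (fun k s => weight (m + k) s /\ ext_out E *m s = phi *m ev (m + k))
  (fun k s s' => acty (ext_mid E) *m s' = t ^+ at_pos K (m + k.+1) *: s) k0 n s0 k0n.
- exact: s0P.
- move=> k b kk0 Pb; have := KJ k kk0; rewrite addnS => h.
  by apply: (lift_down hphi h); rewrite -addnS.
- move=> k a kk0 Pa; have := JK k kk0; rewrite addnS => h.
  exact: (lift_up hphi h).
have [F [hF Fs]] := path_hom n2 (A := ext_mid E) (fun k kn => (sP k kn).1) sQ.
exists F; split; first exact: hF.
have ej j : (j < n)%N -> exists k, (k <= n)%N /\ ev j = ev (m + k).
  move=> jn; have mn : (m %% n < n)%N by rewrite ltn_pmod.
  exists ((j + (n - m %% n)) %% n)%N; split; first by rewrite ltnW // ltn_pmod.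
  by apply: ev_mod; rewrite modnDmr -modnDml addnCA subnKC ?modnDr // ltnW.
apply: (eq_on_ev (hz := hz)) => j jn; have [k [kn ->]] := ej j jn.
by rewrite -mulmxA (Fs k kn); case: (sP k kn).
Qed.

End Lifting.

(** * Extensions between crossing chords *)

Section Crossing.
Variables (R : realType) (n : nat) (zeta : R[i]).
Hypotheses (n2 : (2 <= n)%N) (hz : n.-primitive_root zeta).

Local Notation Z := (fps R[i]).
Local Notation t := (fps_t R[i]).
Local Notation obj := (obj n zeta).
Local Notation c0 := (@fps_coef0 R[i]).
Local Notation M := (Mod hz).
Local Notation od := (od hz).
Local Notation ev := (ev hz).
Local Notation at_pos := (in_pos hz).

Let n_gt0 : (0 < n)%N := prim_order_gt0 hz.

Definition tdiag (e : 'I_n -> nat) : 'M[Z]_n := diag_mx (\row_j t ^+ e j).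

Lemma tdiagE e p (v : 'M[Z]_(n, p)) i j : (tdiag e *m v) i j = t ^+ e i * v i j.
Proof. by rewrite mul_diag_mx !mxE. Qed.

Lemma NtdiagE e p (v : 'M[Z]_(n, p)) i j : (- tdiag e *m v) i j = - (t ^+ e i * v i j).
Proof. by rewrite mulNmx mxE tdiagE. Qed.

Lemma tdiag2E e e' p (u v : 'M[Z]_(n, p)) i j :
  (tdiag e *m u + tdiag e' *m v) i j = t ^+ e i * u i j + t ^+ e' i * v i j.
Proof. by rewrite mxE (tdiagE e u) (tdiagE e' v). Qed.

Lemma tdiag_ev e k : tdiag e *m ev k = t ^+ e (od k) *: ev k.
Proof.
apply/matrixP => i j; rewrite tdiagE !mxE (ord1 j) andbT.
by case: eqP => [->|_]; rewrite ?mulr0.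
Qed.

Lemma tdiagM e e' : tdiag e *m tdiag e' = tdiag (fun i => e i + e' i)%N.
Proof.
rewrite mulmx_diag; congr diag_mx; apply/rowP => i; rewrite !mxE exprD.
exact: erefl.
Qed.

Lemma eq_on_evS m (F G : 'M[Z]_(m, n)) :
  (forall k, F *m ev k.+1 = G *m ev k.+1) -> F = G.
Proof.
move=> FG; apply: (eq_on_ev (hz := hz)) => k _.
have <- : ev (k + n.-1).+1 = ev k.
  by apply: ev_mod; rewrite -addnS (prednK n_gt0) modnDr.
exact: FG.
Qed.

Lemma tdiag_hom (I J : twoset n) e :
  (forall k, e (od k) + at_pos I k.+1 = e (od k.+1) + at_pos J k.+1)%N ->
  @is_hom _ _ _ (M I) (M J) (tdiag e).
Proof.
move=> eIJ; apply: hom_of_yg; apply: eq_on_evS => k.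
  have l : tdiag e *m (acty (M I) *m ev k.+1) = t ^+ (e (od k) + at_pos I k.+1) *: ev k.
    by rewrite ev_y -scalemxAr tdiag_ev scalerA -exprD addnC.
  have r : acty (M J) *m (tdiag e *m ev k.+1) =
      t ^+ (e (od k.+1) + at_pos J k.+1) *: ev k.
    rewrite tdiag_ev -scalemxAr ev_y scalerA -exprD; exact: erefl.
  apply: etrans (esym (mulmxA _ _ _)) (etrans l _).
  rewrite eIJ -r; exact: mulmxA.
have l : tdiag e *m (actg (M I) *m ev k.+1) =
    fps_const (zeta ^+ k.+1) *: (t ^+ e (od k.+1) *: ev k.+1).
  by rewrite ev_g -scalemxAr tdiag_ev.
have r : actg (M J) *m (tdiag e *m ev k.+1) =
    t ^+ e (od k.+1) *: (fps_const (zeta ^+ k.+1) *: ev k.+1).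
  rewrite tdiag_ev -scalemxAr ev_g; exact: erefl.
apply: etrans (esym (mulmxA _ _ _)) (etrans l _); apply: etrans (mulmxA _ _ _).
rewrite r !scalerA mulrC; exact: erefl.
Qed.

Section CrossExt.
Variables (I J K K' : twoset n) (P Q : 'I_n -> bool).
Hypothesis PQ : forall i, ~~ (P i && Q i).
Hypothesis hK : forall k,
  (at_pos K k.+1 + P (od k) = at_pos I k.+1 + P (od k.+1))%N.
Hypothesis hK' : forall k,
  (at_pos K' k.+1 + Q (od k) = at_pos I k.+1 + Q (od k.+1))%N.
Hypothesis hJ : forall k, (at_pos J k.+1 + (P (od k) + Q (od k)) =
  at_pos I k.+1 + (P (od k.+1) + Q (od k.+1)))%N.

Local Notation L := (dsum (M K) (M K')).
Local Notation o1 := (dsum_out1 (M K) (M K')).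
Local Notation o2 := (dsum_out2 (M K) (M K')).

Let dP : 'M[Z]_n := tdiag P.
Let dQ : 'M[Z]_n := tdiag Q.

Fact dP_out : @is_hom _ _ _ (M K) (M I) dP.
Proof. by apply: tdiag_hom => k; have := hK k; lia. Qed.
Fact dQ_out : @is_hom _ _ _ (M K') (M I) dQ.
Proof. by apply: tdiag_hom => k; have := hK' k; lia. Qed.
Fact dP_in : @is_hom _ _ _ (M J) (M K') dP.
Proof. by apply: tdiag_hom => k; have := hK' k; have := hJ k; lia. Qed.
Fact dQ_in : @is_hom _ _ _ (M J) (M K) dQ.
Proof. by apply: tdiag_hom => k; have := hK k; have := hJ k; lia. Qed.

(** A Koszul-like sequence: [(- t ^ Q, t ^ P)] followed by [(t ^ P, t ^ Q)]. It is exact because at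
    each position one of the two exponents is 0, so that one of the two components is invertible
    there. *)
Definition cross_in : 'M[Z]_(rk L, n) := @dpair _ _ _ (M K) (M K') n (- dQ) dP.
Definition cross_out : 'M[Z]_(n, rk L) := @dcopair _ _ _ (M K) (M K') n dP dQ.

Fact cross_inj (v : 'cV[Z]_n) : cross_in *m v = 0 -> v = 0.
Proof.
rewrite dpair_mul => v0.
have : - dQ *m v = 0.
  by rewrite -(out1_dpair (A := M K) (B := M K') (- dQ *m v) (dP *m v)) v0 mulmx0.
rewrite mulNmx => /eqP; rewrite oppr_eq0 => /eqP/matrixP Qv.
have /matrixP Pv : dP *m v = 0.
  by rewrite -(out2_dpair (A := M K) (B := M K') (- dQ *m v) (dP *m v)) v0 mulmx0.
have {}Pv i : t ^+ P i * v i 0 = 0 by have := Pv i 0; rewrite tdiagE [RHS]mxE.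
have {}Qv i : t ^+ Q i * v i 0 = 0 by have := Qv i 0; rewrite tdiagE [RHS]mxE.
apply/matrixP => i j; rewrite (ord1 j) [RHS]mxE; have := Pv i; have := Qv i.
have := PQ i; case: (P i) => /= [/negPf ->|_ _]; last by rewrite expr0 mul1r.
by rewrite expr0 mul1r.
Qed.

Fact cross_comp : cross_out *m cross_in = 0.
Proof.
rewrite dcopair_dpair mulmxN !tdiagM.
have -> : (fun i => Q i + P i)%N = (fun i => P i + Q i)%N.
  by apply/funext => i; rewrite addnC.
exact: addNr.
Qed.

Fact cross_exact (v : 'cV[Z]_(rk L)) : cross_out *m v = 0 ->
  exists u : 'cV[Z]_n, v = cross_in *m u.
Proof.
rewrite [v]dpair_eta dcopair_dpair; move: (o1 *m v) (o2 *m v) => v1 v2 /matrixP h.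
have {h} v0 i : t ^+ P i * v1 i 0 + t ^+ Q i * v2 i 0 = 0.
  by apply: etrans (esym (tdiag2E _ _ _ _ _ _)) (etrans (h i 0) _); rewrite mxE.
exists (\col_i if P i then - v1 i 0 else v2 i 0).
rewrite dpair_mul; congr dpair; apply/matrixP => i j; rewrite (ord1 j).
- apply/esym; apply: etrans (NtdiagE _ _ _ _) _; rewrite mxE.
  have := v0 i; have := PQ i; case: (P i) => /= [/negPf -> _|_].
    by rewrite expr0 mul1r opprK.
  by rewrite expr0 mul1r => /eqP; rewrite addr_eq0 => /eqP.
- apply/esym; apply: etrans (tdiagE _ _ _ _) _; rewrite mxE.
  have := v0 i; have := PQ i; case: (P i) => /= [/negPf ->|_ _].
    rewrite expr0 expr1 mul1r addrC => /eqP; rewrite addr_eq0 => /eqP ->.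
    by rewrite mulrN.
  by rewrite expr0 mul1r.
Qed.

Fact cross_surj (w : 'cV[Z]_n) : exists v : 'cV[Z]_(rk L), cross_out *m v = w.
Proof.
exists (@dpair _ _ _ (M K) (M K') 1 (\col_i if P i then 0 else w i 0)
  (\col_i if P i then w i 0 else 0)).
rewrite dcopair_dpair; apply/matrixP => i j; rewrite (ord1 j).
apply: etrans (tdiag2E _ _ _ _ _ _) _; rewrite [X in _ * X + _]mxE [X in _ + _ * X]mxE.
have := PQ i; case: (P i) => /= [/negPf ->|_]; first by rewrite mulr0 add0r expr0 mul1r.
by rewrite mulr0 addr0 expr0 mul1r.
Qed.

Fact cross_in_hom : @is_hom _ _ _ (M J) L cross_in.
Proof. exact: dpair_hom (hom_opp dQ_in) dP_in. Qed.

Fact cross_out_hom : @is_hom _ _ _ L (M I) cross_out.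
Proof. exact: dcopair_hom dP_out dQ_out. Qed.

Definition cross_ext : extension (M I) (M J) :=
  @Extension R n zeta (M I) (M J) L cross_in cross_out cross_in_hom cross_out_hom
    cross_inj cross_comp cross_exact cross_surj.

(** A section would write the identity of [M I] as a sum of endomorphisms through [M K] and through
    [M K']. Both are scalars; the first is divisible by [t] at [p], the second at [q], so their sum
    is not 1. *)
Lemma cross_nonsplit p q : P (od p) -> Q (od q) -> ~ ext_split cross_ext.
Proof.
move=> Pp Qq [S [hS]]; change (cross_out *m S = 1%:M -> False).
rewrite dcopair_mul => e.
have hX : @is_hom _ _ _ (M I) (M I) (dP *m (o1 *m S)).
  exact: hom_comp (hom_comp hS (dsum_out1_hom _ _)) dP_out.
have hY : @is_hom _ _ _ (M I) (M I) (dQ *m (o2 *m S)).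
  exact: hom_comp (hom_comp hS (dsum_out2_hom _ _)) dQ_out.
move: (o1 *m S) (o2 *m S) e hX hY => s1 s2 e hX hY.
have a : (dP *m s1) (od 0) (od 0) = t * s1 (od p) (od p).
  by rewrite -(hom_end p hX) tdiagE Pp expr1.
have b : (dQ *m s2) (od 0) (od 0) = t * s2 (od q) (od q).
  by rewrite -(hom_end q hY) tdiagE Qq expr1.
have : (dP *m s1) (od 0) (od 0) + (dQ *m s2) (od 0) (od 0) = 1.
  have /matrixP/(_ (od 0) (od 0)) := e; rewrite [LHS]mxE => ->; rewrite mxE eqxx.
  exact: erefl.
rewrite a b -mulrDr => /(congr1 c0); rewrite rmorphM rmorph1 /= fps_coef0_t mul0r.
by move=> /esym/eqP; rewrite oner_eq0.
Qed.

(** Lifting the two components of [cross_out] to [E'] gives a map of extensions that induces a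
    scalar [th] on [M J]. The class of [cross_ext] is killed by [t], so only the constant term of
    [th] counts. *)
Lemma cross_span : lifts (M K) (M J) -> lifts (M K') (M J) ->
  forall E' : extension (M I) (M J), exists c, ext_scaled c cross_ext E'.
Proof.
move=> lK lK' E'; have [psi1 [h1 e1]] := lK _ E' _ dP_out.
have [psi2 [h2 e2]] := lK' _ E' _ dQ_out.
pose F0 := @dcopair _ _ _ (M K) (M K') _ psi1 psi2.
have hF0 : @is_hom _ _ _ L (ext_mid E') F0 := dcopair_hom h1 h2.
have outF0 : ext_out E' *m F0 = cross_out by rewrite mul_dcopair e1 e2.
have [Th [hTh e]] : exists Th : 'M[Z]_n, @is_hom _ _ _ (M J) (M J) Th /\
    F0 *m cross_in = ext_in E' *m Th.
  apply: (@ext_factor_hom _ _ _ _ _ E' (M J) (F0 *m cross_in)).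
    exact: hom_comp cross_in_hom hF0.
  by rewrite mulmxA outF0 cross_comp.
move: e; rewrite (hom_end_scalar hTh); set th := Th _ _ => e.
have [th' th'E] : exists th', th - fps_const (c0 th) = t * th'.
  by apply: fps_tdiv; rewrite rmorphB /= fps_coef0_const subrr.
(* As [D *m dQ = t], multiplication by [t] on [M J] extends to the middle term; [rho] uses this to
   absorb [t * th']. *)
pose D : 'M[Z]_n := tdiag (fun i => ~~ Q i).
have hD : @is_hom _ _ _ (M K) (M J) D.
  apply: tdiag_hom => k; have := hK k; have := hJ k.
  by case: (Q (od k)); case: (Q (od k.+1)); lia.
have DQ : D *m dQ = t%:M.
  rewrite tdiagM; apply/matrixP => i j; rewrite !mxE.
  by case: eqP => // _; case: (Q i).
pose rho := @dcopair _ _ _ (M K) (M K') n (- th' *: D) 0.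
have hrho : @is_hom _ _ _ L (M J) rho.
  apply: dcopair_hom (hom_scale _ hD) _; exact: hom0.
have rho_in : rho *m cross_in = (t * th')%:M.
  rewrite dcopair_dpair mul0mx addr0 mulmxN -scalemxAl DQ scaleNr opprK.
  by rewrite scale_scalar_mx mulrC.
exists (c0 th); exists (F0 - ext_in E' *m rho); split.
- apply: hom_add hF0 (hom_opp _); exact: hom_comp hrho (ext_in_hom E').
- rewrite [LHS]mulmxBl -[ext_in E' *m rho *m _]mulmxA.
  change (F0 *m cross_in - ext_in E' *m (rho *m cross_in) =
     fps_const (c0 th) *: ext_in E').
  have eS (a b : Z) : a%:M - b%:M = (a - b)%:M :> 'M[Z]_n by rewrite raddfB.
  rewrite e rho_in -mulmxBr -th'E eS subKr; exact: mul_mx_scalar.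
- rewrite [LHS]mulmxBr outF0 (mulmxA (ext_out E')) ext_comp mul0mx subr0.
  exact: erefl.
Qed.

End CrossExt.

(** * Vanishing of extensions passes to direct summands *)

Section Transport.
Implicit Types A N B : obj.

Lemma dpair_eq0 A B m (X : 'M[Z]_(rk A, m)) (Y : 'M[Z]_(rk B, m)) :
  dpair X Y = 0 -> X = 0 /\ Y = 0.
Proof.
move=> XY; rewrite -(out1_dpair X Y) -{2}(out2_dpair X Y) XY !mulmx0; split; exact: erefl.
Qed.

(** Adding the identity of [A2] to [E] gives an extension of [A]. A section of it, restricted to
    [A1] and projected to the middle term of [E], splits [E]. *)
Lemma Ext1_summand_l A A1 A2 N : iso A (dsum A1 A2) -> Ext1_zero A N -> Ext1_zero A1 N.
Proof.
case=> F [G [hF hG GF FG]] h E.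
pose f := ext_in E; pose g := ext_out E; pose L := ext_mid E.
pose o1 := dsum_out1 L A2; pose o2 := dsum_out2 L A2.
pose H := dpair (g *m o1) o2.
have hH : @is_hom _ _ _ (dsum L A2) (dsum A1 A2) H.
  apply: dpair_hom; last exact: dsum_out2_hom.
  exact: hom_comp (dsum_out1_hom _ _) (ext_out_hom E).
have HE m (v : 'M[Z]_(rk (dsum L A2), m)) : H *m v = dpair (g *m (o1 *m v)) (o2 *m v).
  rewrite dpair_mul mulmxA; exact: erefl.
have hin : @is_hom _ _ _ N (dsum L A2) (dpair f 0).
  apply: dpair_hom (ext_in_hom E) _; exact: hom0.
have inE m (u : 'M[Z]_(rk N, m)) : @dpair _ _ _ L A2 _ f 0 *m u = dpair (f *m u) 0.
  rewrite dpair_mul mul0mx; exact: erefl.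
have inj (v : 'cV[Z]_(rk N)) : @dpair _ _ _ L A2 _ f 0 *m v = 0 -> v = 0.
  by rewrite inE => /dpair_eq0[/ext_inj].
have comp : G *m H *m @dpair _ _ _ L A2 _ f 0 = 0.
  rewrite -[LHS]mulmxA HE out1_dpair out2_dpair ext_comp dpair0; exact: mulmx0.
have FGH m (v : 'M[Z]_(rk (dsum L A2), m)) : F *m (G *m H *m v) = H *m v.
  rewrite -[G *m H *m v]mulmxA [LHS]mulmxA FG mul1mx; exact: erefl.
have exct (v : 'cV[Z]_(rk (dsum L A2))) : G *m H *m v = 0 ->
    exists u : 'cV[Z]_(rk N), v = @dpair _ _ _ L A2 _ f 0 *m u.
  move=> v0; have := FGH _ v; rewrite v0 mulmx0 HE => /esym/dpair_eq0[/ext_exact[u uE] v2].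
  by exists u; rewrite inE -uE -v2; apply: dpair_eta.
have surj (w : 'cV[Z]_(rk A)) : exists v : 'cV[Z]_(rk (dsum L A2)), G *m H *m v = w.
  have [v1 v1E] := ext_surj E (dsum_out1 A1 A2 *m (F *m w)).
  exists (dpair v1 (dsum_out2 A1 A2 *m (F *m w))).
  rewrite -[LHS]mulmxA HE out1_dpair out2_dpair v1E -dpair_eta mulmxA GF.
  exact: mul1mx.
have [S [hS e]] := h (@Extension _ _ _ A N (dsum L A2) (dpair f 0) (G *m H) hin
  (hom_comp hH hG) inj comp exct surj).
have {}e : G *m H *m S = 1%:M := e.
exists (o1 *m S *m (G *m dsum_in1 A1 A2)); split.
  apply: hom_comp (hom_comp hS (dsum_out1_hom _ _)).
  exact: hom_comp (dsum_in1_hom _ _) hG.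
have gS : g *m (o1 *m S) = dsum_out1 A1 A2 *m F.
  have := FGH _ S; rewrite e mulmx1 HE => ->; rewrite out1_dpair; exact: erefl.
rewrite [LHS]mulmxA gS -[LHS]mulmxA (mulmxA F) FG mul1mx; exact: dsum_out1_in1.
Qed.

(** Here [N2] is added to the submodule and to the middle term of [E]. *)
Lemma Ext1_summand_r A N N1 N2 : iso N (dsum N1 N2) -> Ext1_zero A N -> Ext1_zero A N1.
Proof.
case=> F [G [hF hG GF FG]] h E.
pose f := ext_in E; pose g := ext_out E; pose L := ext_mid E.
pose o1 := dsum_out1 L N2; pose o2 := dsum_out2 L N2.
pose q1 := dsum_out1 N1 N2; pose q2 := dsum_out2 N1 N2.
pose H : 'M[Z]_(rk (dsum L N2), rk (dsum N1 N2)) := dpair (f *m q1) q2.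
have hH : @is_hom _ _ _ (dsum N1 N2) (dsum L N2) H.
  apply: dpair_hom; last exact: dsum_out2_hom.
  exact: hom_comp (dsum_out1_hom _ _) (ext_in_hom E).
have HE m (v : 'M[Z]_(rk (dsum N1 N2), m)) : H *m v = dpair (f *m (q1 *m v)) (q2 *m v).
  rewrite dpair_mul mulmxA; exact: erefl.
have inj (v : 'cV[Z]_(rk N)) : H *m F *m v = 0 -> v = 0.
  rewrite -mulmxA HE => /dpair_eq0[/ext_inj v1 v2].
  have := dpair_eta (F *m v); rewrite -/q1 -/q2 v1 v2 dpair0 => /(congr1 (mulmx G)).
  rewrite mulmxA GF mul1mx mulmx0; exact: id.
have comp : g *m o1 *m (H *m F) = 0.
  have o1H : o1 *m H = f *m q1 := out1_dpair _ _.
  rewrite [LHS]mulmxA -(mulmxA g) o1H (mulmxA g) ext_comp !mul0mx; exact: erefl.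
have exct (v : 'cV[Z]_(rk (dsum L N2))) : g *m o1 *m v = 0 ->
    exists u : 'cV[Z]_(rk N), v = H *m F *m u.
  rewrite -mulmxA => /ext_exact[u uE]; exists (G *m dpair u (o2 *m v)).
  rewrite -[RHS]mulmxA (mulmxA F) FG mul1mx HE out1_dpair out2_dpair.
  by rewrite -uE; apply: dpair_eta.
have surj (w : 'cV[Z]_(rk A)) : exists v : 'cV[Z]_(rk (dsum L N2)), g *m o1 *m v = w.
  have [v1 v1E] := ext_surj E w; exists (dpair v1 0).
  rewrite -[LHS]mulmxA out1_dpair; exact: v1E.
have [S [hS e]] := h (@Extension _ _ _ A N (dsum L N2) (H *m F) (g *m o1)
  (hom_comp hF hH) (hom_comp (dsum_out1_hom _ _) (ext_out_hom E)) inj comp exct surj).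
exists (o1 *m S); split; first exact: hom_comp hS (dsum_out1_hom _ _).
rewrite mulmxA; exact: e.
Qed.

End Transport.

End Crossing.

(** * Triangulations *)

Import Order.TTheory Num.Theory.

Section Triangulations.
Variable n : nat.
Implicit Types (s : rel nat) (p q r i j k l : nat).

Definition crosses i j k l : bool :=
  [&& i < k, k < j & j < l]%N || [&& k < i, i < l & l < j]%N.

(* Identifying {i, j} with the chord from i to j of an n-gon, the maximal sets of
   pairwise noncrossing chords (sides included) are the triangulations. *)
Definition triangulation s : Prop := forall i j, (i < j < n)%N ->
  s i j <-> forall k l, (k < l < n)%N -> s k l -> ~~ crosses i j k l.

Lemma tri_nocross s i j k l : triangulation s -> (i < j < n)%N -> (k < l < n)%N ->
  s i j -> s k l -> ~~ crosses i j k l.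
Proof. by move=> hs ij kl sij skl; apply: ((hs i j ij).1 sij). Qed.

Lemma tri_side s i : triangulation s -> (i.+1 < n)%N -> s i i.+1.
Proof. by move=> hs i1; apply/hs; rewrite ?ltnSn ?i1 // /crosses => k l kl _; lia. Qed.

Lemma tri_top s : triangulation s -> (1 < n)%N -> s 0%N n.-1.
Proof. by move=> hs n1; apply/hs; rewrite /crosses; [lia|move=> k l kl _; lia]. Qed.

(** The apex is the last [r] before [q] joined to [p]. A chord of [s] crossing [{r, q}] but neither
    [{p, q}] nor [{p, r}] would join [p] to a later point. *)
Lemma tri_split s p q : triangulation s -> (p.+1 < q < n)%N -> s p q ->
  exists2 r, (p < r < q)%N & s p r && s r q.
Proof.
move=> hs pq spq.
pose P r := (p < r < q)%N && s p r.
have exP : exists r, P r by exists p.+1; rewrite /P tri_side //; lia.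
have leP r : P r -> (r <= q)%N by case/andP; lia.
have [r /andP[pr spr] rmax] := ex_maxnP exP leP; exists r => //; rewrite spr /=.
apply/hs; first lia.
move=> k l kl skl; apply/negP => rqkl.
have h1 : ~~ crosses p q k l by apply: tri_nocross hs _ _ spq skl; lia.
have h2 : ~~ crosses p r k l by apply: tri_nocross hs _ _ spr skl; lia.
have [kp lr] : k = p /\ (r < l < q)%N by move: rqkl h1 h2; rewrite /crosses; lia.
rewrite kp in skl; have := rmax l; rewrite /P skl; lia.
Qed.

(** Every chord is reached by exchanging the diagonals of quadrilaterals that have one diagonal in
    [s]. Below a chord [{p, q}] of [s] with apex [r], a chord from [i < r] to [j > r] takes two
    exchanges: across [{p, r}] to reach [{i, q}], then across [{r, q}]. *)
Lemma tri_ind s (Phi : nat -> nat -> Prop) : triangulation s ->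
  (forall i j, (i < j < n)%N -> s i j -> Phi i j) ->
  (forall a b c d, (a < b < c)%N -> (c < d < n)%N -> s a c ->
     Phi a b -> Phi b c -> Phi c d -> Phi a d -> Phi a c -> Phi b d) ->
  (forall a b c d, (a < b < c)%N -> (c < d < n)%N -> s b d ->
     Phi a b -> Phi b c -> Phi c d -> Phi a d -> Phi b d -> Phi a c) ->
  forall i j, (i < j < n)%N -> Phi i j.
Proof.
move=> hs base flip1 flip2.
suff h L p q : (q - p <= L)%N -> (p < q < n)%N -> s p q ->
    forall i j, (p <= i)%N -> (i < j <= q)%N -> Phi i j.
  move=> i j ij; apply: (h n 0%N n.-1); rewrite ?tri_top //; lia.
elim: L p q => [|L IH] p q qpL pq spq i j pi ij; first lia.
have [qp|pq'] := eqVneq q p.+1.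
  have [-> ->] : i = p /\ j = q by lia.
  exact: base.
have [|r pr /andP[spr srq]] := tri_split hs _ spq; first lia.
have IH1 := IH p r; have IH2 := IH r q.
have [jr|rj] := leqP j r; first by apply: IH1 => //; lia.
have [ri|ir] := leqP r i; first by apply: IH2 => //; lia.
have Phi_iq : Phi i q.
  have [->|ip] := eqVneq i p; first exact: base.
  apply: (flip1 p i r q); rewrite ?spr //; try lia.
  - by apply: IH1 => //; lia.
  - by apply: IH1 => //; lia.
  - by apply: base => //; lia.
  - exact: base.
  - by apply: base => //; lia.
have [->|jq] := eqVneq j q; first exact: Phi_iq.
apply: (flip2 i r j q); rewrite ?srq //; try lia.
- by apply: IH1 => //; lia.
- by apply: IH2 => //; lia.
- by apply: IH2 => //; lia.
- by apply: base => //; lia.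
Qed.

End Triangulations.

(** * Integer vectors attached to a triangulation *)

Section Det.

Definition det2 (v w : int * int) : int := v.1 * w.2 - v.2 * w.1.

Lemma plucker (a b c d : int * int) :
  det2 a c * det2 b d = det2 a b * det2 c d + det2 a d * det2 b c.
Proof. by rewrite /det2; ring. Qed.

Lemma det2_self v : det2 v v = 0. Proof. by rewrite /det2; ring. Qed.

(* The vectors are found from the top chord downwards: the apex of the triangle
   below the chord from p to q receives the sum of the vectors at p and q, as for
   Farey mediants. *)
Lemma tri_vectors n (s : rel nat) : triangulation n s -> (1 < n)%N ->
  exists v : nat -> int * int, forall i j, (i < j < n)%N ->
    0 < det2 (v i) (v j) /\ (det2 (v i) (v j) = 1 <-> s i j).
Proof.
move=> hs n1.
suff h L p q a b : (q - p <= L)%N -> (p < q < n)%N -> s p q -> det2 a b = 1 ->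
    exists v : nat -> int * int, [/\ v p = a, v q = b &
      forall i j, (p <= i)%N -> (i < j <= q)%N ->
        0 < det2 (v i) (v j) /\ (s i j -> det2 (v i) (v j) = 1)].
  have [|||//|v [_ _ vP]] := h n 0%N n.-1 (1, 0) (0, 1); first lia; first lia.
    exact: tri_top.
  have pos i j : (i < j < n)%N -> 0 < det2 (v i) (v j).
    by move=> ij; have [||//] := vP i j; lia.
  have one i j : (i < j < n)%N -> s i j -> det2 (v i) (v j) = 1.
    by move=> ij; have [||_ //] := vP i j; lia.
  have big (x y : int) : 0 < x -> 0 < y -> x + y = 1 -> False by move=> ? ? ?; lia.
  exists v => i j ij; split; first exact: pos.
  split; last exact: one.
  (* A chord of [s] crossing [{i, j}] would make 1 a sum of two positive products, by the Plücker
     relation. *)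
  move=> vij1; apply/hs => // k l kl skl; have vkl := one k l kl skl.
  apply/negP => /orP[h1|h1].
    have := plucker (v i) (v k) (v j) (v l); rewrite vij1 vkl // mulr1 => /esym.
    by apply: big; apply: mulr_gt0; apply: pos; lia.
  have := plucker (v k) (v i) (v l) (v j); rewrite vij1 vkl // mulr1 => /esym.
  by apply: big; apply: mulr_gt0; apply: pos; lia.
elim: L p q a b => [|L IH] p q a b qpL pq spq ab; first lia.
have [qp|pq'] := eqVneq q p.+1.
  exists (fun k => if k == p then a else b); rewrite eqxx; split=> //.
    by rewrite ifF //; apply/eqP; lia.
  move=> i j pi ij; have [-> ->] : i = p /\ j = q by lia.
  by rewrite eqxx ifF ?ab //; apply/eqP; lia.
have [|r pr /andP[spr srq]] := tri_split hs _ spq; first lia.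
pose c := (a.1 + b.1, a.2 + b.2).
have ac : det2 a c = 1 by rewrite -ab /det2 /=; ring.
have cb : det2 c b = 1 by rewrite -ab /det2 /=; ring.
have [|||//|v [vp vr vP]] := IH p r a c; [lia|lia|done|].
have [|||//|w [wr wq wP]] := IH r q c b; [lia|lia|done|].
exists (fun k => if (k <= r)%N then v k else w k); split.
- by rewrite ifT //; lia.
- by rewrite ifF //; lia.
move=> i j pi ij; have [jr|rj] := leqP j r.
  by rewrite ifT; [apply: vP; lia|lia].
case: (leqP i r) => [ir|ri]; last by apply: wP; lia.
have [ei|ir'] := eqVneq i r.
  by rewrite ei vr -wr; apply: wP; lia.
have vpos k l : (p <= k)%N -> (k < l <= r)%N -> 0 < det2 (v k) (v l).
  by move=> pk kl; have [] := vP k l pk kl.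
have wpos k l : (r <= k)%N -> (k < l <= q)%N -> 0 < det2 (w k) (w l).
  by move=> pk kl; have [] := wP k l pk kl.
have ir0 : 0 < det2 (v i) c by rewrite -vr; apply: vpos; lia.
(* For indices on different sides of the apex, the Plücker relation with unimodular pairs among [a],
   [b], [c] gives a sum of positive terms: here for [i] and [q], at the end for [i] and [j]. *)
have iq0 : 0 < det2 (v i) b.
  have [->|ip] := eqVneq i p; first by rewrite vp ab.
  have := plucker a (v i) c b; rewrite ac cb ab !mulr1 !mul1r => ->.
  by apply: addr_gt0 ir0; rewrite -vp; apply: vpos; lia.
have sij : s i j -> i = p /\ j = q.
  move=> sij; have := tri_nocross hs _ _ spr sij; have := tri_nocross hs _ _ srq sij.
  rewrite /crosses; lia.
split; last by move=> /sij[-> ->]; rewrite vp wq.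
have [->|jq] := eqVneq j q; first by rewrite wq.
have := plucker (v i) c (w j) b; rewrite cb mulr1 => ->.
apply: addr_gt0; apply: mulr_gt0 => //.
  by rewrite -wq; apply: wpos; lia.
by rewrite -wr; apply: wpos; lia.
Qed.

End Det.

(** * Friezes *)

Section Friezes.
Variables (n : nat) (m : int -> int -> int).
Hypotheses (n4 : (4 <= n)%N) (hm : CC_frieze (n - 3) m).
Implicit Types i j k l : int.

Lemma frieze0 i : m i i = 0.
Proof. by have [h _ _ _] := hm; case: (h i). Qed.

Lemma frieze0n i : m i (i + n%:Z) = 0.
Proof. by have [h _ _ _] := hm; have [_ <-] := h i; congr (m _ _); lia. Qed.

Lemma frieze1 i j : j = i + 1 -> m i j = 1.
Proof. by move=> ->; have [_ h _ _] := hm; case: (h i). Qed.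

Lemma frieze1n i j : j + 1 = i + n%:Z -> m i j = 1.
Proof. by move=> e; have [_ h _ _] := hm; have [_ <-] := h i; congr (m _ _); lia. Qed.

Lemma frieze_gt0 i j : i < j < i + n%:Z -> 0 < m i j.
Proof.
move=> ij; have [e|e] := eqVneq j (i + 1); first by rewrite (frieze1 e).
have [e'|e'] := eqVneq (j + 1) (i + n%:Z); first by rewrite (frieze1n e').
by have [_ _ h _] := hm; apply: h; lia.
Qed.

Lemma frieze_rule i j : i < j < i + n%:Z ->
  m i j * m (i + 1) (j + 1) - m (i + 1) j * m i (j + 1) = 1.
Proof. by move=> ij; have [_ _ _ h] := hm; apply: h; lia. Qed.

(** The quiddity sequence of the frieze, its first nontrivial row. *)
Definition quid (j : int) : int := m (j - 1) (j + 1).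

(** Induction on [j - i]: the frieze rules at [(i, j)] and [(i, j - 1)], combined with the
    recurrence for [i + 1], give the claim times the positive entry [m (i + 1) j]. *)
Lemma frieze_rec_r i j : i < j < i + n%:Z ->
  m i (j + 1) = quid j * m i j - m i (j - 1).
Proof.
move=> ij; have [d dE] : exists d : nat, i = j - 1 - d%:Z.
  by exists (absz (j - 1 - i)%R); lia.
elim: d i ij dE => [|d IHd] i ij dE.
  have -> : i = j - 1 by lia.
  by rewrite frieze0 (@frieze1 (j - 1) j) ?/quid ?mulr1 ?subr0 //; lia.
have := IHd (i + 1); have r1 := frieze_rule ij.
have := @frieze_rule i (j - 1); rewrite subrK => r2.
have p1 : 0 < m (i + 1) j by apply: frieze_gt0; lia.
move=> h; have {}h := h ltac:(lia) ltac:(lia); have {}r2 := r2 ltac:(lia).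
apply: (@mulfI _ (m (i + 1) j)); first by rewrite gt_eqF.
by rewrite h in r1; lia.
Qed.

Lemma frieze_rec_l i j : i < j < i + n%:Z ->
  m (i - 1) j = quid i * m i j - m (i + 1) j.
Proof.
move=> ij; have [d dE] : exists d : nat, j = i + 1 + d%:Z.
  by exists (absz (j - i - 1)%R); lia.
elim: d j ij dE => [|d IHd] j ij dE.
  have -> : j = i + 1 by lia.
  by rewrite frieze0 (@frieze1 i (i + 1)) ?/quid ?mulr1 ?subr0 //; lia.
have := IHd (j - 1); have := @frieze_rule i (j - 1); rewrite subrK => r1.
have := @frieze_rule (i - 1) (j - 1); rewrite !subrK => r2.
have p1 : 0 < m i (j - 1) by apply: frieze_gt0; lia.
move=> h; have {}h := h ltac:(lia) ltac:(lia).
have {}r1 := r1 ltac:(lia); have {}r2 := r2 ltac:(lia).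
apply: (@mulfI _ (m i (j - 1))); first by rewrite gt_eqF.
by rewrite h in r2; lia.
Qed.

(** A solution of a second order recurrence is fixed by its first two values. The second is asked
    for only when [0 < b], since otherwise it lies outside the frieze. *)
Lemma two_step (f g a : nat -> int) b : f 0%N = g 0%N -> ((0 < b)%N -> f 1%N = g 1%N) ->
  (forall d, (d.+1 < b)%N -> f d.+2 = a d * f d.+1 - f d) ->
  (forall d, (d.+1 < b)%N -> g d.+2 = a d * g d.+1 - g d) ->
  forall d, (d <= b)%N -> f d = g d.
Proof.
move=> e0 e1 hf hg d db.
suff [] : f d = g d /\ ((d < b)%N -> f d.+1 = g d.+1) by [].
elim: d db => [|d IHd] db; first by split.
have [e e'] := IHd (ltnW db); split; first exact: e'.
by move=> db'; rewrite hf // hg // e e' // ltnW.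
Qed.

(** Glide symmetry: as functions of [j] both sides start with 0, 1 and satisfy the recurrence with
    the same quiddity coefficients, the left one by [frieze_rec_l], the right one by
    [frieze_rec_r]. *)
Lemma frieze_glide i j : i <= j <= i + n%:Z -> m j (i + n%:Z) = m i j.
Proof.
move=> ij; have [d dE] : exists d : nat, j = i + d%:Z by exists (absz (j - i)%R); lia.
rewrite dE; have dn : (d <= n)%N by lia.
apply: (@two_step (fun d => m (i + d%:Z) (i + n%:Z)) (fun d => m i (i + d%:Z))
  (fun d => quid (i + d%:Z + 1)) n) => //.
- by rewrite addr0 frieze0 frieze0n.
- by move=> _; rewrite (frieze1 (i := i)) // frieze1n //; lia.
- move=> e en; have := @frieze_rec_l (i + e%:Z + 1) (i + n%:Z).
  rewrite addrK.
  have -> : i + e%:Z + 1 + 1 = i + e.+2%:Z by lia.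
  have -> : i + e%:Z + 1 = i + e.+1%:Z by lia.
  by move=> -> //; [ring|lia].
- move=> e en; have := @frieze_rec_r i (i + e%:Z + 1).
  rewrite addrK.
  have -> : i + e%:Z + 1 + 1 = i + e.+2%:Z by lia.
  have -> : i + e%:Z + 1 = i + e.+1%:Z by lia.
  by apply; lia.
Qed.

Lemma frieze_period u i j : i <= j <= i + n%:Z ->
  m (i + u * n%:Z) (j + u * n%:Z) = m i j.
Proof.
have step k l : k <= l <= k + n%:Z -> m (k + n%:Z) (l + n%:Z) = m k l.
  by move=> kl; rewrite !frieze_glide //; lia.
move=> ij; elim/int_ind: u => [|u IH|u IH]; first by rewrite mul0r !addr0.
  rewrite -IH -[in RHS]step; last by lia.
  by congr (m _ _); lia.
rewrite -IH -[in LHS]step; last by lia.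
by congr (m _ _); lia.
Qed.

(** As functions of [l] both sides satisfy the recurrence of [frieze_rec_r]; they start with 0 at
    [l = k] and, by the frieze rule, with 1 at [l = k + 1]. *)
Lemma frieze_det i k l : i + 1 <= k <= l -> l <= i + n%:Z ->
  m i k * m (i + 1) l - m i l * m (i + 1) k = m k l.
Proof.
move=> ik ln; have [d dE] : exists d : nat, l = k + d%:Z by exists (absz (l - k)%R); lia.
have [b bE] : exists b : nat, i + n%:Z = k + b%:Z by exists (absz (i + n%:Z - k)%R); lia.
rewrite dE; have db : (d <= b)%N by lia.
apply: (@two_step
  (fun d => m i k * m (i + 1) (k + d%:Z) - m i (k + d%:Z) * m (i + 1) k)
  (fun d => m k (k + d%:Z)) (fun d => quid (k + d%:Z + 1)) b) => //.
- by rewrite addr0 frieze0; ring.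
- by move=> b0; rewrite (frieze1 (i := k)) // [X in _ - X]mulrC;
    apply: frieze_rule; lia.
- move=> e en; have := @frieze_rec_r (i + 1) (k + e%:Z + 1).
  have := @frieze_rec_r i (k + e%:Z + 1); rewrite addrK.
  have -> : k + e%:Z + 1 + 1 = k + e.+2%:Z by lia.
  have -> : k + e%:Z + 1 = k + e.+1%:Z by lia.
  move=> -> //; last lia.
  by move=> -> //; [ring|lia].
- move=> e en; have := @frieze_rec_r k (k + e%:Z + 1).
  rewrite addrK.
  have -> : k + e%:Z + 1 + 1 = k + e.+2%:Z by lia.
  have -> : k + e%:Z + 1 = k + e.+1%:Z by lia.
  by apply; lia.
Qed.

(** Two adjacent diagonals of the array, read as vectors. For [k = 0] the entry [m 1 0] lies outside
    the array, and [-1] is its antiperiodic continuation. *)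
Definition frieze_vec (k : nat) : int * int :=
  if k is 0%N then (0, -1) else (m 0 k%:Z, m 1 k%:Z).

Lemma frieze_vecE (a b : nat) : (a <= b <= n)%N ->
  m a%:Z b%:Z = det2 (frieze_vec a) (frieze_vec b).
Proof.
move=> ab; have [b0|b0] := posnP b.
  have -> : a = 0%N by lia.
  by rewrite b0 frieze0 det2_self.
case: a ab => [|a] ab.
  by case: b b0 ab => // b _ _; rewrite /det2 /frieze_vec /=; ring.
have := @frieze_det 0 a.+1%:Z b%:Z; rewrite add0r => <-; [|lia|lia].
by case: b b0 ab => // b _ _; rewrite /det2 /frieze_vec /=; ring.
Qed.

Lemma frieze_ptolemy (a b c d : nat) : (a < b < c)%N -> (c < d < n)%N ->
  m a%:Z c%:Z * m b%:Z d%:Z = m a%:Z b%:Z * m c%:Z d%:Z + m a%:Z d%:Z * m b%:Z c%:Z.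
Proof. by move=> abc cd; rewrite !frieze_vecE; [exact: plucker|lia..]. Qed.

Definition ones : rel nat := fun a b => m a%:Z b%:Z == 1.

Lemma frieze_pos (a b : nat) : (a < b < n)%N -> 0 < m a%:Z b%:Z.
Proof. by move=> ab; apply: frieze_gt0; lia. Qed.

(* In the basis v_p, v_q, the vectors v_k of the chords between p and q have
   positive coordinates, and the first v_k lying past the diagonal is v_p + v_q. *)
Lemma ones_split (p q : nat) : (p.+1 < q < n)%N -> ones p q ->
  exists2 r, (p < r < q)%N & ones p r && ones r q.
Proof.
move=> pq /eqP mpq; pose al (k : nat) := m k%:Z q%:Z; pose be (k : nat) := m p%:Z k%:Z.
pose P (k : nat) := (p <= k)%N && (al k <= be k).
have Pq : P q by rewrite /P /al /be frieze0 mpq; lia.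
have exP : exists k : nat, P k by exists q.
have [r /andP[pr abr] rmin] := ex_minnP exP.
have rq : (r <= q)%N by apply: rmin.
have pr' : (p < r)%N.
  rewrite ltn_neqAle pr andbT; apply/eqP => e; move: abr.
  by rewrite /al /be -e frieze0 mpq.
have ab' : be r.-1 < al r.-1.
  rewrite ltNge; apply/negP => h; have := rmin r.-1; rewrite /P h; lia.
(* [al k] and [be k] are the coordinates of [v_k] in the basis [v_p, v_q], and neighbouring vectors
   have determinant 1. *)
have adj : al r.-1 * be r - be r.-1 * al r = 1.
  have : m r.-1%:Z r%:Z = 1 by apply: frieze1; lia.
  rewrite /al /be !frieze_vecE; try lia.
  have := mpq; rewrite frieze_vecE; last by lia.
  move: (frieze_vec p) (frieze_vec q) (frieze_vec r) (frieze_vec r.-1) => vp vq vr vs.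
  move=> e1 e2; have := plucker vp vs vr vq; rewrite e1 e2; lia.
have be0 : 0 <= be r.-1.
  rewrite /be; have [->|h] := eqVneq r.-1 p; first by rewrite frieze0.
  by apply/ltW/frieze_pos; lia.
have br0 : 0 < be r by apply: frieze_pos; lia.
have ar0 : 0 <= al r.
  rewrite /al; have [->|h] := eqVneq r q; first by rewrite frieze0.
  by apply/ltW/frieze_pos; lia.
(* With [b = be r.-1], the bounds [al r.-1 >= b + 1] and [al r <= be r] turn [adj] into
   [be r + b * (be r - al r) <= 1]. *)
have be1 : be r = 1 by nia.
have [rq'|rq'] := eqVneq r q.
  have al0 : al r = 0 by rewrite /al rq' frieze0.
  have b0 : be r.-1 = 0 by nia.
  have : r.-1 = p.
    apply/eqP; apply: contraTT isT => h; have := @frieze_pos p r.-1.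
    by rewrite -/(be r.-1) b0; lia.
  lia.
have al1 : al r = 1.
  have : 0 < al r by apply: frieze_pos; lia.
  lia.
by exists r; [lia|rewrite /ones -/(be r) -/(al r) be1 al1].
Qed.

(** Crossing entries 1 would make 1 a sum of two positive products. For maximality one descends from
    the top chord through the triangles of [ones_split]: a chord straddling the apex [r] crosses
    [{p, r}] or [{r, q}] unless it is [{p, q}] itself. *)
Lemma ones_triangulation : triangulation n ones.
Proof.
have noc (i j k l : nat) : (i < j < n)%N -> (k < l < n)%N -> ones i j -> ones k l ->
    [&& i < k, k < j & j < l]%N -> False.
  move=> ij kl /eqP mij /eqP mkl h.
  have := @frieze_ptolemy i k j l; rewrite mij mkl => e.
  have {}e := e ltac:(lia) ltac:(lia).
  have p1 := @frieze_pos i k ltac:(lia); have p2 := @frieze_pos j l ltac:(lia).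
  have p3 := @frieze_pos i l ltac:(lia); have p4 := @frieze_pos k j ltac:(lia).
  by have := mulr_gt0 p1 p2; have := mulr_gt0 p3 p4; lia.
move=> i j ij; split=> [oij k l kl okl|h].
  by apply/negP => /orP[c|c]; [apply: noc oij okl c; lia|apply: noc okl oij c; lia].
suff H (L p q : nat) : (q - p <= L)%N -> (p < q < n)%N -> ones p q ->
    (p <= i)%N -> (j <= q)%N -> ones i j.
  apply: (H n 0%N n.-1); try lia.
  by apply/eqP/frieze1n; lia.
elim: L p q => [|L IH] p q qpL pq opq pi jq; first lia.
have [/andP[/eqP-> /eqP->]//|ne] := boolP ((i == p) && (j == q)).
have [|r pr /andP[opr orq]] := ones_split _ opq; first lia.
have [jr|rj] := leqP j r; first by apply: (IH p r) => //; lia.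
have [ri|ir] := leqP r i; first by apply: (IH r q) => //; lia.
have [ip|ip] := eqVneq i p.
  by have := h r q; rewrite orq /crosses; lia.
by have := h p r; rewrite opr /crosses; lia.
Qed.

End Friezes.

(** * Friezes and triangulations determine each other *)

Section Correspondence.
Variable n : nat.
Hypothesis n4 : (4 <= n)%N.
Implicit Types (m : int -> int -> int) (i j u : int).

(** Period and glide symmetry move every position into the triangle [0 <= a <= b < n]. The pair does
    not depend on [m], so that two friezes, or a frieze and the modules, can be compared there. *)
Lemma frieze_normal i j : i <= j <= i + n%:Z ->
  exists a b : nat, [/\ (a <= b < n)%N,
    forall m, CC_frieze (n - 3) m -> m i j = m a%:Z b%:Z &
    (a%:Z = i %[mod n%:Z])%Z /\ (b%:Z = j %[mod n%:Z])%Z \/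
    (b%:Z = i %[mod n%:Z])%Z /\ (a%:Z = j %[mod n%:Z])%Z].
Proof.
move=> ij; pose u := (i %/ n%:Z)%Z.
have n0 : n%:Z != 0 by lia.
have := divz_eq i n%:Z; have := ltz_mod i n0; have := modz_ge0 i n0.
rewrite -/u; set a := (i %% n%:Z)%Z => a0 an iE.
have modE (x y v : int) : x = y + v * n%:Z -> (y = x %[mod n%:Z])%Z.
  by move=> ->; rewrite addrC modzMDl.
have aE : a = (absz a)%:Z by lia.
have e m : CC_frieze (n - 3) m -> m i j = m a (j - u * n%:Z).
  move=> hm; rewrite -(frieze_period n4 hm u (i := a) (j := j - u * n%:Z)); last by lia.
  by congr (m _ _); lia.
have [jn|jn] := ltP (j - u * n%:Z) n%:Z.
  exists (absz a), (absz (j - u * n%:Z)%R); split; first lia.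
    by move=> m /e ->; congr (m _ _); lia.
  by left; split; apply: (modE _ _ u); lia.
exists (absz (j - u * n%:Z - n%:Z)%R), (absz a); split; first lia.
  move=> m hm; rewrite (e m hm) -(frieze_glide n4 hm (j := (absz a)%:Z)); last lia.
  by congr (m _ _); lia.
by right; split; [apply: (modE _ _ u)|apply: (modE _ _ (u + 1))]; lia.
Qed.

(** Along [tri_ind] each new entry is given by the Ptolemy relation whose other diagonal is 1 in
    both friezes. *)
Lemma ones_inj m m' : CC_frieze (n - 3) m -> CC_frieze (n - 3) m' ->
  (forall a b : nat, (a < b < n)%N -> ones m a b = ones m' a b) ->
  same_frieze (n - 3) m m'.
Proof.
move=> hm hm' mm' i j ij; have [|a [b [ab e _]]] := @frieze_normal i j; first lia.
rewrite !e //; have [->|nab] := eqVneq a b; first by rewrite (frieze0 hm) (frieze0 hm').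
apply: (tri_ind (Phi := fun a b : nat => m a%:Z b%:Z = m' a%:Z b%:Z)
  (ones_triangulation n4 hm)); last lia.
- move=> {ab nab e} {}a {}b ab oab; have := mm' a b ab; rewrite oab => /esym/eqP ->.
  exact/eqP.
- move=> {ab nab e} {}a {}b c d abc cd oac e1 e2 e3 e4 e5.
  have := frieze_ptolemy n4 hm abc cd; have := frieze_ptolemy n4 hm' abc cd.
  have : m' a%:Z c%:Z = 1 by apply/eqP; rewrite -[_ == _]/(ones m' a c) -mm' //; lia.
  by rewrite e1 e2 e3 e4 e5 => -> <-; rewrite !mul1r.
- move=> {ab nab e} {}a {}b c d abc cd obd e1 e2 e3 e4 e5.
  have := frieze_ptolemy n4 hm abc cd; have := frieze_ptolemy n4 hm' abc cd.
  have : m' b%:Z d%:Z = 1 by apply/eqP; rewrite -[_ == _]/(ones m' b d) -mm' //; lia.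
  by rewrite e1 e2 e3 e4 e5 => -> <-; rewrite !mulr1.
Qed.

Definition sg u : int := if odd (absz u) then -1 else 1.

Lemma sgS u : sg (u + 1) = - sg u.
Proof.
rewrite /sg; suff -> : odd (absz (u + 1)%R) = ~~ odd (absz u) by case: (odd _).
by lia.
Qed.

Lemma sg_sq u : sg u * sg u = 1. Proof. by rewrite /sg; case: ifP. Qed.

Lemma triangulation_frieze (s : rel nat) : triangulation n s ->
  exists m, CC_frieze (n - 3) m /\ forall a b : nat, (a < b < n)%N -> ones m a b = s a b.
Proof.
move=> hs; have [|v vP] := tri_vectors hs; first lia.
(* The [n] vectors are continued antiperiodically, [V (i + n) = - V i]. The sign keeps
   [det2 (V j) (V (i + n))] equal to [det2 (V i) (V j)], hence positive, when a pair wraps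
   around. *)
pose V (i : int) : int * int :=
  let: w := v (absz (i %% n%:Z)%Z) in
  (sg (i %/ n%:Z)%Z * w.1, sg (i %/ n%:Z)%Z * w.2).
have VE u (a : nat) : (a < n)%N -> V (u * n%:Z + a%:Z) = (sg u * (v a).1, sg u * (v a).2).
  move=> an; rewrite /V modzMDl divzMDl; last by lia.
  by rewrite divz_small ?modz_small ?addr0 //; lia.
have Vdet u (a b : nat) : (a < n)%N -> (b < n)%N ->
    det2 (V (u * n%:Z + a%:Z)) (V (u * n%:Z + b%:Z)) = det2 (v a) (v b).
  move=> an bn; rewrite !VE // /det2 /=.
  by rewrite -[RHS]mul1r -(sg_sq u); ring.
have VdetS u (a b : nat) : (a < n)%N -> (b < n)%N ->
    det2 (V (u * n%:Z + a%:Z)) (V ((u + 1) * n%:Z + b%:Z)) = det2 (v b) (v a).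
  move=> an bn; rewrite !VE // sgS /det2 /=.
  by rewrite -[RHS]mul1r -(sg_sq u); ring.
pose m i j := det2 (V i) (V j); exists m.
have dec i j : i <= j <= i + n%:Z -> exists u (a b : nat), [/\ (a < n)%N, (b < n)%N &
    i = u * n%:Z + a%:Z] /\ ((a <= b)%N /\ j = u * n%:Z + b%:Z \/
      (b <= a)%N /\ j = (u + 1) * n%:Z + b%:Z).
  move=> ij; have n0 : n%:Z != 0 by lia.
  have := divz_eq i n%:Z; have := ltz_mod i n0; have := modz_ge0 i n0.
  move: (i %/ n%:Z)%Z (i %% n%:Z)%Z => u a a0 an iE.
  have [jn|jn] := ltP (j - u * n%:Z) n%:Z.
    exists u, (absz a), (absz (j - u * n%:Z)%R); split; first by split; lia.
    by left; lia.
  exists u, (absz a), (absz (j - u * n%:Z - n%:Z)%R); split; first by split; lia.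
  by right; lia.
have side i : m i (i + 1) = 1.
  have [|u [a [b [[an bn iE] h]]]] := @dec i (i + 1); first lia.
  rewrite /m; case: h => -[ab jE]; rewrite jE iE ?Vdet ?VdetS //.
    have -> : b = a.+1 by lia.
    by apply/(vP a a.+1 _).2; [lia|apply: tri_side hs _; lia].
  have [-> ->] : b = 0%N /\ a = n.-1 by lia.
  by apply/(vP 0%N n.-1 _).2; [lia|apply: tri_top hs _; lia].
have Vn i : V (i + n%:Z) = (- (V i).1, - (V i).2).
  have [|u [a [b [[an _ ->] _]]]] := @dec i i; first lia.
  have -> : u * n%:Z + a%:Z + n%:Z = (u + 1) * n%:Z + a%:Z by ring.
  by rewrite !VE // sgS /= !mulNr.
split; first split.
- move=> i; rewrite /m det2_self; split=> //.
  have -> : i + (n - 3)%:Z + 3 = i + n%:Z by lia.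
  by rewrite Vn /det2 /=; ring.
- move=> i; split; first exact: side.
  have -> : i + (n - 3)%:Z + 2 = i - 1 + n%:Z by lia.
  by apply: etrans (side (i - 1)); rewrite /m Vn subrK /det2 /=; ring.
- move=> i j ij; have [|u [a [b [[an bn iE] h]]]] := @dec i j; first lia.
  rewrite /m; case: h => -[ab jE]; rewrite jE iE ?Vdet ?VdetS //.
    by have [] := vP a b _; lia.
  by have [] := vP b a _; lia.
(* The frieze rule is the Plücker relation for [i, i + 1, j, j + 1], two of whose sides are 1. *)
- move=> i j ij; rewrite /m.
  have := plucker (V i) (V (i + 1)) (V j) (V (j + 1)).
  rewrite -![det2 (V _) (V _)]/(m _ _) !side; lia.
move=> a b ab; rewrite /ones /m.
have -> : det2 (V a%:Z) (V b%:Z) = det2 (v a) (v b).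
  by have := Vdet 0 a b; rewrite mul0r !add0r; apply; lia.
by have [_ h] := vP a b ab; apply/eqP/idP => /h.
Qed.

End Correspondence.

(** * Modules attached to chords *)

Section Chords.
Variables (R : realType) (n : nat) (zeta : R[i]).
Hypotheses (n4 : (4 <= n)%N) (hz : n.-primitive_root zeta).

Local Notation obj := (obj n zeta).
Local Notation M := (Mod hz).
Local Notation od := (od hz).
Local Notation at_pos := (in_pos hz).
Implicit Types (I J K : twoset n).

Let n_gt0 : (0 < n)%N := prim_order_gt0 hz.
Let n2 : (2 <= n)%N. Proof. by apply: leq_trans n4. Qed.

Lemma val_od k : (k < n)%N -> od k = k :> nat.
Proof. exact: modn_small. Qed.

Lemma od_neq i j : (i < j < n)%N -> od i != od j.
Proof.
move=> ij; apply/eqP => /(congr1 val) /=; rewrite !modn_small; lia.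
Qed.

Fact od01 : od 0 != od 1.
Proof. by apply: od_neq; lia. Qed.

(* Junk unless i < j < n. *)
Definition chord (i j : nat) : twoset n := insubd (tw od01) [set od i; od j].

Lemma val_chord i j : (i < j < n)%N -> val (chord i j) = [set od i; od j].
Proof. by move=> ij; rewrite insubdK // -topredE /= cards2 od_neq. Qed.

Lemma at_chord i j k : (i < j < n)%N ->
  at_pos (chord i j) k = (k %% n == i)%N || (k %% n == j)%N.
Proof.
move=> ij; rewrite /in_pos val_chord // in_set2.
by congr (_ || _); rewrite -val_eqE /= [X in (_ == X) = _]modn_small //; lia.
Qed.

Lemma chordP I : exists i j, (i < j < n)%N /\ I = chord i j.
Proof.
suff main (x y : 'I_n) : (x < y)%N -> val I = [set x; y] ->
    exists i j, (i < j < n)%N /\ I = chord i j.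
  have /cards2P[x [y [xy Ixy]]] : #|val I| == 2%N := valP I.
  case: (ltngtP x y) => [xy'|yx|/val_inj e]; first exact: main Ixy.
    by apply: main yx _; rewrite Ixy setUC.
  by rewrite e eqxx in xy.
move=> xy Ixy; have h : (x < y < n)%N by rewrite xy /=.
by exists x, y; split=> //; apply: val_inj; rewrite val_chord // !od_val -Ixy.
Qed.

Lemma chord_inj i j k l : (i < j < n)%N -> (k < l < n)%N ->
  chord i j = chord k l -> i = k /\ j = l.
Proof.
move=> ij kl e; have h p : at_pos (chord i j) p = at_pos (chord k l) p by rewrite e.
have [i0 j0 k0 l0] : [/\ (i < n)%N, (j < n)%N, (k < n)%N & (l < n)%N] by split; lia.
have := h i; have := h j; rewrite !at_chord // !modn_small //.
by have := h k; have := h l; rewrite !at_chord // !modn_small //; lia.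
Qed.

Lemma mod_wrap x : (x < n + n)%N -> (x %% n = if x < n then x else x - n)%N.
Proof.
move=> xn; case: ltnP => h; first by rewrite modn_small.
by rewrite -[in LHS](subnK h) modnDr modn_small //; lia.
Qed.

(** For noncrossing chords the circle can be cut into two arcs such that on the first every end of
    [{i, j}] is an end of [{k, l}], and on the second every end of [{k, l}] is an end of [{i, j}].
    In [main] the arcs are the positions up to [m + k0] and those after it. *)
Lemma noncrossing_lifts i j k l : (i < j < n)%N -> (k < l < n)%N ->
  ~~ crosses i j k l -> lifts (M (chord i j)) (M (chord k l)).
Proof.
move=> ij kl; rewrite /crosses => nc.
have main m k0 : (m < n)%N -> (k0 <= n)%N ->
    (forall x, (m < x <= m + k0)%N -> [|| x == i, x == i + n, x == j | x == j + n]%N ->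
       [|| x == k, x == k + n, x == l | x == l + n]%N) ->
    (forall x, (m + k0 < x <= m + n)%N ->
       [|| x == k, x == k + n, x == l | x == l + n]%N ->
       [|| x == i, x == i + n, x == j | x == j + n]%N) ->
    lifts (M (chord i j)) (M (chord k l)).
  move=> mn k0n h1 h2; apply: (lifts_Mod n2 (m := m) (k0 := k0)) => // x xk.
    rewrite !at_chord // !mod_wrap; [|lia..].
    by have := h1 (m + x.+1)%N; case: ifP; lia.
  rewrite !at_chord // !mod_wrap; [|lia..].
  by have := h2 (m + x.+1)%N; case: ifP; lia.
have [jk|kj] := leqP j k; first by apply: (main j (l - j)%N) => [||x|x]; lia.
have [li|il] := leqP l i; first by apply: (main j (l + n - j)%N) => [||x|x]; lia.
have [/andP[ik lj]|h] := boolP ((i <= k) && (l <= j))%N.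
  by apply: (main i (l - i)%N) => [||x|x]; lia.
by apply: (main j (k + n - j)%N) => [||x|x]; lia.
Qed.

Lemma od_succ x : (od x.+1 : nat) = if (od x).+1 == n then 0%N else (od x).+1.
Proof.
rewrite /= -addn1 -modnDml addn1; have : (x %% n < n)%N by rewrite ltn_pmod.
move: (x %% n)%N => y yn; case: eqP => [->|ne]; first by rewrite modnn.
by rewrite modn_small //; lia.
Qed.

Section Quadrilateral.
Variables a b c d : nat.
Hypotheses (abc : (a < b < c)%N) (cd : (c < d < n)%N).

Let ac_lt : (a < c < n)%N. Proof. by lia. Qed.
Let bd_lt : (b < d < n)%N. Proof. by lia. Qed.
Let ab_lt : (a < b < n)%N. Proof. by lia. Qed.
Let bc_lt : (b < c < n)%N. Proof. by lia. Qed.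
Let ad_lt : (a < d < n)%N. Proof. by lia. Qed.

(** Indicators of arcs. Raising the exponent of [t] on the arc from [x] to [y] replaces the element
    [y] of a 2-subset by [x]: [P] turns [{a, c}] into [{a, b}], [Q] turns it into [{c, d}], and both
    together into [{b, d}]. [P'] and [Q'] do the same for [{b, d}]. *)
Let P (x : 'I_n) : bool := (b <= x < c)%N.
Let Q (x : 'I_n) : bool := (x < a)%N || (d <= x)%N.
Let P' (x : 'I_n) : bool := (c <= x < d)%N.
Let Q' (x : 'I_n) : bool := (a <= x < b)%N.

Let at_succ i j x : (i < j < n)%N ->
  at_pos (chord i j) x.+1 = (od x.+1 == i :> nat) || (od x.+1 == j :> nat).
Proof. exact: at_chord. Qed.

Lemma crossing_ext :
  exists (E : extension (M (chord a c)) (M (chord b d)))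
         (E' : extension (M (chord b d)) (M (chord a c))),
    [/\ ~ ext_split E, ~ ext_split E',
        ext_mid E = dsum (M (chord a b)) (M (chord c d)),
        ext_mid E' = dsum (M (chord b c)) (M (chord a d)) &
        Ext1_dim1 (M (chord b d)) (M (chord a c))].
Proof.
have cd_lt : (c < d < n)%N := cd.
have PQ x : ~~ (P x && Q x) by rewrite /P /Q; lia.
have PQ' x : ~~ (P' x && Q' x) by rewrite /P' /Q'; lia.
have h1 k : (at_pos (chord a b) k.+1 + P (od k) =
             at_pos (chord a c) k.+1 + P (od k.+1))%N.
  rewrite !at_succ //; have := od_succ k; have := ltn_ord (od k).
  by move: (od k) (od k.+1) => x y; rewrite /P; case: ifP; lia.
have h2 k : (at_pos (chord c d) k.+1 + Q (od k) =
             at_pos (chord a c) k.+1 + Q (od k.+1))%N.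
  rewrite !at_succ //; have := od_succ k; have := ltn_ord (od k).
  by move: (od k) (od k.+1) => x y; rewrite /Q; case: ifP; lia.
have h3 k : (at_pos (chord b d) k.+1 + (P (od k) + Q (od k)) =
             at_pos (chord a c) k.+1 + (P (od k.+1) + Q (od k.+1)))%N.
  rewrite !at_succ //; have := od_succ k; have := ltn_ord (od k).
  by move: (od k) (od k.+1) => x y; rewrite /P /Q; case: ifP; lia.
have h1' k : (at_pos (chord b c) k.+1 + P' (od k) =
              at_pos (chord b d) k.+1 + P' (od k.+1))%N.
  rewrite !at_succ //; have := od_succ k; have := ltn_ord (od k).
  by move: (od k) (od k.+1) => x y; rewrite /P'; case: ifP; lia.
have h2' k : (at_pos (chord a d) k.+1 + Q' (od k) =
              at_pos (chord b d) k.+1 + Q' (od k.+1))%N.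
  rewrite !at_succ //; have := od_succ k; have := ltn_ord (od k).
  by move: (od k) (od k.+1) => x y; rewrite /Q'; case: ifP; lia.
have h3' k : (at_pos (chord a c) k.+1 + (P' (od k) + Q' (od k)) =
              at_pos (chord b d) k.+1 + (P' (od k.+1) + Q' (od k.+1)))%N.
  rewrite !at_succ //; have := od_succ k; have := ltn_ord (od k).
  by move: (od k) (od k.+1) => x y; rewrite /P' /Q'; case: ifP; lia.
exists (cross_ext n2 PQ h1 h2 h3), (cross_ext n2 PQ' h1' h2' h3').
have ns : ~ ext_split (cross_ext n2 PQ h1 h2 h3).
  by apply: (cross_nonsplit (p := b) (q := d));
    rewrite /P /Q val_od; lia.
have ns' : ~ ext_split (cross_ext n2 PQ' h1' h2' h3').
  by apply: (cross_nonsplit (p := c) (q := a));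
    rewrite /P' /Q' val_od; lia.
split; [exact: ns|exact: ns'|by []|by []|].
exists (cross_ext n2 PQ' h1' h2' h3'); split; first exact: ns'.
by apply: cross_span; apply: noncrossing_lifts => //; rewrite /crosses; lia.
Qed.

Lemma crossing_Ext1 : ~ Ext1_zero (M (chord a c)) (M (chord b d)) /\
  ~ Ext1_zero (M (chord b d)) (M (chord a c)).
Proof.
have [E [E' [ns ns' _ _ _]]] := crossing_ext.
by split=> [/(_ E)|/(_ E')].
Qed.

End Quadrilateral.
Lemma crosses_Ext1 i j k l : (i < j < n)%N -> (k < l < n)%N -> crosses i j k l ->
  ~ Ext1_zero (M (chord i j)) (M (chord k l)).
Proof.
move=> ij kl /orP[/and3P[ik kj jl]|/and3P[ki il lj]].
  by have [] := @crossing_Ext1 i k j l ltac:(lia) ltac:(lia).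
by have [] := @crossing_Ext1 k i l j ltac:(lia) ltac:(lia).
Qed.

End Chords.

(** * Cluster tilting objects *)

Section ClusterTilting.
Variables (R : realType) (n : nat) (zeta : R[i]).
Hypotheses (n4 : (4 <= n)%N) (hz : n.-primitive_root zeta).

Local Notation obj := (obj n zeta).
Local Notation M := (Mod hz).
Local Notation chord := (chord n4 hz).
Local Notation dsm := (mod_sum hz).
Implicit Types (A B C T : obj) (I J K : twoset n) (s : seq (twoset n)).

Let n2 : (2 <= n)%N. Proof. by apply: leq_trans n4. Qed.

Lemma summand_refl A : summand A A.
Proof. by exists zero_obj; apply: dsum_zeror (iso_refl _). Qed.

Lemma summand_trans A B C : summand A B -> summand B C -> summand A C.
Proof.
case=> D iD [E iE]; exists (dsum D E); apply: iso_trans (dsumA _ _ _) _.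
exact: iso_trans (dsum_cong iD (iso_refl E)) iE.
Qed.

Lemma dsums_const m T : dsums (fun _ : 'I_m => T) = iter m (dsum T) zero_obj.
Proof.
rewrite /dsums -[in RHS](size_enum_ord m); elim: (enum _) => //= _ e ->.
exact: erefl.
Qed.

Lemma iter_dsum T s m : iso T (dsm s) ->
  iso (iter m (dsum T) zero_obj) (dsm (flatten (nseq m s))).
Proof.
move=> iT; elim: m => [|m IH]; first exact: iso_refl.
exact: iso_trans (dsum_cong iT IH) (iso_sym (dsm_cat _ _ _)).
Qed.

Lemma mem_flatten_nseq m s I : I \in flatten (nseq m s) -> I \in s.
Proof. by case/flattenP => s'; rewrite mem_nseq => /andP[_ /eqP ->]. Qed.

Section AddT.
Variables (T : obj) (s : seq (twoset n)).
Hypothesis iT : iso T (dsm s).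

Lemma summand_T I : summand (M I) T <-> I \in s.
Proof.
split; first exact: summand_dsm.
by move=> Is; apply: summand_iso (iso_refl _) (iso_sym iT) (dsm_summand _ Is).
Qed.

Lemma in_add_Mod I A : in_add T A -> summand (M I) A -> I \in s.
Proof.
case=> m; rewrite dsums_const => sA sI.
exact: mem_flatten_nseq (summand_dsm (iter_dsum m iT) (summand_trans sI sA)).
Qed.

Lemma in_addP A : in_add T A <-> exists2 s', iso A (dsm s') & {subset s' <= s}.
Proof.
split=> [addA|[s' iA s's]].
  have [s' iA] := classification n2 hz A; exists s' => // I Is'.
  apply: in_add_Mod addA _.
  exact: summand_iso (iso_refl _) (iso_sym iA) (dsm_summand _ Is').
suff [m sm] : exists m, summand (dsm s') (iter m (dsum T) zero_obj).
  exists m; rewrite dsums_const.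
  exact: summand_iso (iso_sym iA) (iso_refl _) sm.
elim: s' s's {iA} => [|I s' IH] ss; first by exists 0%N; apply: summand_refl.
have [|m sm] := IH; first by move=> J Js; apply: ss; rewrite in_cons Js orbT.
exists m.+1; apply: summand_dsum sm; apply/summand_T.
by apply: ss; apply: mem_head.
Qed.

Lemma in_add_T I : I \in s -> in_add T (M I).
Proof.
move=> Is; apply/in_addP; exists [:: I].
  exact: iso_sym (dsum_zeror _ (iso_refl _)).
by move=> J; rewrite inE => /eqP ->.
Qed.

End AddT.

Lemma dsums_cong k (F G : 'I_k -> obj) : (forall i, iso (F i) (G i)) ->
  iso (dsums F) (dsums G).
Proof.
move=> FG; rewrite /dsums; elim: (enum _) => [|i e IH]; first exact: iso_refl.
exact: dsum_cong (FG i) IH.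
Qed.

Lemma basicP T : basic T <-> exists2 s, uniq s & iso T (dsm s).
Proof.
split=> [[k [F [indF injF iT]]]|[s us iT]].
  have /choice[f fP] : forall i, exists I, iso (F i) (M I).
    by move=> i; apply: (indecomposable_Mod n2).
  exists [seq f i | i <- enum 'I_k].
    rewrite map_inj_uniq ?enum_uniq // => i j e; apply: injF.
    by apply: iso_trans (fP i) _; rewrite e; apply: iso_sym.
  apply: iso_trans iT _; apply: iso_trans (dsums_cong fP) _.
  rewrite /mod_sum -map_comp; exact: iso_refl.
exists (size s), (fun i => M (tnth (in_tuple s) i)); split.
- by move=> i; apply: (Mod_indecomposable n2).
- move=> i j /Mod_inj/eqP; have x0 := tnth (in_tuple s) i.
  rewrite !(tnth_nth x0) nth_uniq ?ltn_ord // => /eqP; exact: val_inj.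
- apply: iso_trans iT _; rewrite /dsums /mod_sum.
  have -> : map M s = [seq M (tnth (in_tuple s) i) | i <- enum 'I_(size s)].
    rewrite [RHS](map_comp M); congr map; exact: esym (map_tnth_enum (in_tuple s)).
  exact: iso_refl.
Qed.

Definition chords T : rel nat := fun i j => chord i j \in summands hz T.

Lemma summandsE T s I : iso T (dsm s) -> (I \in summands hz T) = (I \in s).
Proof.
move=> iT; rewrite inE; apply/asboolP/idP; first by move/(summand_T iT).
by move=> Is; apply/(summand_T iT).
Qed.

Lemma summands_iso T T' : iso T T' -> summands hz T = summands hz T'.
Proof.
move=> TT'; have [s iT'] := classification n2 hz T'.
by apply/setP => I; rewrite (summandsE I iT') (summandsE I (iso_trans TT' iT')).
Qed.

Lemma basic_iso T T' : basic T -> basic T' -> summands hz T = summands hz T' -> iso T T'.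
Proof.
move=> /basicP[s us iT] /basicP[s' us' iT'] e.
apply: (iso_trans iT (iso_trans _ (iso_sym iT'))).
apply/dsm_perm/uniq_perm => // I.
by rewrite -(summandsE I iT) -(summandsE I iT') e.
Qed.

(** A chord crossing no summand of [T] lifts against each of them, hence against all of [add T]. It
    then lies in [add T], and by Krull-Schmidt it is a summand. *)
Lemma tilting_triangulation T : cluster_tilting T -> triangulation n (chords T).
Proof.
move=> cT; have [s iT] := classification n2 hz T.
have chE i j : chords T i j = (chord i j \in s) by rewrite /chords (summandsE _ iT).
move=> i j ij; split=> [sij k l kl skl|nc].
  apply/negP => cr; case: (crosses_Ext1 (n4 := n4) (hz := hz) ij kl cr).
  rewrite chE in sij; rewrite chE in skl.
  have [[h _] _] := cT (M (chord i j)).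
  by apply: h; [exact: (in_add_T iT)|exact: (in_add_T iT)].
rewrite chE; apply: (in_add_Mod iT) (summand_refl _).
apply/(cT _).1 => T' addT'; apply: lifts_Ext1.
have [s' iT' s's] := (in_addP iT T').1 addT'.
apply: lifts_isor (iso_sym iT') _.
apply: lifts_isol (dsum_zeror _ (iso_refl zero_obj)) _.
apply: (lifts_dsm (s := [:: chord i j])) => I J; rewrite inE => /eqP -> Js.
have [k [l [kl JE]]] := chordP n4 hz J; rewrite JE; apply: noncrossing_lifts => //.
by apply: nc => //; rewrite chE -JE; apply: s's.
Qed.

Lemma triangulation_tilting (t : rel nat) : triangulation n t ->
  exists T, basic_cluster_tilting T /\
    forall i j, (i < j < n)%N -> chords T i j = t i j.
Proof.
move=> ht; pose P I := `[< exists i j, [/\ (i < j < n)%N, t i j & I = chord i j] >].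
pose s := [seq I <- enum [set: twoset n] | P I].
have us : uniq s by rewrite filter_uniq // enum_uniq.
have memP I : (I \in s) = P I by rewrite mem_filter mem_enum in_setT andbT.
have mems i j : (i < j < n)%N -> (chord i j \in s) = t i j.
  move=> ij; rewrite memP; apply/asboolP/idP => [[k [l [kl tkl e]]]|tij].
    by have [-> ->] := chord_inj ij kl e.
  by exists i, j.
have Ts : iso (dsm s) (dsm s) := iso_refl _.
exists (dsm s); split; last by move=> i j ij; rewrite /chords (summandsE _ Ts) mems.
have lif I J : I \in s -> J \in s -> lifts (M I) (M J).
  rewrite !memP => /asboolP[i [j [ij tij ->]]] /asboolP[k [l [kl tkl ->]]].
  by apply: noncrossing_lifts => //; apply: tri_nocross ht _ _ tij tkl.
have addE A : in_add (dsm s) A <-> forall I, summand (M I) A -> I \in s.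
  split=> [addA I sI|h]; first exact: (in_add_Mod Ts addA sI).
  have [s' iA] := classification n2 hz A; apply/(in_addP Ts); exists s' => // I Is'.
  exact: h (summand_iso (iso_refl _) (iso_sym iA) (dsm_summand _ Is')).
have ext0 A A' : in_add (dsm s) A -> in_add (dsm s) A' -> Ext1_zero A A'.
  move=> /(in_addP Ts)[s1 i1 h1] /(in_addP Ts)[s2 i2 h2]; apply: lifts_Ext1.
  apply: lifts_isol (iso_sym i1) _; apply: lifts_isor (iso_sym i2) _.
  by apply: lifts_dsm => I J /h1 Is /h2 Js; apply: lif.
(* Crossing chords have nonzero extensions in both orders, so vanishing in either order is enough;
   each half of the tilting condition supplies one of them. *)
have max I : (forall J, J \in s -> Ext1_zero (M I) (M J)) \/
    (forall J, J \in s -> Ext1_zero (M J) (M I)) -> I \in s.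
  have [i [j [ij ->]]] := chordP n4 hz I => h; rewrite mems //; apply/(ht i j ij).
  move=> k l kl tkl; apply/negP => cr; case: h => /(_ (chord k l)).
    by rewrite mems // => /(_ tkl); apply: crosses_Ext1.
  rewrite mems // => /(_ tkl); apply: crosses_Ext1 => //.
  by move: cr; rewrite /crosses orbC.
split; last by apply/basicP; exists s.
move=> A; split; split=> [addA T' addT'|h].
- exact: ext0.
(* An arbitrary object is tested on its rank one summands, to which vanishing passes. *)
- apply/addE => I [B iB]; apply: max; left => J Js.
  exact: Ext1_summand_l (iso_sym iB) (h _ (in_add_T Ts Js)).
- exact: ext0.
- apply/addE => I [B iB]; apply: max; right => J Js.
  exact: Ext1_summand_r (iso_sym iB) (h _ (in_add_T Ts Js)).
Qed.

End ClusterTilting.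

(** * Values of cluster characters *)

Section Values.
Variable k : nat.
Local Notation F := {fraction {mpoly rat[k]}}.
Implicit Types (f g : F) (u v w : rat).

Lemma tofrac_ones_neq0 (P : {mpoly rat[k]}) : P.@[fun=> 1] != 0 -> tofrac P != 0.
Proof. by rewrite tofrac_eq0; apply: contraNneq => ->; rewrite meval0. Qed.

Lemma value_var i : value_at_ones (tofrac 'X_i : F) 1.
Proof.
by exists 'X_i, 1; rewrite meval1 mevalXU tofrac1 !divr1 oner_eq0.
Qed.

Lemma value_add f g v w : value_at_ones f v -> value_at_ones g w ->
  value_at_ones (f + g) (v + w).
Proof.
case=> P [Q [Q0 -> ->]] [P' [Q' [Q0' -> ->]]].
exists (P * Q' + P' * Q), (Q * Q'); rewrite mevalM mulf_neq0 //; split=> //.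
  by rewrite addf_div ?tofrac_ones_neq0 // tofracD !tofracM.
by rewrite addf_div // mevalD !mevalM.
Qed.

Lemma value_mul f g v w : value_at_ones f v -> value_at_ones g w ->
  value_at_ones (f * g) (v * w).
Proof.
case=> P [Q [Q0 -> ->]] [P' [Q' [Q0' -> ->]]].
exists (P * P'), (Q * Q'); rewrite mevalM mulf_neq0 //; split=> //.
  by rewrite mulf_div !tofracM.
by rewrite mulf_div mevalM.
Qed.

Lemma value_inv f v : v != 0 -> value_at_ones f v -> f != 0 /\ value_at_ones f^-1 v^-1.
Proof.
move=> v0 [P [Q [Q0 fE vE]]]; have P0 : P.@[fun=> 1] != 0.
  by apply: contraNneq v0 => P0; rewrite vE P0 mul0r.
rewrite fE vE !invf_div; split; last by exists Q, P.
by rewrite mulf_neq0 ?invr_eq0 ?tofrac_ones_neq0.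
Qed.

(** An element with a nonzero value is a unit of the local ring at the point of ones, so
    [g = f^-1 * (f * g)] is defined there. *)
Lemma value_cancel f g v w : value_at_ones f v -> v != 0 ->
  value_at_ones (f * g) (v * w) -> value_at_ones g w.
Proof.
move=> fv v0 fgw; have [f0 fV] := value_inv v0 fv.
by rewrite -(mulKf f0 g) -(mulKf v0 w); apply: value_mul.
Qed.

End Values.

(** * Cluster characters evaluated at ones *)

Section Main.
Variables (R : realType) (n : nat) (zeta : R[i]).
Hypotheses (n4 : (4 <= n)%N) (hz : n.-primitive_root zeta).

Local Notation M := (Mod hz).
Local Notation chord := (chord n4 hz).
Local Notation chords := (chords n4 hz).

Lemma character_ptolemy T (X : obj n zeta -> clfield hz T) a b c d :
  cluster_character X -> (a < b < c)%N -> (c < d < n)%N ->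
  X (M (chord a c)) * X (M (chord b d)) =
    X (M (chord a b)) * X (M (chord c d)) + X (M (chord a d)) * X (M (chord b c)).
Proof.
case=> _ Xsum Xext _ abc cd.
have [E [E' [ns ns' midE midE' dim1]]] := crossing_ext n4 hz abc cd.
apply: etrans (Xext _ _ dim1 E E' ns ns') _; rewrite midE midE'.
apply: etrans (congr2 +%R (Xsum _ _) (Xsum _ _)) _; congr (_ + _); exact: mulrC.
Qed.

(** The character and the frieze satisfy the same Ptolemy relations and agree on the chords of [T].
    At each exchange the known diagonal has a positive frieze entry as value, so [value_cancel]
    applies. *)
Lemma character_value T (X : obj n zeta -> clfield hz T) m :
  cluster_character X -> CC_frieze (n - 3) m -> triangulation n (chords T) ->
  (forall a b : nat, (a < b < n)%N -> ones m a b = chords T a b) ->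
  forall a b : nat, (a < b < n)%N ->
    value_at_ones (X (M (chord a b))) (m a%:Z b%:Z)%:~R.
Proof.
move=> hX hm hT mT.
have m1 (a b : nat) : (a < b < n)%N -> chords T a b -> m a%:Z b%:Z = 1.
  by move=> ab tab; apply/eqP; rewrite -[_ == _]/(ones m a b) mT.
have nz (a b : nat) : (a < b < n)%N -> (m a%:Z b%:Z)%:~R != 0 :> rat.
  by move=> ab; rewrite intr_eq0 gt_eqF // (frieze_pos n4 hm).
have split_ (x y z u v w : int) : x * y = z * u + v * w ->
    x%:~R * y%:~R = z%:~R * u%:~R + v%:~R * w%:~R :> rat.
  by move=> /(congr1 (fun x : int => x%:~R : rat)); rewrite rmorphD !rmorphM.
apply: (tri_ind hT).
- move=> a b ab tab; rewrite (m1 a b ab tab).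
  have [_ _ _ Xvar] := hX; rewrite (Xvar _ tab); exact: value_var.
- move=> a b c d abc cd _ vab vbc vcd vad vac.
  apply: value_cancel vac _ _; first by apply: nz; lia.
  rewrite (character_ptolemy hX abc cd) (split_ _ _ _ _ _ _ (frieze_ptolemy n4 hm abc cd)).
  by apply: value_add; apply: value_mul.
- move=> a b c d abc cd _ vab vbc vcd vad vbd.
  apply: value_cancel vbd _ _; first by apply: nz; lia.
  rewrite mulrC (character_ptolemy hX abc cd) [X in value_at_ones _ X]mulrC.
  rewrite (split_ _ _ _ _ _ _ (frieze_ptolemy n4 hm abc cd)).
  by apply: value_add; apply: value_mul.
Qed.

(** [is_pair] leaves open which residue is the smaller one, whereas [chord] wants it first; the
    residues differ because [I] has two elements. *)
Lemma pair_chord i j (I : twoset n) (a b : nat) : is_pair i j I -> (a <= b < n)%N ->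
  (a%:Z = i %[mod n%:Z])%Z /\ (b%:Z = j %[mod n%:Z])%Z \/
  (b%:Z = i %[mod n%:Z])%Z /\ (a%:Z = j %[mod n%:Z])%Z ->
  (a < b < n)%N /\ I = chord a b.
Proof.
case=> x [y [xi yj Ixy]] ab h.
have modE (p q : nat) : (p < n)%N -> (q < n)%N -> (p%:Z = q%:Z %[mod n%:Z])%Z -> p = q.
  by move=> pn qn; rewrite !modz_nat => -[]; rewrite !modn_small.
have [an bn] : (a < n)%N /\ (b < n)%N by lia.
have xy : x != y.
  apply/eqP => e; have := valP I; rewrite Ixy e setUid cards1.
  by [].
have Iab : val I = [set od hz a; od hz b] /\ a <> b.
  case: h => -[ha hb].
    have ea : a = x by apply: modE => //; rewrite ha -xi.
    have eb : b = y by apply: modE => //; rewrite hb -yj.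
    rewrite ea eb !od_val; split; first exact: Ixy.
    by move=> /val_inj e; rewrite e eqxx in xy.
  have eb : b = x by apply: modE => //; rewrite ha -xi.
  have ea : a = y by apply: modE => //; rewrite hb -yj.
  rewrite ea eb !od_val setUC; split; first exact: Ixy.
  by move=> /val_inj e; rewrite e eqxx in xy.
have ab' : (a < b < n)%N by case: Iab => _; lia.
by split=> //; apply: val_inj; rewrite val_chord //; case: Iab.
Qed.

End Main.

Theorem proposition4p5 (R : realType) (n : nat) (hn : (4 <= n)%N)
    (zeta : R[i]) (hz : n.-primitive_root zeta) :
  exists frieze : obj n zeta -> int -> int -> int,
    [/\ (forall T, basic_cluster_tilting T -> CC_frieze (n - 3) (frieze T)),
        (forall T T', basic_cluster_tilting T -> basic_cluster_tilting T' ->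
           iso T T' <-> same_frieze (n - 3) (frieze T) (frieze T')),
        (forall m, CC_frieze (n - 3) m ->
           exists T, basic_cluster_tilting T /\
                     same_frieze (n - 3) (frieze T) m) &
        (forall T, basic_cluster_tilting T ->
           forall X : obj n zeta -> clfield hz T,
             cluster_character X -> obtained_from X (frieze T))].
Proof.
(* The frieze of [T] is selected by its entries 1, hence without any character; objects that are not
   basic cluster tilting receive the zero array as a default. *)
have /choice[frieze friezeP] : forall T : obj n zeta, exists m,
    basic_cluster_tilting T -> CC_frieze (n - 3) m /\
      forall a b : nat, (a < b < n)%N -> ones m a b = chords hn hz T a b.
  move=> T; have [[cT _]|nT] := pselect (basic_cluster_tilting T).
    by have [m mP] := triangulation_frieze hn (tilting_triangulation hn hz cT); exists m.
  by exists (fun _ _ => 0).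
exists frieze; split.
- by move=> T /friezeP[].
- move=> T T' bT bT'; have [hm mT] := friezeP T bT; have [hm' mT'] := friezeP T' bT'.
  split=> [TT'|same].
    apply: (ones_inj hn hm hm') => a b ab; rewrite mT // mT' // /chords.
    by rewrite (summands_iso hn hz TT').
  apply: (basic_iso hn (hz := hz) (proj2 bT) (proj2 bT')); apply/setP => I.
  have [a [b [ab ->]]] := chordP hn hz I.
  rewrite -[LHS]/(chords hn hz T a b) -[RHS]/(chords hn hz T' a b) -mT // -mT' //.
  by rewrite /ones same //; lia.
- move=> m hm.
  have [T [bT tT]] := triangulation_tilting hn hz (ones_triangulation hn hm).
  exists T; split=> //; have [hm' mT] := friezeP T bT.
  by apply: (ones_inj hn hm' hm) => a b ab; rewrite mT // tT.
- move=> T bT X hX; have [hm mT] := friezeP T bT; split.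
    by move=> i; rewrite (frieze0 hm) (frieze0n hn hm).
  move=> i j I ij Iij; have [|a [b [ab e h]]] := @frieze_normal n hn i j; first lia.
  rewrite (e _ hm); have [ab' ->] := pair_chord hn hz Iij ab h.
  apply: (character_value hX hm _ mT) => //.
  exact: (tilting_triangulation hn hz (proj1 bT)).
Qed.
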